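(* Let $V=\mathrm{Sym}(3,\mathbb{C})$ be the space of complex symmetric $3\times 3$ matrices, with $G=\mathrm{SL}(3,\mathbb{C})$ acting by $g\cdot x=gxg^t$, and let $A(4)=\mathbb{C}[4V]^G$ be the algebra of polynomial functions on $4V=V\oplus V\oplus V\oplus V$ invariant under the diagonal action of $G$. Then the algebra $A(4)$ is generated by the polarizations of $\det x$ and of $f(\mathrm{n}(x),\mathrm{n}(y),\mathrm{n}(z))$.
   Context: $f$ denotes the symmetric trilinear form on $V$ obtained by full polarization of $\det$, normalized by $f(x,x,x)=6\det x$; equivalently $f(x,y,z)$ is the coefficient of $abc$ in $\det(ax+by+cz)$. The map $\mathrm{n}:V\to V$ is the quadratic map sending $x$ to its adjugate matrix (transpose of the cofactor matrix). Polarizations: for $q\le p$, a polynomial $F$ on $qV$ is regarded as a polynomial on $pV$ depending only on the first $q$ variables. The group $\mathrm{GL}(p,\mathbb{C})$ acts on $pV\cong \mathbb{C}^p\otimes V$ through the first factor, hence on $\mathbb{C}[pV]$. The polarizations of $F$ (on $pV$) are the elements of the $\mathrm{GL}(p,\mathbb{C})$-submodule of $\mathbb{C}[pV]$ generated by $F$; equivalently, the elements of the smallest subspace containing $F$ and stable under all polarization operators $D_{ij}$, $(D_{ij}H)(x_1,\dots,x_p)=\frac{d}{ds}\big|_{s=0}H(x_1,\dots,x_i+s x_j,\dots,x_p)$, $1\le i,j\le p$. Here $p=4$. *)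

(* Defs.v *)
From HB Require Import structures.
From mathcomp Require Import all_boot all_order all_algebra.
From mathcomp Require Import boolp classical_sets functions reals.
From mathcomp Require Import complex mpoly.

Set Implicit Arguments.
Unset Strict Implicit.
Unset Printing Implicit Defensive.

Import GRing.Theory.
Local Open Scope classical_set_scope.
Local Open Scope ring_scope.

(* The field of complex numbers is R[i], for R an arbitrary model of the reals. *)

Section SymmetricMatrices.
Variable R : realType.

Definition is_sym : {pred 'M[R[i]]_3} := fun A => A^T == A.

Lemma is_sym_submod_closed : submod_closed is_sym.
Proof.
split=> [|a A B]; rewrite !unfold_in; first by rewrite trmx0.
by move=> /eqP hA /eqP hB; rewrite linearP /= hA hB.
Qed.

HB.instance Definition _ :=
  GRing.isSubmodClosed.Build R[i] 'M[R[i]]_3 is_sym is_sym_submod_closed.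

Record sym3 := Sym3 { mx_of_sym3 :> 'M[R[i]]_3; _ : mx_of_sym3 \in is_sym }.

HB.instance Definition _ := [isSub for mx_of_sym3].
HB.instance Definition _ := [Choice of sym3 by <:].
HB.instance Definition _ := [SubChoice_isSubLmodule of sym3 by <:].

Lemma tr_sym3 (x : sym3) : (x : 'M[R[i]]_3)^T = x.
Proof. by apply/eqP; case: x. Qed.

Lemma sl_act_subproof (g : 'M[R[i]]_3) (x : sym3) : g *m x *m g^T \in is_sym.
Proof. by rewrite unfold_in !trmx_mul trmxK tr_sym3 mulmxA. Qed.

Definition sl_act (g : 'M[R[i]]_3) (x : sym3) : sym3 :=
  Sym3 (sl_act_subproof g x).

Lemma adj_sym3_subproof (x : sym3) : \adj (x : 'M[R[i]]_3) \in is_sym.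
Proof. by rewrite unfold_in trmx_adj tr_sym3. Qed.

Definition adj_sym3 (x : sym3) : sym3 := Sym3 (adj_sym3_subproof x).

(* The coefficient of abc in det (a x + b y + c z), where the indeterminates
   a, b, c are 'X_0, 'X_1, 'X_2. *)
Definition polar_det (x y z : sym3) : R[i] :=
  let gen (t : sym3) : 'M[{mpoly R[i][3]}]_3 := map_mx (@mpolyC 3 R[i]) t in
  (\det ('X_0 *: gen x + 'X_1 *: gen y + 'X_2 *: gen z))
    @_[multinom 1%N | _ < 3].

End SymmetricMatrices.

Section FunctionsOnCopies.
Variable R : realType.

Definition copies (p : nat) := {ffun 'I_p -> sym3 R}.

(* The entries (i, j) and (j, i) of a component give the same function: these
   coordinates are redundant, but their polynomials are exactly the polynomial
   functions on the space. *)
Definition coords p (x : copies p) (t : 'I_#|{: 'I_p * 'I_3 * 'I_3}|) : R[i] :=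
  let: (k, i, j) := enum_val t in x k i j.

Definition polynomial_function p (F : copies p -> R[i]) : Prop :=
  exists P : {mpoly R[i][#|{: 'I_p * 'I_3 * 'I_3}|]},
    forall x, F x = P.@[coords x].

Definition invariants p : set (copies p -> R[i]) :=
  [set F : copies p -> R[i] | polynomial_function F /\
     forall g : 'M[R[i]]_3, \det g = 1 ->
       forall x : copies p, F [ffun k => sl_act g (x k)] = F x].

Definition subalgebra (X : Type) (S : set (X -> R[i])) : Prop :=
  [/\ forall c : R[i], S (fun=> c),
      forall F G, S F -> S G -> S (F \+ G)
    & forall F G, S F -> S G -> S (F \* G)].

Definition generated_algebra (X : Type) (S : set (X -> R[i])) :=
  smallest (@subalgebra X) S.

Definition gl_act p (a : 'M[R[i]]_p) (x : copies p) : copies p :=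
  [ffun i => \sum_(j < p) a i j *: x j].

Definition gl_submodule p (M : set (copies p -> R[i])) : Prop :=
  [/\ M (fun=> 0),
      forall F G, M F -> M G -> M (F \+ G),
      forall (c : R[i]) F, M F -> M (fun x => c * F x)
    & forall (a : 'M[R[i]]_p) F, a \in unitmx -> M F ->
        M (fun x => F (gl_act (invmx a) x))].

Definition extend_vars q p (le_qp : (q <= p)%N) (F : copies q -> R[i]) :
    copies p -> R[i] :=
  fun x => F [ffun i => x (widen_ord le_qp i)].

Definition polarizations q p (le_qp : (q <= p)%N) (F : copies q -> R[i]) :
    set (copies p -> R[i]) :=
  smallest (@gl_submodule p) [set extend_vars le_qp F].

Definition det_fun (x : copies 1) : R[i] := \det (x ord0 : 'M[R[i]]_3).

Definition polar_det_adj_fun (x : copies 3) : R[i] :=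
  polar_det (adj_sym3 (x 0)) (adj_sym3 (x 1)) (adj_sym3 (x 2%R)).

End FunctionsOnCopies.

Arguments copies : clear implicits.
Arguments invariants : clear implicits.

(* Main.v *)
Require Import Defs.
From HB Require Import structures.
From mathcomp Require Import all_boot all_order all_algebra.
From mathcomp Require Import generic_quotient ring_quotient.
From mathcomp Require Import boolp classical_sets reals.
From mathcomp Require Import complex mpoly.
From mathcomp Require Import ring zify.

(** Let x_1, ..., x_4 be generic symmetric matrices, let theta be the polarized
    determinant and x # y the polarized cofactor matrix. By the polarization
    part of the argument (submodule_cubic, submodule_sextic) it is enough to
    generate the invariants by the cubics theta x_i x_j x_k and the sextics
    theta (x_i # x_j) (x_k # x_l) (x_m # x_n): a GL-submodule is closed under
    singular substitutions of the variables as well (submodule_subst), and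
    sums of the variables polarize everything that is needed. The converse
    inclusion holds because the invariants form a subalgebra and a
    GL-submodule.

    Hilbert's argument (generation) reduces this to ideal membership. If F is
    an invariant of degree 3 n, substituting g x g^T for x, with g generic,
    multiplies F by (det g)^(2 n). Cayley's operator in the entries of g, used
    2 n times, turns this power into a nonzero constant (Cayley). Applied to
    an expression of F in the ideal of the generators, it replaces the
    coefficients by invariants of lower degree, and induction finishes. Applied
    to the monomials of F, it shows that F is a combination of contraction
    graphs: cubic graphs whose edges are labelled by the x_i and whose
    vertices are Levi-Civita symbols (LOmega_monomial).

    So it has to be shown that every such graph lies in the ideal of the
    generators or, passing to the quotient, that all graphs vanish over a
    commutative ring in which all the generators vanish (graph_eq0). There,
    the words a p b q c ... in which letters a, b, c alternate with adjugates
    p = u # v satisfy many linear relations. A word with three adjugates has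
    nine letters, so that one of the four letters occurs three times, and the
    relations force it to be zero (word3_eq0). Hence the shorter words span a
    space W that is stable under all the operations needed: the cubic form
    vanishes on it (theta_words), and a cross product of elements of W is
    again the inner part of an element of W (inD_cross_words).

    Now let the edges of a graph be labelled by elements of W. A loop
    (loop_eq0) and a bigon (bigon_eq0) can be contracted to a single edge with
    a label in W, or to a closed factor that vanishes. In the absence of both,
    take an edge and the four further edges at its ends. Exchanging the labels
    of two of those five edges that meet changes the sign, up to graphs with
    fewer vertices (center_swap). A trace-free prefix u p of a label can be
    moved around a vertex by Leibniz's rule, which together with this
    antisymmetry makes all labels but single letters disappear
    (leibniz_alternating). Five labels out of four letters contain a repeated
    one, and so the graph vanishes. *)

Set Implicit Arguments.
Unset Strict Implicit.
Unset Printing Implicit Defensive.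

Import GRing.Theory Num.Theory.
Local Open Scope classical_set_scope.
Local Open Scope ring_scope.

(** * Cross products of matrices of order three *)

(* The entries become variables, so that ring does not compare matrices. *)
Ltac gen9 A := generalize (A 0 0) (A 0 1) (A 0 2) (A 1 0) (A 1 1) (A 1 2) (A 2 0) (A 2 1) (A 2 2); intros.

Section Cross.
Variable K : comNzRingType.
Implicit Types A B C M N P U V : 'M[K]_3.

(** cross x x is twice the cofactor matrix of x, and theta x x x is six times
    its determinant: these are the polarizations of the adjugate, up to
    transposition, and of the determinant. *)
Definition cross A B : 'M[K]_3 := \matrix_(i, j)
  (A (i + 1) (j + 1) * B (i + 2) (j + 2) + B (i + 1) (j + 1) * A (i + 2) (j + 2)
 - A (i + 1) (j + 2) * B (i + 2) (j + 1) - B (i + 1) (j + 2) * A (i + 2) (j + 1)).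

Definition theta A B C : K := \tr (A^T * cross B C).

Lemma ord3P (Q : 'I_3 -> Prop) : Q 0 -> Q 1 -> Q 2 -> forall i, Q i.
Proof.
move=> q0 q1 q2 [[|[|[|//]]] h]; [move: q0|move: q1|move: q2];
by congr Q; apply: val_inj.
Qed.

Lemma sum3E (V : nmodType) (F : 'I_3 -> V) : \sum_i F i = F 0 + F 1 + F 2.
Proof.
rewrite !big_ord_recl big_ord0 addr0 addrA; congr (_ + F _ + F _); exact: val_inj.
Qed.

Lemma add3E : (((0 + 1)%R = 1%R :> 'I_3) * ((0 + 2)%R = 2%R :> 'I_3)
  * ((1 + 1)%R = 2%R :> 'I_3) * ((1 + 2)%R = 0%R :> 'I_3)
  * ((2 + 1)%R = 0%R :> 'I_3) * ((2 + 2)%R = 1%R :> 'I_3))%type.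
Proof. by repeat split; apply: val_inj. Qed.

Lemma crossE A B i j : cross A B i j = A (i + 1) (j + 1) * B (i + 2) (j + 2) + B (i + 1) (j + 1) * A (i + 2) (j + 2)
 - A (i + 1) (j + 2) * B (i + 2) (j + 1) - B (i + 1) (j + 2) * A (i + 2) (j + 1).
Proof. by rewrite mxE. Qed.

Lemma mul3E A B i j : (A * B) i j = A i 0 * B 0 j + A i 1 * B 1 j + A i 2 * B 2 j.
Proof. by rewrite mxE sum3E. Qed.

Lemma tr3E A : \tr A = A 0 0 + A 1 1 + A 2 2.
Proof. by rewrite /mxtrace sum3E. Qed.
Lemma add3mxE A B i j : (A + B) i j = A i j + B i j. Proof. by rewrite mxE. Qed.
Lemma opp3mxE A i j : (- A) i j = - A i j. Proof. by rewrite mxE. Qed.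
Lemma tr3mxE A i j : (A^T) i j = A j i. Proof. by rewrite mxE. Qed.
Lemma scale3mxE a A i j : (a *: A) i j = a * A i j. Proof. by rewrite mxE. Qed.
Lemma mxE0 i j : (0 : 'M[K]_3) i j = 0. Proof. by rewrite mxE. Qed.
Lemma one3E : (((1 : 'M[K]_3)%R 0%R 0%R = 1%R) * ((1 : 'M[K]_3)%R 1%R 1%R = 1%R) * ((1 : 'M[K]_3)%R 2%R 2%R = 1%R)
 * ((1 : 'M[K]_3)%R 0%R 1%R = 0%R) * ((1 : 'M[K]_3)%R 0%R 2%R = 0%R) * ((1 : 'M[K]_3)%R 1%R 0%R = 0%R)
 * ((1 : 'M[K]_3)%R 1%R 2%R = 0%R) * ((1 : 'M[K]_3)%R 2%R 0%R = 0%R) * ((1 : 'M[K]_3)%R 2%R 1%R = 0%R))%type.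
Proof. by do ![split]; rewrite mxE. Qed.

Definition mx3E := (add3mxE, opp3mxE, tr3mxE, scale3mxE, mul3E, crossE, add3E, tr3E, one3E).

Ltac mx3 A B C := let i := fresh in let j := fresh in apply/matrixP; move=> i j; rewrite !(add3mxE, opp3mxE, scale3mxE) !tr3E !mul3E ?crossE ?mul3E ?tr3mxE ?crossE ?mul3E ?tr3mxE; move: i j; elim/ord3P; elim/ord3P; rewrite ?one3E !add3E; gen9 A; gen9 B; gen9 C; ring.

Lemma crossC A B : cross A B = cross B A.
Proof. apply/matrixP=> i j; rewrite !mxE; ring. Qed.

Lemma crossDl A B C : cross (A + B) C = cross A C + cross B C.
Proof. apply/matrixP=> i j; rewrite !mxE; ring. Qed.

Lemma crossZl a A B : cross (a *: A) B = a *: cross A B.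
Proof. apply/matrixP=> i j; rewrite !mxE; ring. Qed.

Lemma crossDr A B C : cross C (A + B) = cross C A + cross C B.
Proof. by rewrite crossC crossDl !(crossC C). Qed.

Lemma crossZr a A B : cross A (a *: B) = a *: cross A B.
Proof. by rewrite crossC crossZl crossC. Qed.

Lemma trmx_cross A B : (cross A B)^T = cross A^T B^T.
Proof. apply/matrixP=> i j; rewrite !mxE; ring. Qed.

(** The polarization of the product of a matrix and its adjugate. *)
Lemma theta_mul A B C :
  A^T * cross B C + B^T * cross C A + C^T * cross A B = theta A B C *: 1.
Proof. rewrite /theta; mx3 A B C. Qed.

(** Cofactor matrices transform by the cofactor matrix of the transformation.
    This is the derivative of that rule at the identity, in the direction M. *)
Lemma cross_der M A B :
  cross (M * A) B + cross A (M * B) + M^T * cross A B = \tr M *: cross A B.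
Proof. mx3 A B M. Qed.

Lemma cross_cross P U V : cross P (cross U V) =
  \tr (P^T * U) *: V + \tr (P^T * V) *: U - (U * P^T * V + V * P^T * U).
Proof. mx3 P U V. Qed.

Lemma tr_mul3 M N P : theta M N P = \tr M * \tr N * \tr P
  - \tr M * \tr (N * P) - \tr N * \tr (M * P) - \tr P * \tr (M * N)
  + \tr (M * N * P) + \tr (M * P * N).
Proof. rewrite /theta !mx3E; gen9 M; gen9 N; gen9 P; ring. Qed.

Lemma cross_adj M N : (cross M N)^T =
  M * N + N * M - \tr M *: N - \tr N *: M + (\tr M * \tr N - \tr (M * N)) *: 1.
Proof. mx3 M N N. Qed.

(** The polarized Cayley-Hamilton identity: each of its other terms contains
    one of the traces that vanish. *)
Lemma cayley_hamilton_polar M N P : \tr M = 0 -> \tr N = 0 -> \tr P = 0 ->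
  \tr (M * N) = 0 -> \tr (N * P) = 0 -> \tr (P * M) = 0 ->
  \tr (M * N * P) = 0 -> \tr (M * P * N) = 0 ->
  M * N * P + M * P * N + N * M * P + N * P * M + P * M * N + P * N * M = 0.
Proof.
move=> tM tN tP tMN tNP tPM tMNP tMPN.
have adj A B : \tr A = 0 -> \tr B = 0 -> \tr (A * B) = 0 -> (cross A B)^T = A * B + B * A.
  by move=> hA hB hAB; rewrite cross_adj hA hB hAB mulr0 subrr !scale0r !subr0 addr0.
have th : theta M N P = 0.
  rewrite tr_mul3 tM tN tP tMNP tMPN !mul0r !subr0 !addr0; by [].
have := congr1 trmx (theta_mul M N P).
have trM (A B : 'M[K]_3) : (A * B)^T = B^T * A^T by exact: trmx_mul.
rewrite th scale0r trmx0 !linearD /= !trM !trmxK !adj // !mulrDl => h.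
by rewrite -{}h; apply/matrixP=> i j; rewrite !add3mxE; ring.
Qed.
End Cross.

Local Notation "x '#' y" := (cross x y) (at level 30).

(** * Linear combinations of equations and alternating functions of four letters *)

(** A proof term such as h1 ⊞ h2 ⊟ 2 ⊡ h3 denotes a linear combination of
    equations; lc and lcm close a goal that is this combination up to ring
    identities, in a ring and entrywise for matrices. *)
Section Lc.
Variable V : zmodType.
Lemma lc_add (a b c d : V) : a = b -> c = d -> a + c = b + d. Proof. by move=> -> ->. Qed.
Lemma lc_sub (a b c d : V) : a = b -> c = d -> a - c = b - d. Proof. by move=> -> ->. Qed.
Lemma lc_mul (k : nat) (a b : V) : a = b -> a *+ k = b *+ k. Proof. by move=> ->. Qed.
Lemma lc_fin (a b c d : V) : c = d -> a - b = c - d -> a = b.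
Proof. by move=> -> /eqP; rewrite subrr subr_eq0 => /eqP. Qed.
End Lc.
Notation "a ⊞ b" := (lc_add a b) (at level 50, left associativity).
Notation "a ⊟ b" := (lc_sub a b) (at level 50, left associativity).
Notation "k ⊡ b" := (lc_mul k b) (at level 40, left associativity).
Ltac lc t := apply: (lc_fin t); ring.
Ltac lcm t := apply: (lc_fin t); let i := fresh in let j := fresh in
  apply/matrixP=> i j; rewrite !(add3mxE, opp3mxE, mulmxnE, mxE0); ring.

Section Alternating.
Variable K : comNzRingType.
Hypothesis reg2 : forall a : K, a + a = 0 -> a = 0.

Lemma anti_eq (a : K) : a = - a -> a = 0.
Proof. by move=> h; apply: reg2; rewrite {1}h addNr. Qed.

Lemma five_ord4 (a b c d f : 'I_4) : uniq [:: a; b; c; d; f] = false.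
Proof.
apply/negP=> /card_uniqP /= h.
by have := max_card (mem [:: a; b; c; d; f]); rewrite h card_ord.
Qed.

Lemma five_ord4P (a b c d f : 'I_4) :
  [\/ [\/ a = b, a = c, a = d | a = f], [\/ b = c, b = d | b = f], c = d \/ c = f | d = f].
Proof.
have := five_ord4 a b c d f; rewrite /= !inE.
case: (eqVneq a b) => [|_]; first by constructor 1; constructor 1.
case: (eqVneq a c) => [|_]; first by constructor 1; constructor 2.
case: (eqVneq a d) => [|_]; first by constructor 1; constructor 3.
case: (eqVneq a f) => [|_]; first by constructor 1; constructor 4.
case: (eqVneq b c) => [|_]; first by constructor 2; constructor 1.
case: (eqVneq b d) => [|_]; first by constructor 2; constructor 2.
case: (eqVneq b f) => [|_]; first by constructor 2; constructor 3.
case: (eqVneq c d) => [|_]; first by constructor 3; left.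
case: (eqVneq c f) => [|_]; first by constructor 3; right.
by case: (eqVneq d f) => // -> _; constructor 4.
Qed.

(** An alternating function of four letters is determined by its value at the
    four distinct ones, and x is among those. *)
Lemma alt4 (x : 'I_4) (f : 'I_4 -> 'I_4 -> 'I_4 -> 'I_4 -> K) :
  (forall a b c d, f a b c d = - f b a c d) ->
  (forall a b c d, f a b c d = - f a c b d) ->
  (forall a b c d, f a b c d = - f a b d c) ->
  (forall b c d, f x b c d = 0) -> forall a b c d, f a b c d = 0.
Proof.
move=> s1 s2 s3 f0 a b c d.
have e1 u v w : f u u v w = 0 by apply: anti_eq; exact: s1.
have e2 u v w : f v u u w = 0 by apply: anti_eq; exact: s2.
have e3 u v w : f v w u u = 0 by apply: anti_eq; exact: s3.
case: (five_ord4P x a b c d) => [[] <-|[] <-|[] <-|<-].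
- exact: f0.
- by rewrite s1 f0 oppr0.
- by rewrite s2 s1 f0 !oppr0.
- by rewrite s3 s2 s1 f0 !oppr0.
- exact: e1.
- by rewrite s2 e1 oppr0.
- by rewrite s3 s2 e1 !oppr0.
- exact: e2.
- by rewrite s3 e2 oppr0.
- exact: e3.
Qed.

(** Three distinct letters out of four cannot avoid both x and y. *)
Lemma alt3 (x y : 'I_4) (f : 'I_4 -> 'I_4 -> 'I_4 -> K) : x != y ->
  (forall a b c, f a b c = - f b a c) ->
  (forall a b c, f a b c = - f a c b) ->
  (forall b c, f x b c = 0) -> (forall b c, f y b c = 0) ->
  forall a b c, f a b c = 0.
Proof.
move=> nxy s1 s2 fx fy a b c.
case: (five_ord4P x y a b c) => [[]|[]|[]|].
- by move/eqP: nxy.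
- by move=> <-; exact: fx.
- by move=> <-; rewrite s1 fx oppr0.
- by move=> <-; rewrite s2 s1 fx !oppr0.
- by move=> <-; exact: fy.
- by move=> <-; rewrite s1 fy oppr0.
- by move=> <-; rewrite s2 s1 fy !oppr0.
- by move=> <-; apply: anti_eq; exact: s1.
- by move=> <-; rewrite s2; apply/eqP; rewrite oppr_eq0; apply/eqP; apply: anti_eq; exact: s1.
- by move=> <-; apply: anti_eq; exact: s2.
Qed.
End Alternating.

(** The three alternating letters have to be the ones other than x. The
    letters of the pair then occur among them, and the cyclic relation takes
    care of this case. *)
Lemma alt3_pair (K : comNzRingType)
  (reg2 : forall a : K, a + a = 0 -> a = 0) (reg3 : forall a : K, a + a + a = 0 -> a = 0)
  (x : 'I_4) (f : 'I_4 -> 'I_4 -> 'I_4 -> 'I_4 -> 'I_4 -> K) :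
  (forall a b c p q, f a b c p q = - f b a c p q) ->
  (forall a b c p q, f a b c p q = - f a c b p q) ->
  (forall a b c p q, f a b c p q = f a b c q p) ->
  (forall a b c p q, f a b c p q + f p b c a q + f q b c p a = 0) ->
  (forall b c p q, f x b c p q = 0) -> (forall a b c q, f a b c x q = 0) ->
  forall a b c p q, f a b c p q = 0.
Proof.
move=> s1 s2 sp cyc x0 xp.
have e1 a b p q : f a a b p q = 0 by apply: (anti_eq reg2); exact: s1.
have e2 a b p q : f b a a p q = 0 by apply: (anti_eq reg2); exact: s2.
have e3 a b p q : f a b a p q = 0 by rewrite s1 e2 oppr0.
have uu a b c : f a b c a a = 0 by apply: reg3; exact: cyc.
(* the three alternating letters and x exhaust the alphabet, so the other *)
(* letter of the pair is one of them *)
have uc a b c d : f a b c a d = 0.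
  have z : f d b c a a = 0.
    case: (five_ord4P x a b c d) => [[]|[]|[]|] <-.
    - exact: xp.
    - by rewrite s1 x0 oppr0.
    - by rewrite s2 s1 x0 !oppr0.
    - exact: x0.
    - by rewrite s1 uu oppr0.
    - by rewrite s2 s1 uu !oppr0.
    - exact: uu.
    - exact: e2.
    - exact: e1.
    - exact: e3.
  by apply: reg2; lc (cyc a b c a d ⊟ z).
move=> a b c p q; case: (five_ord4P x a b c p) => [[]|[]|[]|] <-.
- exact: x0.
- by rewrite s1 x0 oppr0.
- by rewrite s2 s1 x0 !oppr0.
- exact: xp.
- exact: e1.
- exact: e3.
- exact: uc.
- exact: e2.
- by rewrite s1 uc oppr0.
- by rewrite s2 s1 uc !oppr0.
Qed.

Section TwoByTwo.
Variable K : comNzRingType.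
Hypothesis reg2 : forall a : K, a + a = 0 -> a = 0.
Hypothesis reg3 : forall a : K, a + a + a = 0 -> a = 0.
Notation I := 'I_4.
Notation form := (I -> I -> I -> I -> I -> I -> K).

(** The relations of words with three letters x as functions of the six other
    letters: the pair u, v is alternating, the pairs r, s and p, q come from
    adjugates, and the letters of an adjugate can be exchanged with a
    neighbouring letter. *)
Definition two_by_two (x : I) (H : form) := [/\
  (forall u v r s p q, H u v r s p q = H u v s r p q) /\
  (forall u v r s p q, H u v r s p q = H u v r s q p),
  forall u v r s p q, H u v r s p q = - H v u r s p q,
  forall u v r s p q, H u v r s p q + H r v u s p q + H s v r u p q = 0,
  forall u v r s p q, H u v r s p q + H p v r s u q + H q v r s p u = 0
  & forall v r s p q, H x v r s p q = 0].

Lemma two_by_two_swap x H : two_by_two x H ->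
  two_by_two x (fun u v r s p q => H u v p q r s).
Proof.
case=> -[h1 h1'] h2 h3 h4 h5; split=> //.
Qed.

Lemma two_by_two_x x H : two_by_two x H -> forall u v a p q, H u v x a p q = 0.
Proof.
move=> [[sr sq] an cr cq H0].
have H0' u r s p q : H u x r s p q = 0 by rewrite an H0 oppr0.
have s1 u v a p q : H u v x a p q = - H v u x a p q by exact: an.
have s2 u v a p q : H u v x a p q = - H a v x u p q.
  by lc (cr u v x a p q ⊟ H0 v u a p q).
have s3 u v a p q : H u v x a p q = - H u a x v p q.
  by rewrite s1 s2 opprK s1 .
have g0 u v a b : H u v x a x b = 0.
  have t u' v' a' b' : H u' v' x a' x b' = - H b' v' x a' x u'.
    by lc (cq u' v' x a' x b' ⊟ H0 v' x a' u' b').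
  apply: (alt4 reg2 (x := x) (f := fun u v a b => H u v x a x b)).
  - by move=> *; exact: s1.
  - by move=> *; exact: s3.
  - by move=> a' b' c' d'; rewrite s2 t s2 opprK.
  - by [].
have hx u v p q : H u v x x p q = 0 by rewrite s2 H0 oppr0.
move=> u v a p q; apply: (alt3_pair reg2 reg3 (x := x) (f := fun u v a p q => H u v x a p q)) => //.
Qed.

Lemma two_by_two_thrice x H : two_by_two x H ->
  forall y u v b, H u v y y y b = 0.
Proof.
move=> HH y u v b; case: (eqVneq x y) => [<-|nxy]; first exact: (two_by_two_x HH).
case: HH (two_by_two_x HH) (two_by_two_x (two_by_two_swap HH)) => -[sr sq] an cr cq H0 _ hq.
have y0 v' p q : H y v' y y p q = 0 by apply: reg3; exact: cr.
apply: (alt3 reg2 nxy (f := fun u v b => H u v y y y b)) => [*|u' v' b'|*|*].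
- exact: an.
- have t u1 v1 b1 : H u1 v1 y y y b1 = - H b1 v1 y y y u1.
    by lc (cq u1 v1 y y y b1 ⊟ y0 v1 u1 b1).
  by rewrite an t (an u') !opprK.
- exact: H0.
- exact: y0.
Qed.

(** An alternating pair of letters against two symmetric pairs: when both
    letters of the former are cyclically exchanged with the letters of both
    pairs, three letters beside x are not enough for a nonzero form. *)
Lemma two_by_two_eq0 x H : two_by_two x H -> forall u v r s p q, H u v r s p q = 0.
Proof.
move=> HH y z r s p q.
have [[sr sq] an cr cq H0] := HH.
have hr := two_by_two_x HH; have hq := two_by_two_x (two_by_two_swap HH).
have tr3 := two_by_two_thrice HH.
have tq3 := two_by_two_thrice (two_by_two_swap HH).
rewrite /= in hq tq3.
case: (eqVneq y x) => [->|nyx]; first exact: H0.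
case: (eqVneq z x) => [->|nzx]; first by rewrite an H0 oppr0.
have e u r' s' p' q' : H u u r' s' p' q' = 0 by apply: (anti_eq reg2); exact: an.
case: (eqVneq y z) => [->|nyz]; first exact: e.
have uu u v p' q' : H u v u u p' q' = 0 by apply: reg3; exact: cr.
have vv u v p' q' : H u v v v p' q' = 0 by rewrite an uu oppr0.
have uu' u v p' q' : H u v p' q' u u = 0 by apply: reg3; exact: (cq u v p' q' u u).
have vv' u v p' q' : H u v p' q' v v = 0 by rewrite an uu' oppr0.
have uv u v p' q' : H u v u v p' q' = 0.
  by apply: reg2; lc (cr u v u v p' q' ⊟ e v u u p' q').
have uv' u v p' q' : H u v p' q' u v = 0.
  by apply: reg2; lc (cq u v p' q' u v ⊟ e v p' q' u u).
have vu u v p' q' : H u v v u p' q' = 0 by rewrite sr uv.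
have vu' u v p' q' : H u v p' q' v u = 0 by rewrite sq uv'.
have ww u v w : H u v u w u w = 0.
  by apply: reg2; lc (cr u v u w u w ⊟ tr3 u w v w).
have ww' u v w : H u v v w v w = 0 by rewrite an ww oppr0.
have cqv u' v' r' s' p' q' :
  H u' v' r' s' p' q' + H u' p' r' s' v' q' + H u' q' r' s' p' v' = 0.
  by rewrite -oppr0 -(cq v' u' r' s' p' q') !opprD -!an.
have ee u v w : H u v u w v w = 0.
  apply: reg2; have := cqv u w w u v v.
  by rewrite vu add0r !(sr u v w u) (sq u v u w w v).
have [w hw] : exists w, forall c, [\/ c = x, c = y, c = z | c = w].
  case: (pickP (fun c => c \notin [:: x; y; z])) => [w|hn].
    rewrite !inE !negb_or => /and3P[/eqP wx /eqP wy /eqP wz]; exists w => c.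
    case: (five_ord4P x y z c w) => [[]|[]|[]|]; do ?[by move/eqP; rewrite eq_sym => /eqP];
      do ?[by move/eqP; rewrite ?(negPf nyx) ?(negPf nyz) // eq_sym ?(negPf nyx) ?(negPf nzx)].
    - by move=> <-; constructor 1.
    - by move=> <-; constructor 2.
    - by move=> <-; constructor 3.
    - by move=> <-; constructor 4.
  exists x => c; have /negbFE := hn c; rewrite !inE => /or3P[] /eqP ->.
  - by constructor 1.
  - by constructor 2.
  - by constructor 3.
have hr' u v a p' q' : H u v a x p' q' = 0 by rewrite sr hr.
have hq' u v p' q' a : H u v p' q' a x = 0 by rewrite sq hq.
have tr3' u v b : H u v w w b w = 0 by rewrite sq tr3.
have tq3' u v b : H u v b w w w = 0 by rewrite sr tq3.
have ww1 u v w' : H u v w' u u w' = 0 by rewrite sr ww.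
have ee1 u v : H u v v w u w = 0 by rewrite an ee oppr0.
case: (hw r) => -> //; case: (hw s) => -> //; case: (hw p) => -> //; case: (hw q) => -> //;
rewrite ?uv ?uv' ?vu ?vu' ?uu ?vv ?uu' ?vv' ?hr ?hq ?tr3 ?tq3 ?tr3' ?tq3' ?ww ?ww' //;
  rewrite ?(sr _ _ w) ?(sq _ _ _ _ w) ?ww ?ww' ?ee ?ee1 ?tr3 ?tq3 //.
Qed.
End TwoByTwo.

(** * Traces of words with three adjugates *)

(** T a b c p p' q q' r r' is the trace of a (p # p') b (q # q') c (r # r'),
    of which only the symmetries and the exchange relations are retained. Some
    letter x occurs at three of the nine places; the lemmas below run through
    the possible places, from the letters outside the adjugates to those
    inside. *)
Section CyclicWords.
Variable K : comNzRingType.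
Hypothesis reg2 : forall a : K, a + a = 0 -> a = 0.
Hypothesis reg3 : forall a : K, a + a + a = 0 -> a = 0.
Notation I := 'I_4.
Variable T : I -> I -> I -> I -> I -> I -> I -> I -> I -> K.
Hypothesis sp : forall a b c p p' q q' r r', T a b c p p' q q' r r' = T a b c p' p q q' r r'.
Hypothesis rot : forall a b c p p' q q' r r', T a b c p p' q q' r r' = T b c a q q' r r' p p'.
Hypothesis rev : forall a b c p p' q q' r r', T a b c p p' q q' r r' = T a c b r r' q q' p p'.
Hypothesis cap : forall a b c p p' q q' r r',
  T a b c p p' q q' r r' + T p b c a p' q q' r r' + T p' b c p a q q' r r' = 0.
Hypothesis cube : forall x p p' q q' r r',
  T x x x p p' q q' r r' + T x x x p p' r r' q q' = 0.

Let rot2 a b c p p' q q' r r' : T a b c p p' q q' r r' = T c a b r r' p p' q q'.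
Proof. by rewrite rot rot. Qed.
Let sq a b c p p' q q' r r' : T a b c p p' q q' r r' = T a b c p p' q' q r r'.
Proof. by rewrite rot sp rot2. Qed.
Let sr a b c p p' q q' r r' : T a b c p p' q q' r r' = T a b c p p' q q' r' r.
Proof. by rewrite rot2 sp rot. Qed.
Let car a b c p p' q q' r r' :
  T a b c p p' q q' r r' + T r b c p p' q q' a r' + T r' b c p p' q q' r a = 0.
Proof. by rewrite rev [X in _ + X + _]rev [X in _ + X]rev cap. Qed.
Let cbp a b c p p' q q' r r' :
  T a b c p p' q q' r r' + T a p c b p' q q' r r' + T a p' c p b q q' r r' = 0.
Proof. by rewrite rot [X in _ + X + _]rot [X in _ + X]rot car. Qed.
Let cbq a b c p p' q q' r r' :
  T a b c p p' q q' r r' + T a q c p p' b q' r r' + T a q' c p p' q b r r' = 0.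
Proof. by rewrite rot [X in _ + X + _]rot [X in _ + X]rot cap. Qed.
Let ccq a b c p p' q q' r r' :
  T a b c p p' q q' r r' + T a b q p p' c q' r r' + T a b q' p p' q c r r' = 0.
Proof. by rewrite rot2 [X in _ + X + _]rot2 [X in _ + X]rot2 car. Qed.
Let ccr a b c p p' q q' r r' :
  T a b c p p' q q' r r' + T a b r p p' q q' c r' + T a b r' p p' q q' r c = 0.
Proof. by rewrite rot2 [X in _ + X + _]rot2 [X in _ + X]rot2 cap. Qed.

Variable x : I.

Let xxx p p' q q' r r' : T x x x p p' q q' r r' = 0.
Proof.
have e : T x x x p p' r r' q q' = T x x x p p' q q' r r' by rewrite rev -rot.
by apply: reg2; rewrite -{2}e cube.
Qed.

Let xx_between b c q q' r r' : T x b c x x q q' r r' = 0.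
Proof. by apply: reg3; exact: cap. Qed.

Let xx_between' b c q q' r r' : T b x c x x q q' r r' = 0.
Proof. by apply: reg3; exact: cbp. Qed.

Let xx_p c d q q' r r' : T x x c x d q q' r r' = 0.
Proof. by apply: reg2; lc (cap x x c x d q q' r r' ⊟ xx_between' d c q q' r r'). Qed.

(* two neighbouring letters x, the third x in an adjacent pair *)
Let F c d p p' r r' := T x x c p p' x d r r'.

Let F_antisym c d p p' r r' : F c d p p' r r' = - F d c p p' r r'.
Proof. by rewrite /F; lc (ccq x x c p p' x d r r' ⊟ xxx p p' c d r r'). Qed.

Let F_swap c d p p' r r' : F c d p p' r r' = F d c r r' p p'.
Proof.
have e : T x x c p p' x d r r' = T x d x p p' c x r r'.
  apply/eqP; rewrite -subr_eq0; apply/eqP/reg2.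
  by lc (cbq x x c p p' x d r r' ⊟ ccq x d c p p' x x r r' ⊟ sq x d x p p' c x r r').
by rewrite /F e rev sq.
Qed.

Let F0 c d p p' r r' : F c d p p' r r' = 0.
Proof.
have HH : two_by_two x (fun c d p p' r r' => F c d p p' r r'); last exact: (two_by_two_eq0 reg2 reg3 HH).
have Fr c' d' a a' b b' : F c' d' a a' b b' = - F c' d' b b' a a'.
  by rewrite F_antisym F_swap.
split=> [|u v *|u v r1 r2 q1 q2|u v r1 r2 q1 q2|v r1 r2 q1 q2].
- by split=> *; [exact: sp|exact: sr].
- exact: F_antisym.
- by rewrite !(Fr _ _ _ _ q1) -!opprD /F ccr oppr0.
- exact: ccr.
- exact: xxx.
Qed.

Let xx_q c d p p' r r' : T x x c p p' x d r r' = 0. Proof. exact: F0. Qed.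
Let xx_r c d p p' q q' : T x x c p p' q q' x d = 0.
Proof. by rewrite rev rot rot xx_q. Qed.

(* one letter x, two more in the pairs *)
Let x_xx_q b c p p' r r' : T x b c p p' x x r r' = 0.
Proof.
have := cbq x b c p p' x x r r'; rewrite (sq _ _ _ _ _ b). by rewrite !xx_q !addr0.
Qed.
Let x_xx_r b c p p' q q' : T x b c p p' q q' x x = 0.
Proof. by rewrite rev xx_between. Qed.

Let x_pq b c d e r r' : T x b c x d x e r r' = 0.
Proof.
apply: (alt4 reg2 (x := x) (f := fun d b e c => T x b c x d x e r r')).
- by move=> d' b' e' c'; lc (cbp x b' c' x d' x e' r r' ⊟ xx_q c' e' b' d' r r').
- by move=> d' b' e' c'; lc (cbq x b' c' x d' x e' r r' ⊟ xx_p c' d' b' e' r r').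
- move=> d' b' e' c'; have z : T x b' x x d' c' e' r r' = 0 by rewrite rot2 xx_q.
  by lc (ccq x b' c' x d' x e' r r' ⊟ z).
- by move=> b' e' c'; exact: xx_between.
Qed.
Let x_qr b c d e p p' : T x b c p p' x d x e = 0.
Proof. by rewrite rev x_pq. Qed.
Let x_pr b c d e q q' : T x b c x d q q' x e = 0.
Proof.
have e1 : T x b c x d q q' x e + T x b c x d q q' x e + T d b c x x q q' x e = 0.
  exact: cap.
have e2 : T d b c x x q q' x e + T d x c b x q q' x e + T d x c x b q q' x e = 0.
  exact: cbp.
have z : T d x c x b q q' x e = 0 by rewrite rot x_qr.
by apply: reg2; move: e1 e2; rewrite (sp _ _ _ b) z !addr0 => + e2; rewrite e2 addr0.
Qed.

(* no letter x outside the pairs *)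
Let xx_x a b c d r r' : T a b c x x x d r r' = 0.
Proof. by have := cap a b c x x x d r r'; rewrite (sp _ _ _ a) !x_pq !addr0. Qed.
Let xx_x' a b c d q q' : T a b c x x q q' x d = 0.
Proof. by have := cap a b c x x q q' x d; rewrite (sp _ _ _ a) !x_pr !addr0. Qed.
Let x_x_x a b c d e f : T a b c x d x e x f = 0.
Proof.
apply: (alt4 reg2 (x := x) (f := fun a d b e => T a b c x d x e x f)).
- by move=> a' d' b' e'; lc (cap a' b' c x d' x e' x f ⊟ x_qr b' c e' f a' d').
- move=> a' d' b' e'; have z : T a' x c b' d' x e' x f = 0 by rewrite rot x_pq.
  by lc (cbp a' b' c x d' x e' x f ⊟ z).
- move=> a' d' b' e'; have z : T a' x c x d' b' e' x f = 0 by rewrite rot x_qr.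
  by lc (cbq a' b' c x d' x e' x f ⊟ z).
- by move=> d' b' e'; exact: x_pq.
Qed.

(* up to the order of the letters of each adjugate *)
Ltac gray t := first [t | rewrite sp; t | rewrite sq; t | rewrite sp sq; t | rewrite sr; t
  | rewrite sp sr; t | rewrite sq sr; t | rewrite sp sq sr; t].
Ltac eqcases l := match l with
  | nil => idtac | ?a :: ?l' => case: (eqVneq a x) => [->|_]; eqcases l' end.

Let xx_any c p p' q q' r r' :
  (0 < (c == x) + (p == x) + (p' == x) + (q == x) + (q' == x) + (r == x) + (r' == x))%N ->
  T x x c p p' q q' r r' = 0.
Proof.
eqcases [:: c; p; p'; q; q'; r; r'] => //= _;
  gray ltac:(first [exact: xxx | exact: xx_p | exact: xx_q | exact: xx_r]).
Qed.

Let x_any b c p p' q q' r r' :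
  (1 < (p == x) + (p' == x) + (q == x) + (q' == x) + (r == x) + (r' == x))%N ->
  T x b c p p' q q' r r' = 0.
Proof.
eqcases [:: p; p'; q; q'; r; r'] => //= _;
  gray ltac:(first [exact: xx_between | exact: x_xx_q | exact: x_xx_r
    | exact: x_pq | exact: x_pr | exact: x_qr]).
Qed.

Let none_any a b c p p' q q' r r' :
  (2 < (p == x) + (p' == x) + (q == x) + (q' == x) + (r == x) + (r' == x))%N ->
  T a b c p p' q q' r r' = 0.
Proof.
have xx_x1 a1 b1 c1 d r1 r1' : T a1 b1 c1 x d x x r1 r1' = 0 by rewrite rev rot xx_x.
have xx_x2 a1 b1 c1 d r1 r1' : T a1 b1 c1 r1 r1' x x x d = 0 by rewrite rot xx_x.
have xx_x3 a1 b1 c1 d r1 r1' : T a1 b1 c1 x d r1 r1' x x = 0 by rewrite rot2 xx_x.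
have xx_x4 a1 b1 c1 d r1 r1' : T a1 b1 c1 r1 r1' x d x x = 0 by rewrite rot2 xx_x'.
eqcases [:: p; p'; q; q'; r; r'] => //= _;
  gray ltac:(first [exact: xx_x | exact: xx_x' | exact: x_x_x | exact: xx_x1
    | exact: xx_x2 | exact: xx_x3 | exact: xx_x4 ]).
Qed.

Lemma cyclic_count_eq0 a b c p p' q q' r r' :
  (2 < (a == x) + (b == x) + (c == x)
     + ((p == x) + (p' == x) + (q == x) + (q' == x) + (r == x) + (r' == x)))%N ->
  T a b c p p' q q' r r' = 0.
Proof.
eqcases [:: a; b; c]; rewrite ?addn0 ?add0n ?eqxx /= => h.
- by apply: xx_any; rewrite eqxx.
- apply: xx_any; move: h; rewrite !addnA; do 7 case: (_ == x) => //=.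
- rewrite rot2; apply: xx_any; move: h; rewrite !addnA; do 7 case: (_ == x) => //=.
- apply: x_any; move: h; rewrite !addnA; do 6 case: (_ == x) => //=.
- rewrite rot; apply: xx_any; move: h; rewrite !addnA; do 7 case: (_ == x) => //=.
- rewrite rot; apply: x_any; move: h; rewrite !addnA; do 6 case: (_ == x) => //=.
- rewrite rot2; apply: x_any; move: h; rewrite !addnA; do 6 case: (_ == x) => //=.
- exact: none_any.
Qed.
End CyclicWords.

Lemma letter_thrice (s : seq 'I_4) : (8 < size s)%N ->
  exists x, (2 < count_mem x s)%N.
Proof.
move=> hs; case: (pickP (fun x => (2 < count_mem x s)%N)) => [x hx|h]; first by exists x.
have e : \sum_(x : 'I_4) count_mem x s = size s.
  elim: s {hs h} => [|y s IH] /=; first by rewrite big1.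
  rewrite big_split /= IH (bigD1 y) //= eqxx big1 ?addn0 // => z nz.
  by rewrite eq_sym (negPf nz).
suff : (size s <= \sum_(x : 'I_4) 2)%N.
  by rewrite sum_nat_const card_ord leqNgt hs.
by rewrite -e; apply: leq_sum => x _; rewrite leqNgt h.
Qed.

Lemma cyclic_word_eq0 (K : comNzRingType)
  (reg2 : forall a : K, a + a = 0 -> a = 0) (reg3 : forall a : K, a + a + a = 0 -> a = 0)
  (T : 'I_4 -> 'I_4 -> 'I_4 -> 'I_4 -> 'I_4 -> 'I_4 -> 'I_4 -> 'I_4 -> 'I_4 -> K) :
  (forall a b c p p' q q' r r', T a b c p p' q q' r r' = T a b c p' p q q' r r') ->
  (forall a b c p p' q q' r r', T a b c p p' q q' r r' = T b c a q q' r r' p p') ->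
  (forall a b c p p' q q' r r', T a b c p p' q q' r r' = T a c b r r' q q' p p') ->
  (forall a b c p p' q q' r r',
    T a b c p p' q q' r r' + T p b c a p' q q' r r' + T p' b c p a q q' r r' = 0) ->
  (forall x p p' q q' r r', T x x x p p' q q' r r' + T x x x p p' r r' q q' = 0) ->
  forall a b c p p' q q' r r', T a b c p p' q q' r r' = 0.
Proof.
move=> sp rot rev cap cube a b c p p' q q' r r'.
have [//|x hx] := @letter_thrice [:: a; b; c; p; p'; q; q'; r; r'].
apply: (cyclic_count_eq0 reg2 reg3 sp rot rev cap cube (x := x)).
by move: hx; rewrite /= !addnA addn0.
Qed.

(** * Four symmetric matrices at which the generators vanish *)

(** Four symmetric matrices at which the cubic and the sextic generators
    vanish. For the latter this is expressed by the traces nf_tr2, which are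
    what the relations between words involve; trace_sextic relates the two.
    Dividing by 2 and 3 is all that is needed of a base field. *)
Record null_forms (K : comNzRingType) (e : 'I_4 -> 'M[K]_3) : Prop := NullForms {
  nf_half : exists h : K, h + h = 1;
  nf_third : exists t : K, t + t + t = 1;
  nf_sym : forall i, (e i)^T = e i;
  nf_theta : forall i j k, theta (e i) (e j) (e k) = 0;
  nf_tr2 : forall i j k l m n,
    \tr (e i * cross (e j) (e k) * e l * cross (e m) (e n)) = 0 }.

Lemma nf_reg2 (K : comNzRingType) (e : 'I_4 -> 'M[K]_3) : null_forms e ->
  forall a : K, a + a = 0 -> a = 0.
Proof. by case=> -[h hh] _ _ _ _ a H; rewrite -[a]mul1r -hh mulrDl -mulrDr H mulr0. Qed.

Lemma nf_reg3 (K : comNzRingType) (e : 'I_4 -> 'M[K]_3) : null_forms e ->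
  forall a : K, a + a + a = 0 -> a = 0.
Proof. by case=> _ [t ht] _ _ _ a H; rewrite -[a]mul1r -ht !mulrDl -!mulrDr H mulr0. Qed.

Section NullForms.
Variables (K : comNzRingType) (e : 'I_4 -> 'M[K]_3).
Hypothesis NF : null_forms e.
Let reg2 := nf_reg2 NF.
Let reg3 := nf_reg3 NF.
Let e_sym := nf_sym NF.
Let theta_e := nf_theta NF.
Let tr2_e := nf_tr2 NF.

Lemma mx_reg2 (A : 'M[K]_3) : A + A = 0 -> A = 0.
Proof. by move/matrixP=> h; apply/matrixP=> i j; move: (h i j); rewrite !mxE; exact: reg2. Qed.
Lemma mx_reg3 (A : 'M[K]_3) : A + A + A = 0 -> A = 0.
Proof. by move/matrixP=> h; apply/matrixP=> i j; move: (h i j); rewrite !mxE; exact: reg3. Qed.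

Lemma trM3 (A B : 'M[K]_3) : (A * B)^T = B^T * A^T.
Proof. exact: trmx_mul. Qed.

Lemma trC3 (A B : 'M[K]_3) : \tr (A * B) = \tr (B * A).
Proof. exact: mxtrace_mulC. Qed.

Definition inS (x : 'M[K]_3) := exists c : 'I_4 -> K, x = \sum_i c i *: e i.

Lemma inS_e i : inS (e i).
Proof.
exists (fun j => (j == i)%:R); rewrite (bigD1 i) //= eqxx scale1r big1 ?addr0 // => j nj.
by rewrite (negPf nj) scale0r.
Qed.
Lemma inS_add x y : inS x -> inS y -> inS (x + y).
Proof.
move=> [c ->] [d ->]; exists (fun i => c i + d i); rewrite -big_split /=.
by apply: eq_bigr => i _; rewrite scalerDl.
Qed.
Lemma inS_scale a x : inS x -> inS (a *: x).
Proof.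
move=> [c ->]; exists (fun i => a * c i); rewrite scaler_sumr.
by apply: eq_bigr => i _; rewrite scalerA.
Qed.

Lemma inS_lin (f : 'M[K]_3 -> K) : (forall x y, f (x + y) = f x + f y) ->
  (forall a x, f (a *: x) = a * f x) -> (forall i, f (e i) = 0) ->
  forall x, inS x -> f x = 0.
Proof.
move=> fD fZ fe _ [c ->].
have f0 : f 0 = 0 by rewrite -(scale0r 0) fZ mul0r.
by elim/big_ind: _ => // [x y hx hy|i _]; [rewrite fD hx hy addr0|rewrite fZ fe mulr0].
Qed.

Lemma inS_sym x : inS x -> x^T = x.
Proof.
move=> [c ->]; rewrite raddf_sum; apply: eq_bigr => i _.
by rewrite /= linearZ /= e_sym.
Qed.

Lemma theta_S x y z : inS x -> inS y -> inS z -> theta x y z = 0.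
Proof.
rewrite /theta => hx hy hz.
apply: (inS_lin (f := fun x => \tr (x^T * (y # z))) _ _ _ hx) => [u v|a u|i].
- by rewrite [(_ + _)^T]linearD mulrDl mxtraceD.
- by rewrite [(_ *: _)^T]linearZ -scalerAl mxtraceZ.
apply: (inS_lin (f := fun y => \tr (_ * (y # z))) _ _ _ hy) => [u v|a u|j].
- by rewrite crossDl mulrDr mxtraceD.
- by rewrite crossZl -scalerAr mxtraceZ.
apply: (inS_lin (f := fun z => \tr (_ * (_ # z))) _ _ _ hz) => [u v|a u|k].
- by rewrite crossDr mulrDr mxtraceD.
- by rewrite crossZr -scalerAr mxtraceZ.
exact: theta_e.
Qed.

Ltac linD := rewrite ?crossDl ?crossDr ?mulrDl ?mulrDr ?mulrDl ?mulrDr ?mulrDl ?mxtraceD //.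
Ltac linZ := rewrite ?crossZl ?crossZr -?scalerAr -?scalerAl ?mxtraceZ //.

Lemma tr2_S a b c d f g : inS a -> inS b -> inS c -> inS d -> inS f -> inS g ->
  \tr (a * (b # c) * d * (f # g)) = 0.
Proof.
move=> ha hb hc hd hf hg.
apply: (inS_lin (f := fun a => \tr (a * _ * _ * _)) _ _ _ ha) => [u v|k u|i1]; [linD|linZ|].
apply: (inS_lin (f := fun b => \tr (_ * (b # _) * _ * _)) _ _ _ hb) => [u v|k u|i2]; [linD|linZ|].
apply: (inS_lin (f := fun b => \tr (_ * (_ # b) * _ * _)) _ _ _ hc) => [u v|k u|i3]; [linD|linZ|].
apply: (inS_lin (f := fun b => \tr (_ * _ * b * _)) _ _ _ hd) => [u v|k u|i4]; [linD|linZ|].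
apply: (inS_lin (f := fun b => \tr (_ * _ * _ * (b # _))) _ _ _ hf) => [u v|k u|i5]; [linD|linZ|].
apply: (inS_lin (f := fun b => \tr (_ * _ * _ * (_ # b))) _ _ _ hg) => [u v|k u|i6]; [linD|linZ|].
exact: tr2_e.
Qed.

Lemma tr1_S a b c : inS a -> inS b -> inS c -> \tr (a * (b # c)) = 0.
Proof. by move=> ha hb hc; have := theta_S ha hb hc; rewrite /theta inS_sym. Qed.

Lemma cross_sym a b : inS a -> inS b -> (a # b)^T = a # b.
Proof. by move=> ha hb; rewrite trmx_cross !inS_sym. Qed.

(** The polarization of x adj x = det x, where the right-hand side vanishes. *)
Lemma relL a b c : inS a -> inS b -> inS c ->
  a * (b # c) + b * (c # a) + c * (a # b) = 0.
Proof.
move=> ha hb hc; have := theta_mul a b c.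
by rewrite !inS_sym // theta_S // scale0r.
Qed.
Lemma relR a b c : inS a -> inS b -> inS c ->
  (b # c) * a + (c # a) * b + (a # b) * c = 0.
Proof.
move=> ha hb hc; have /(congr1 trmx) := relL ha hb hc.
by rewrite trmx0 !linearD /= !trM3 !cross_sym // !inS_sym.
Qed.

Lemma cross_pair a b q : (forall c, inS c -> \tr (q^T * c) = 0) -> inS a -> inS b ->
  q # (a # b) = - (a * q^T * b + b * q^T * a).
Proof. by move=> hq ha hb; rewrite cross_cross !hq // !scale0r !add0r. Qed.

Lemma cross_pair2 a b c d : inS a -> inS b -> inS c -> inS d ->
  (c # d) # (a # b) = - (a * (c # d) * b + b * (c # d) * a).
Proof.
move=> ha hb hc hd; rewrite cross_pair //; first by rewrite cross_sym.
by move=> x hx; rewrite cross_sym // trC3 tr1_S.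
Qed.

(** theta_mul at x, y and p # q, where cross_cross expands the cross products
    of x and of y with p # q. All the traces that appear vanish. *)
Lemma star x y a b c d : inS x -> inS y -> inS a -> inS b -> inS c -> inS d ->
  let p := a # b in let q := c # d in
  x * p * y * q + x * q * y * p + y * p * x * q + y * q * x * p = (p # q) * (x # y).
Proof.
move=> hx hy ha hb hc hd p q.
have pS : p^T = p by rewrite cross_sym.
have qS : q^T = q by rewrite cross_sym.
have zpq z : inS z -> z # (p # q) = - (p * z * q + q * z * p).
  move=> hz; rewrite cross_cross inS_sym // (tr1_S hz ha hb) (tr1_S hz hc hd).
  by rewrite !scale0r !add0r.
have := theta_mul x y (p # q).
have -> : theta x y (p # q) = 0.
  rewrite /theta inS_sym // zpq // mulrN mulrDr !mulrA linearN linearD /=.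
  by rewrite !tr2_S // addr0 oppr0.
rewrite trmx_cross pS qS !inS_sym // scale0r (crossC _ x) !zpq // !mulrN !mulrDr !mulrA.
move=> h; lcm (0 ⊡ h ⊟ h).
Qed.

Lemma sq0 x : inS x -> x * (x # x) = 0.
Proof. by move=> hx; apply: mx_reg3; exact: relL. Qed.
Lemma sq0' x : inS x -> (x # x) * x = 0.
Proof. by move=> hx; apply: mx_reg3; exact: relR. Qed.
Lemma sqL x y : inS x -> inS y -> x * (x # y) + x * (x # y) = - (y * (x # x)).
Proof.
move=> hx hy; have := relL hx hx hy; rewrite (crossC y x) => h.
by lcm (0 ⊡ h ⊞ h).
Qed.
Lemma sqR x y : inS x -> inS y -> (x # y) * x + (x # y) * x = - ((x # x) * y).
Proof.
move=> hx hy; have := relR hx hx hy; rewrite (crossC y x) => h.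
by lcm (0 ⊡ h ⊞ h).
Qed.

(** Since x annihilates its own adjugate, the products x p x q x are
    alternating in p and q. *)
Lemma alt5 x a b c d : inS x -> inS a -> inS b -> inS c -> inS d ->
  x * (a # b) * x * (c # d) * x = - (x * (c # d) * x * (a # b) * x).
Proof.
move=> hx ha hb hc hd; have := congr1 (fun A => A * x) (star hx hx ha hb hc hd).
rewrite /= -(mulrA _ (x # x)) sq0' // mulr0 !mulrDl => h.
have h2 : (x * (a # b) * x * (c # d) * x + x * (c # d) * x * (a # b) * x)
  + (x * (a # b) * x * (c # d) * x + x * (c # d) * x * (a # b) * x) = 0 by lcm (0 ⊡ h ⊞ h).
by have := mx_reg2 h2 => /eqP; rewrite addr_eq0 => /eqP.
Qed.

(** The relations of cyclic_word_eq0 are cyclicity, transposition, relL and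
    alt5. *)
Lemma tr3_e a b c p p' q q' r r' :
  \tr (e a * (e p # e p') * e b * (e q # e q') * e c * (e r # e r')) = 0.
Proof.
have Se := inS_e.
have eS a1 : (e a1)^T = e a1 by [].
have pS a1 b1 : (e a1 # e b1)^T = e a1 # e b1 by exact: cross_sym.
apply: (cyclic_word_eq0 reg2 reg3 (T := fun a b c p p' q q' r r' =>
  \tr (e a * (e p # e p') * e b * (e q # e q') * e c * (e r # e r')))) => {a b c p p' q q' r r'}.
- by move=> a b c p p' * /=; rewrite (crossC (e p)).
- by move=> a b c p p' q q' r r' /=; rewrite -!mulrA mulrA trC3 -!mulrA.
- move=> a b c p p' q q' r r' /=; rewrite -mxtrace_tr !trM3 !eS !pS !mulrA.
  by rewrite trC3 !mulrA.
- move=> a b c p p' q q' r r' /=.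
  rewrite -!linearD -!mulrDl /= (crossC _ (e a)) (_ : _ + _ + _ = 0) ?mul0r ?raddf0 //.
  by rewrite -(relL (Se a) (Se p) (Se p')) (crossC (e p')) (crossC (e a)).
- move=> x p p' q q' r r' /=.
  have h := alt5 (Se x) (Se r) (Se r') (Se p) (Se p').
  have {}h := congr1 (fun A => \tr (A * (e q # e q'))) h.
  rewrite /= mulNr raddfN /= in h.
  have -> : \tr (e x * (e p # e p') * e x * (e q # e q') * e x * (e r # e r')) =
    \tr (e x * (e r # e r') * e x * (e p # e p') * e x * (e q # e q')).
    by rewrite -(mulrA _ (e x) (e r # e r')) trC3 !mulrA.
  by rewrite h addNr.
Qed.

Lemma tr3_S a b c p p' q q' r r' : inS a -> inS b -> inS c -> inS p -> inS p' ->
  inS q -> inS q' -> inS r -> inS r' ->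
  \tr (a * (p # p') * b * (q # q') * c * (r # r')) = 0.
Proof.
move=> ha hb hc hp hp' hq hq' hr hr'.
apply: (inS_lin (f := fun a => \tr (a * _ * _ * _ * _ * _)) _ _ _ ha) => [u v|k u|i1]; [linD|linZ|].
apply: (inS_lin (f := fun b => \tr (_ * _ * b * _ * _ * _)) _ _ _ hb) => [u v|k u|i2]; [linD|linZ|].
apply: (inS_lin (f := fun b => \tr (_ * _ * _ * _ * b * _)) _ _ _ hc) => [u v|k u|i3]; [linD|linZ|].
apply: (inS_lin (f := fun b => \tr (_ * (b # _) * _ * _ * _ * _)) _ _ _ hp) => [u v|k u|i4]; [linD|linZ|].
apply: (inS_lin (f := fun b => \tr (_ * (_ # b) * _ * _ * _ * _)) _ _ _ hp') => [u v|k u|i5]; [linD|linZ|].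
apply: (inS_lin (f := fun b => \tr (_ * _ * _ * (b # _) * _ * _)) _ _ _ hq) => [u v|k u|i6]; [linD|linZ|].
apply: (inS_lin (f := fun b => \tr (_ * _ * _ * (_ # b) * _ * _)) _ _ _ hq') => [u v|k u|i7]; [linD|linZ|].
apply: (inS_lin (f := fun b => \tr (_ * _ * _ * _ * _ * (b # _))) _ _ _ hr) => [u v|k u|i8]; [linD|linZ|].
apply: (inS_lin (f := fun b => \tr (_ * _ * _ * _ * _ * (_ # b))) _ _ _ hr') => [u v|k u|i9]; [linD|linZ|].
exact: tr3_e.
Qed.

(** The products u p span a space of matrices on which the traces of one, two
    and three factors vanish, the last one by tr3_S. *)
Lemma cube_zero a b c p p' q q' r r' : inS a -> inS b -> inS c -> inS p -> inS p' ->
  inS q -> inS q' -> inS r -> inS r' ->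
  let M := a * (p # p') in let N := b * (q # q') in let P := c * (r # r') in
  M * N * P + M * P * N + N * M * P + N * P * M + P * M * N + P * N * M = 0.
Proof.
move=> ha hb hc hp hp' hq hq' hr hr' M N P.
by apply: cayley_hamilton_polar; rewrite /M /N /P ?mulrA;
  first [exact: tr1_S | exact: tr2_S | exact: tr3_S].
Qed.

(** Words in x, x # x, y, y # y and a further letter and adjugate. Because x
    annihilates x # x, few of them are left, and the relations sq_w to sq_iii
    express these by a single one. *)
Section Squares.
Variables c d : 'M[K]_3.
Hypotheses (hc : inS c) (hd : inS d).
Let q := c # d.

Section OneSide.
Variables x y a : 'M[K]_3.
Hypotheses (hx : inS x) (hy : inS y) (ha : inS a).
Let m := x # x.
Let l := y # y.
Let xm : x * m = 0. Proof. exact: sq0. Qed.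
Let mx : m * x = 0. Proof. exact: sq0'. Qed.
Let yl : y * l = 0. Proof. exact: sq0. Qed.
Let ly : l * y = 0. Proof. exact: sq0'. Qed.
Let zxm z : z * x * m = 0. Proof. by rewrite -mulrA xm mulr0. Qed.
Let zmx z : z * m * x = 0. Proof. by rewrite -mulrA mx mulr0. Qed.
Let zyl z : z * y * l = 0. Proof. by rewrite -mulrA yl mulr0. Qed.
Let zly z : z * l * y = 0. Proof. by rewrite -mulrA ly mulr0. Qed.
Let Z := (xm, mx, yl, ly, zxm, zmx, zyl, zly, mul0r, mulr0, addr0, add0r, mulrA, mulrDl).

Let mq : m # q = - (x * q * x + x * q * x).
Proof. by rewrite crossC cross_pair2. Qed.
Let lq : l # q = - (y * q * y + y * q * y).
Proof. by rewrite crossC cross_pair2. Qed.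

Lemma sq_w : x * l * a * m * y = - (y * m * a * l * x).
Proof.
have h1 := congr1 (fun A => A * y) (star hx ha hy hy hx hx).
have h2 := congr1 (fun A => A * x) (star ha hy hy hy hx hx).
have h3 := congr1 (fun A => A * a) (star hy hx hy hy hx hx).
have := congr1 (fun A => (l # m) * A) (relR hy hx ha).
rewrite /= mulr0 !mulrDr !mulrA.
move: h1 h2 h3; rewrite -/m -/l /= !Z => h1 h2 h3 h4.
lcm (h1 ⊞ h2 ⊞ h3 ⊞ h4).
Qed.

Lemma sq_i : x * l * a * m * y * q + a * m * y * q * x * l + y * q * x * l * a * m = 0.
Proof.
have := cube_zero hx ha hy hy hy hx hx hc hd.
rewrite /= -/m -/l -/q !Z => h; lcm (1 ⊡ h).
Qed.

Lemma sq_iv : x * l * a * q * y * m + y * m * a * q * x * l = 0.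
Proof.
have := cube_zero hx ha hy hy hy hc hd hx hx.
rewrite /= -/m -/l -/q !Z => h; lcm (1 ⊡ h).
Qed.

Lemma sq_ii : x * l * a * q * y * m + a * l * x * q * y * m + y * q * x * l * a * m = 0.
Proof.
have := congr1 (fun A => A * y * m) (star hx ha hy hy hc hd).
rewrite /= -/m -/l -/q !Z lq.
have h1 : (x # a) * y * m = - ((y # x) * a * m).
  have := congr1 (fun A => A * m) (relR hy hx ha); rewrite /= !Z => h.
  by lcm (1 ⊡ h).
have h2 := sqL hy hx; rewrite -/l (crossC y) in h2.
have h3 : (y * q * y + y * q * y) * (x # a) * y * m = y * q * x * l * a * m.
  rewrite -!mulrA (mulrA (x # a)) h1.
  have {}h2 := congr1 (fun A => y * q * A * a * m) h2.
  rewrite /= !Z !(mulrDr, mulrN, mulNr) !Z in h2 *.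
  rewrite (crossC y).
  by lcm (0 ⊡ h2 ⊟ h2).
rewrite !mulNr h3 => h; lcm (1 ⊡ h).
Qed.

Lemma sq_iii : x * l * a * m * y * q + x * l * a * q * y * m + x * q * y * m * a * l = 0.
Proof.
have := congr1 (fun A => x * l * A) (star ha hy hx hx hc hd).
rewrite /= -/m -/l -/q mq !(mulrDr, mulrN, mulNr) !Z.
have a5 : x * l * x * q * x = - (x * q * x * l * x) by exact: alt5.
rewrite mulrDr !(mulrDl, mulrA) a5 !(mulrN, mulNr) -opprD opprK.
have h1 := sqR hy hx; rewrite -/l in h1.
have h2 := sqL hx hy; rewrite -/m in h2.
have h3 := sqL hy ha; rewrite -/l in h3.
have e1 := congr1 (fun A => x * q * x * A * (a # y)) h1.
have e2 := congr1 (fun A => x * q * A * y * (a # y)) h2.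
have e3 := congr1 (fun A => x * q * y * m * A) h3.
rewrite /= !(mulrDr, mulrN, mulNr) !Z in e1 e2 e3.
rewrite (crossC y x) in e1; rewrite (crossC y a) in e3.
by move=> h; lcm (h ⊞ 2 ⊡ e1 ⊟ 2 ⊡ e2 ⊞ e3).
Qed.
End OneSide.

Section Solve.
Variables x y a : 'M[K]_3.
Hypotheses (hx : inS x) (hy : inS y) (ha : inS a).
Let m := x # x.
Let l := y # y.

Lemma squares_eq0 : [/\ x * q * y * m * a * l = 0, y * q * x * l * a * m = 0,
  x * l * a * m * y * q = - (y * m * a * l * x * q)
  & [/\ x * l * a * q * y * m = - (x * l * a * m * y * q)
   & a * l * x * q * y * m = x * l * a * m * y * q] ].
Proof.
have i1 := sq_i hx hy ha; have ii := sq_ii hx hy ha; have iii := sq_iii hx hy ha.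
have iv := sq_iv hx hy ha; have w := congr1 (fun A => A * q) (sq_w hx hy ha).
have i1' := sq_i hy hx ha; have ii' := sq_ii hy hx ha; have iii' := sq_iii hy hx ha.
rewrite /= mulNr in w.
rewrite -/m -/l in i1 ii iii iv w i1' ii' iii'.
(* with s the word of s0 and s' the same word with x and y exchanged, *)
(* s' = - s and s' = 2 s *)
have e1 : y * q * x * l * a * m = - (x * q * y * m * a * l) by
  lcm (0 ⊡ w ⊞ iii ⊞ iii' ⊟ iv ⊟ w).
have s0 : x * q * y * m * a * l = 0.
  apply: mx_reg3; lcm (e1 ⊞ i1' ⊞ iii ⊟ ii ⊟ w).
have s0' : y * q * x * l * a * m = 0 by rewrite e1 s0 oppr0.
have o2 : x * l * a * q * y * m = - (x * l * a * m * y * q) by lcm (iii ⊟ s0).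
by split=> //; split=> //; lcm (ii ⊟ o2 ⊟ s0').
Qed.
End Solve.
End Squares.

(** Polarization of a cubic map that is symmetric in two of its arguments. *)
Lemma polar3 (phi : 'M[K]_3 -> 'M[K]_3 -> 'M[K]_3 -> 'M[K]_3) :
  (forall u u' v w, phi (u + u') v w = phi u v w + phi u' v w) ->
  (forall u v v' w, phi u (v + v') w = phi u v w + phi u v' w) ->
  (forall u v w, phi u v w = phi u w v) ->
  (forall y, inS y -> phi y y y = 0) ->
  forall u v w, inS u -> inS v -> inS w -> phi u v w + phi v u w + phi w u v = 0.
Proof.
move=> D1 D2 C h u v w hu hv hw.
have D3 a b c d : phi a b (c + d) = phi a b c + phi a b d by rewrite C D2 !(C _ b).
have hU := h u hu; have hV := h v hv; have hW := h w hw.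
have hUV := h _ (inS_add hu hv); have hUW := h _ (inS_add hu hw); have hVW := h _ (inS_add hv hw).
have := h _ (inS_add (inS_add hu hv) hw).
rewrite !(D1, D2, D3) in hUV hUW hVW *.
rewrite !(C _ v u) !(C _ w v) !(C _ w u) in hUV hUW hVW * => hUVW.
apply: mx_reg2; lcm (hUVW ⊟ hUV ⊟ hUW ⊟ hVW ⊞ hU ⊞ hV ⊞ hW).
Qed.

Section Alternating3.
Variable x : 'M[K]_3.
Hypothesis hx : inS x.
Let Th p q r : 'M[K]_3 := x * p * x * q * x * r.

Let Th12 a b c d r : inS a -> inS b -> inS c -> inS d ->
  Th (a # b) (c # d) r = - Th (c # d) (a # b) r.
Proof. by move=> ha hb hc hd; rewrite /Th alt5 // mulNr. Qed.

Let Th_sq y a c d : inS y -> inS a -> inS c -> inS d -> Th (y # y) (c # d) (y # a) = 0.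
Proof.
move=> hy ha hc hd; have [s0 _ _ _] := squares_eq0 hc hd hx hy ha.
rewrite Th12 // /Th; set q := c # d in s0 *.
have h1 := sqR hy hx; have h2 := sqL hx hy; have h3 := sqL hy ha.
have e1 := congr1 (fun A => x * q * x * A * (a # y)) h1.
have e2 := congr1 (fun A => x * q * A * y * (a # y)) h2.
have e3 := congr1 (fun A => x * q * y * (x # x) * A) h3.
rewrite /= !(mulrDr, mulrDl, mulrN, mulNr, mulrA) ?s0 ?oppr0 in e1 e2 e3.
rewrite (crossC y x) in e1; rewrite (crossC y a) in e3.
have V0 := mx_reg2 e3; rewrite V0 ?oppr0 in e2.
rewrite e2 in e1; rewrite (crossC y a).
by move/eqP: e1; rewrite eq_sym oppr_eq0 => /eqP ->; rewrite oppr0.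
Qed.

Let Th_polar u v w a c d : inS u -> inS v -> inS w -> inS a -> inS c -> inS d ->
  Th (v # w) (c # d) (u # a) + Th (u # w) (c # d) (v # a) + Th (u # v) (c # d) (w # a) = 0.
Proof.
move=> hu hv hw ha hc hd.
apply: (polar3 (phi := fun u v w => Th (v # w) (c # d) (u # a))) => // [*|*|*|y hy].
- by rewrite /Th crossDl mulrDr.
- by rewrite /Th crossDl mulrDr !mulrDl.
- by rewrite /Th crossC.
- exact: Th_sq.
Qed.

Let Th13 a b c d f g : inS a -> inS b -> inS c -> inS d -> inS f -> inS g ->
  Th (a # b) (f # g) (c # d) = Th (c # d) (f # g) (a # b).
Proof.
move=> ha hb hc hd hf hg.
have h1 := Th_polar ha hb hc hd hf hg; have h2 := Th_polar ha hb hd hc hf hg.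
have h3 := Th_polar ha hc hd hb hf hg; have h4 := Th_polar hb hc hd ha hf hg.
rewrite !(crossC d) !(crossC c b) !(crossC c a) !(crossC b a) in h1 h2 h3 h4 *.
have h : (Th (a # b) (f # g) (c # d) - Th (c # d) (f # g) (a # b))
  + (Th (a # b) (f # g) (c # d) - Th (c # d) (f # g) (a # b)) = 0.
  by lcm (h1 ⊞ h2 ⊟ h3 ⊟ h4).
by apply/eqP; rewrite -subr_eq0; apply/eqP/mx_reg2.
Qed.

(** The product is alternating in the first two adjugates by Th12 and
    symmetric in the first and the third one by Th13; the two symmetries
    together are contradictory up to a factor 2. *)
Lemma alt6 a b c d f g : inS a -> inS b -> inS c -> inS d -> inS f -> inS g ->
  x * (a # b) * x * (c # d) * x * (f # g) = 0.
Proof.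
move=> ha hb hc hd hf hg; rewrite -/(Th _ _ _); apply: mx_reg2.
rewrite {1}Th12 // Th13 // Th12 // Th13 // Th12 // Th13 // !opprK addNr //.
Qed.
End Alternating3.
End NullForms.

(** * Linear relations between words *)

(** W a b c p p' q q' r r' is an entry of a (p # p') b (q # q') c (r # r').
    Words lack the cyclic symmetry of their traces, which is compensated by
    relations that hold only for words with three letters x, starting with th.
    Again the possible places of x are treated one after the other. *)
Section LinearWords.
Variable K : comNzRingType.
Hypothesis reg2 : forall a : K, a + a = 0 -> a = 0.
Hypothesis reg3 : forall a : K, a + a + a = 0 -> a = 0.
Notation I := 'I_4.
Variable W : I -> I -> I -> I -> I -> I -> I -> I -> I -> K.
Hypothesis sp : forall a b c p p' q q' r r', W a b c p p' q q' r r' = W a b c p' p q q' r r'.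
Hypothesis sq : forall a b c p p' q q' r r', W a b c p p' q q' r r' = W a b c p p' q' q r r'.
Hypothesis sr : forall a b c p p' q q' r r', W a b c p p' q q' r r' = W a b c p p' q q' r' r.
Hypothesis cap : forall a b c p p' q q' r r',
  W a b c p p' q q' r r' + W p b c a p' q q' r r' + W p' b c p a q q' r r' = 0.
Hypothesis cbp : forall a b c p p' q q' r r',
  W a b c p p' q q' r r' + W a p c b p' q q' r r' + W a p' c p b q q' r r' = 0.
Hypothesis cbq : forall a b c p p' q q' r r',
  W a b c p p' q q' r r' + W a q c p p' b q' r r' + W a q' c p p' q b r r' = 0.
Hypothesis ccq : forall a b c p p' q q' r r',
  W a b c p p' q q' r r' + W a b q p p' c q' r r' + W a b q' p p' q c r r' = 0.
Hypothesis ccr : forall a b c p p' q q' r r',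
  W a b c p p' q q' r r' + W a b r p p' q q' c r' + W a b r' p p' q q' r c = 0.
Variable x : I.
Hypothesis th : forall v p p' q q' r r',
  W x x v p p' q q' r r' + W x v x p p' q q' r r' + W v x x p p' q q' r r' = 0.
Hypothesis th0 : forall p p' q q' r r', W x x x p p' q q' r r' = 0.
Hypothesis mid : forall a b c p p' r r',
  W a b c p p' x x r r' + W a c b p p' x x r r' = W a x x p p' b c r r' *+ 2.
Hypothesis star36 : forall a b c p p' q q' r r',
  W a b c p p' q q' r r' + W a c b p p' q q' r r'
  + W a b c p p' r r' q q' + W a c b p p' r r' q q'
  = - (W a r r' p p' q q' b c + W a r' r p p' q q' b c).
Hypothesis ch : forall u v q q' r r', W u v x x x r r' q q' + W x u v q q' x x r r'
  + W x v u q q' r r' x x + W v x u r r' q q' x x = 0.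
Hypothesis cyc2a : forall u v q q' r r',
  W x u v q q' x x r r' + W x r v q q' x x u r' + W x r' v q q' x x r u = 0.
Hypothesis cyc3a : forall u v q q' r r',
  W x v u q q' r r' x x + W x v q u q' r r' x x + W x v q' q u r r' x x = 0.
Hypothesis cyc4a : forall u v q q' r r',
  W v x u r r' q q' x x + W v x r u r' q q' x x + W v x r' r u q q' x x = 0.

(* adjacent letter and square *)
Let ap b c q q' r r' : W x b c x x q q' r r' = 0. Proof. apply: reg3; exact: cap. Qed.
Let bp a c q q' r r' : W a x c x x q q' r r' = 0. Proof. apply: reg3; exact: cbp. Qed.
Let bq a c p p' r r' : W a x c p p' x x r r' = 0. Proof. apply: reg3; exact: cbq. Qed.
Let cq a b p p' r r' : W a b x p p' x x r r' = 0. Proof. apply: reg3; exact: ccq. Qed.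
Let cr a b p p' q q' : W a b x p p' q q' x x = 0. Proof. apply: reg3; exact: ccr. Qed.

Let A2 u v q q' r r' : W x u v q q' x x r r' = 0.
Proof.
have HH : two_by_two x (fun u v r r' q q' => W x u v q q' x x r r').
  split=> [|u1 v1 r1 s1 p1 q1|u1 v1 r1 s1 p1 q1|u1 v1 r1 s1 p1 q1|v1 r1 s1 p1 q1].
  - by split=> *; [exact: sr|exact: sp].
  - by have := mid x u1 v1 p1 q1 r1 s1; rewrite th0 mul0rn => /eqP; rewrite addr_eq0 => /eqP.
  - exact: cyc2a.
  - exact: cbp.
  - exact: bq.
exact: (two_by_two_eq0 reg2 reg3 HH).
Qed.

Let A3 u v q q' r r' : W x v u q q' r r' x x = 0.
Proof.
have HH : two_by_two x (fun u v r r' q q' => W x v u q q' r r' x x).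
  split=> [|u1 v1 r1 s1 p1 q1|u1 v1 r1 s1 p1 q1|u1 v1 r1 s1 p1 q1|v1 r1 s1 p1 q1].
  - by split=> *; [exact: sq|exact: sp].
  - have := star36 x v1 u1 p1 q1 r1 s1 x x; rewrite !th0 !A2 !addr0 oppr0 => /eqP.
    by rewrite addr_eq0 => /eqP.
  - exact: ccq.
  - exact: cyc3a.
  - exact: cr.
exact: (two_by_two_eq0 reg2 reg3 HH).
Qed.

Let C_anti u v p p' q q' : W x x v p p' q q' u x = - W x x u p p' q q' v x.
Proof. by lc (ccr x x v p p' q q' u x ⊟ th0 p p' q q' u v). Qed.

Let A4_C u v p p' q q' : W v x u p p' q q' x x = W x x v p p' q q' u x *+ 2.
Proof.
have h := th v p p' q q' u x.
have h1 := ccr x v x p p' q q' u x; have h2 := ccr v x x p p' q q' u x.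
rewrite A3 in h1.
by lc (h1 ⊞ h2 ⊟ 2 ⊡ h).
Qed.

Let A4 u v q q' r r' : W v x u r r' q q' x x = 0.
Proof.
have HH : two_by_two x (fun u v r r' q q' => W v x u r r' q q' x x).
  split=> [|u1 v1 r1 s1 p1 q1|u1 v1 r1 s1 p1 q1|u1 v1 r1 s1 p1 q1|v1 r1 s1 p1 q1].
  - by split=> *; [exact: sp|exact: sq].
  - by rewrite !A4_C C_anti mulNrn.
  - exact: cyc4a.
  - exact: ccq.
  - exact: cr.
exact: (two_by_two_eq0 reg2 reg3 HH).
Qed.

Let C u v p p' q q' : W x x v p p' q q' u x = 0.
Proof. by apply: reg2; rewrite -mulr2n -A4_C A4. Qed.

Let A1 u v q q' r r' : W u v x x x r r' q q' = 0.
Proof. by have := ch u v q q' r r'; rewrite A2 A3 A4 !addr0. Qed.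

(* two letters x outside the pairs *)
Let ab_p c d q q' r r' : W x x c x d q q' r r' = 0.
Proof.
by apply: reg2; lc (cap x x c x d q q' r r' ⊟ bp d c q q' r r').
Qed.
Let ab_q c d p p' r r' : W x x c p p' x d r r' = 0.
Proof. by apply: reg2; lc (cbq x x c p p' x d r r' ⊟ A2 d c p p' r r'). Qed.
Let ab_r c d p p' q q' : W x x c p p' q q' x d = 0.
Proof. by rewrite sr C. Qed.
Let bc_p a d q q' r r' : W a x x x d q q' r r' = 0.
Proof. by apply: reg2; lc (cbp a x x x d q q' r r' ⊟ A1 a d r r' q q'). Qed.
Let bc_q a d p p' r r' : W a x x p p' x d r r' = 0.
Proof. by apply: reg2; lc (cbq a x x p p' x d r r' ⊟ cq a d p p' r r'). Qed.
Let bc_r a d p p' q q' : W a x x p p' q q' x d = 0.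
Proof. by apply: reg2; lc (ccr a x x p p' q q' x d ⊟ A4 d a q q' p p'). Qed.
Let ac_p b d q q' r r' : W x b x x d q q' r r' = 0.
Proof. by apply: reg2; lc (cap x b x x d q q' r r' ⊟ A1 d b r r' q q'). Qed.
Let ac_q b d p p' r r' : W x b x p p' x d r r' = 0.
Proof. by apply: reg2; lc (ccq x b x p p' x d r r' ⊟ A2 b d p p' r r'). Qed.
Let ac_r b d p p' q q' : W x b x p p' q q' x d = 0.
Proof. by apply: reg2; lc (ccr x b x p p' q q' x d ⊟ A3 d b p p' q q'). Qed.

Let cut (a b c : K) : a + b + c = 0 -> b = 0 -> a = - c.
Proof. by move=> h b0; apply/eqP; rewrite -addr_eq0 -h b0 addr0. Qed.

(* one letter x outside the pairs *)
Let a_pq b c d f r r' : W x b c x d x f r r' = 0.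
Proof.
apply: (alt4 reg2 (x := x) (f := fun d b f c => W x b c x d x f r r')) => [d1 b1 f1 c1|d1 b1 f1 c1|d1 b1 f1 c1|b1 f1 c1].
- exact: (cut (cbp x b1 c1 x d1 x f1 r r') (ab_q _ _ _ _ _ _)).
- exact: (cut (cbq x b1 c1 x d1 x f1 r r') (ab_p _ _ _ _ _ _)).
- exact: (cut (ccq x b1 c1 x d1 x f1 r r') (ac_p _ _ _ _ _ _)).
- exact: ap.
Qed.

Let uv_anti u v w q q' r r' : W u v w x x q q' r r' = - W v u w x x q q' r r' +
  W x x w u v q q' r r' *+ 2.
Proof.
have h1 := cap u v w x x q q' r r'; have h2 := cap v u w x x q q' r r'.
have h3 := cbp x v w u x q q' r r'.
rewrite (sp _ _ _ x u) in h1; rewrite (sp _ _ _ x v) in h2.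
by lc (h1 ⊞ h2 ⊟ 2 ⊡ h3).
Qed.

(* no letter x outside the pairs, the square of x in the first one *)
Let pp_q u v w a r r' : W u v w x x x a r r' = 0.
Proof.
apply: (alt4 reg2 (x := x) (f := fun u v a w => W u v w x x x a r r')) => [u1 v1 a1 w1|u1 v1 a1 w1|u1 v1 a1 w1|v1 a1 w1].
- by rewrite uv_anti ab_q mul0rn addr0.
- exact: (cut (cbq u1 v1 w1 x x x a1 r r') (bp _ _ _ _ _ _)).
- exact: (cut (ccq u1 v1 w1 x x x a1 r r') (A1 _ _ _ _ _ _)).
- exact: ap.
Qed.
Let pp_r u v w a r r' : W u v w x x r r' x a = 0.
Proof.
apply: (alt4 reg2 (x := x) (f := fun u v w a => W u v w x x r r' x a)) => [u1 v1 w1 a1|u1 v1 w1 a1|u1 v1 w1 a1|v1 w1 a1].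
- by rewrite uv_anti ab_r mul0rn addr0.
- have := star36 u1 v1 w1 x x r r' x a1; rewrite !pp_q bp A1 !addr0 oppr0 => /eqP.
  by rewrite addr_eq0 => /eqP.
- exact: (cut (ccr u1 v1 w1 x x r r' x a1) (A1 _ _ _ _ _ _)).
- exact: ap.
Qed.

Let a_pr b c d f q q' : W x b c x d q q' x f = 0.
Proof. by apply: reg2; lc (cap x b c x d q q' x f ⊟ pp_r d b c f q q'). Qed.
Let a_qr b c d f p p' : W x b c p p' x d x f = 0.
Proof.
apply: (alt4 reg2 (x := x) (f := fun b d c f => W x b c p p' x d x f)) => [b1 d1 c1 f1|b1 d1 c1 f1|b1 d1 c1 f1|d1 c1 f1].
- exact: (cut (cbq x b1 c1 p p' x d1 x f1) (ab_r _ _ _ _ _ _)).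
- exact: (cut (ccq x b1 c1 p p' x d1 x f1) (ac_r _ _ _ _ _ _)).
- exact: (cut (ccr x b1 c1 p p' x d1 x f1) (ac_q _ _ _ _ _ _)).
- exact: ab_q.
Qed.
Let b_pq a c d f r r' : W a x c x d x f r r' = 0.
Proof. by apply: reg2; lc (cbp a x c x d x f r r' ⊟ pp_q a d c f r r'). Qed.
Let b_pr a c d f q q' : W a x c x d q q' x f = 0.
Proof. by apply: reg2; lc (cbp a x c x d q q' x f ⊟ pp_r a d c f q q'). Qed.
Let c_pq a b d f r r' : W a b x x d x f r r' = 0.
Proof.
apply: (alt4 reg2 (x := x) (f := fun a d b f => W a b x x d x f r r')) => [a1 d1 b1 f1|a1 d1 b1 f1|a1 d1 b1 f1|d1 b1 f1].
- exact: (cut (cap a1 b1 x x d1 x f1 r r') (ac_q _ _ _ _ _ _)).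
- exact: (cut (cbp a1 b1 x x d1 x f1 r r') (bc_q _ _ _ _ _ _)).
- exact: (cut (cbq a1 b1 x x d1 x f1 r r') (bc_p _ _ _ _ _ _)).
- exact: ac_p.
Qed.
Let qq_p a b c d r r' : W a b c x d x x r r' = 0.
Proof. by lc (ccq a b x x d x c r r' ⊟ 2 ⊡ c_pq a b d c r r'). Qed.
Let c_pr a b d f q q' : W a b x x d q q' x f = 0.
Proof.
have ad a1 b1 d1 q1 q1' : W a1 b1 x x d1 q1 q1' x f = - W d1 b1 x x a1 q1 q1' x f.
  exact: (cut (cap a1 b1 x x d1 q1 q1' x f) (ac_r _ _ _ _ _ _)).
have db a1 b1 d1 q1 q1' : W a1 b1 x x d1 q1 q1' x f = - W a1 d1 x x b1 q1 q1' x f.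
  exact: (cut (cbp a1 b1 x x d1 q1 q1' x f) (bc_r _ _ _ _ _ _)).
apply: (alt3_pair reg2 reg3 (x := x) (f := fun b d a q q' => W a b x x d q q' x f)) => *.
- exact: db.
- exact: ad.
- exact: sq.
- exact: cbq.
- exact: bc_p.
- exact: c_pq.
Qed.
Let rr_p a b c d q q' : W a b c x d q q' x x = 0.
Proof. by lc (ccr a b x x d q q' x c ⊟ 2 ⊡ c_pr a b d c q q'). Qed.

Let qq_r_b_qr a d c f p p' :
  W a d c p p' x x x f = - (W a x c p p' x d x f + W a x c p p' x d x f).
Proof. by lc (cbq a x c p p' x d x f). Qed.
Let qq_r a d c f p p' : W a d c p p' x x x f = 0.
Proof.
apply: (alt3_pair reg2 reg3 (x := x) (f := fun d c f p p' => W a d c p p' x x x f)) => [d1 c1 f1 q q'|d1 c1 f1 q q'|*|*|*|*].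
- by rewrite !qq_r_b_qr (cut (ccq a x c1 q q' x d1 x f1) (bc_r _ _ _ _ _ _)) !opprD.
- by rewrite !qq_r_b_qr (cut (ccr a x c1 q q' x d1 x f1) (bc_q _ _ _ _ _ _)) !opprD.
- exact: sp.
- exact: cbp.
- exact: bq.
- exact: qq_p.
Qed.
Let b_qr a c d f p p' : W a x c p p' x d x f = 0.
Proof. by apply: reg2; apply/eqP; rewrite -oppr_eq0 -qq_r_b_qr qq_r. Qed.
Let c_qr a b d f p p' : W a b x p p' x d x f = 0.
Proof. by apply: reg2; lc (ccq a b x p p' x d x f ⊟ qq_r a b d f p p'). Qed.
Let rr_q a b c d p p' : W a b c p p' x d x x = 0.
Proof.
apply: (alt3_pair reg2 reg3 (x := x) (f := fun b d c p p' => W a b c p p' x d x x)) => [b1 d1 c1 q q'|b1 d1 c1 q q'|*|*|*|*].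
- exact: (cut (cbq a b1 c1 q q' x d1 x x) (A4 _ _ _ _ _ _)).
- exact: (cut (ccq a b1 c1 q q' x d1 x x) (cr _ _ _ _ _ _)).
- exact: sp.
- exact: cbp.
- exact: A4.
- exact: rr_p.
Qed.
Let pqr a b c d f g : W a b c x d x f x g = 0.
Proof.
apply: (alt4 reg2 (x := x) (f := fun a d b f => W a b c x d x f x g)) => [a1 d1 b1 f1|a1 d1 b1 f1|a1 d1 b1 f1|d1 b1 f1].
- exact: (cut (cap a1 b1 c x d1 x f1 x g) (a_qr _ _ _ _ _ _)).
- exact: (cut (cbp a1 b1 c x d1 x f1 x g) (b_qr _ _ _ _ _ _)).
- exact: (cut (cbq a1 b1 c x d1 x f1 x g) (b_pr _ _ _ _ _ _)).
- exact: a_pq.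
Qed.

(* up to the order of the letters of each adjugate *)
Ltac gray t := first [t | rewrite sp; t | rewrite sq; t | rewrite sp sq; t | rewrite sr; t
  | rewrite sp sr; t | rewrite sq sr; t | rewrite sp sq sr; t].
Ltac eqcases l := match l with
  | nil => idtac | ?a :: ?l' => case: (eqVneq a x) => [->|_]; eqcases l' end.

Lemma linear_count_eq0 a b c p p' q q' r r' :
  (2 < (a == x) + (b == x) + (c == x) + (p == x) + (p' == x)
     + (q == x) + (q' == x) + (r == x) + (r' == x))%N ->
  W a b c p p' q q' r r' = 0.
Proof.
eqcases [:: a; b; c]; rewrite ?addn0 ?add0n ?eqxx /=; first by rewrite th0.
- eqcases [:: p; p'; q; q'; r; r'] => //= _; gray ltac:(first [exact: ab_p | exact: ab_q | exact: ab_r]).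
- eqcases [:: p; p'; q; q'; r; r'] => //= _; gray ltac:(first [exact: ac_p | exact: ac_q | exact: ac_r]).
- eqcases [:: p; p'; q; q'; r; r'] => //= _; gray ltac:(first
    [exact: ap | exact: A2 | exact: A3 | exact: a_pq | exact: a_pr | exact: a_qr]).
- eqcases [:: p; p'; q; q'; r; r'] => //= _; gray ltac:(first [exact: bc_p | exact: bc_q | exact: bc_r]).
- eqcases [:: p; p'; q; q'; r; r'] => //= _; gray ltac:(first
    [exact: bp | exact: bq | exact: A4 | exact: b_pq | exact: b_pr | exact: b_qr]).
- eqcases [:: p; p'; q; q'; r; r'] => //= _; gray ltac:(first
    [exact: A1 | exact: cq | exact: cr | exact: c_pq | exact: c_pr | exact: c_qr]).
- eqcases [:: p; p'; q; q'; r; r'] => //= _; gray ltac:(first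
    [exact: pp_q | exact: pp_r | exact: qq_p | exact: qq_r | exact: rr_p | exact: rr_q | exact: pqr]).
Qed.
End LinearWords.

(** * Words with three adjugates vanish *)

Section Words.
Variables (K : comNzRingType) (e : 'I_4 -> 'M[K]_3).
Hypothesis NF : null_forms e.
Local Notation inS := (inS e).
Let reg2 := nf_reg2 NF.
Let reg3 := nf_reg3 NF.

(** The word that squares_eq0 leaves open is a multiple of one with x # x next
    to x, by alt6 and relL. *)
Lemma squares_all x y a c d : inS x -> inS y -> inS a -> inS c -> inS d ->
  let m := x # x in let l := y # y in let q := c # d in
  [/\ x * q * y * m * a * l = 0, x * l * a * q * y * m = 0 & a * l * x * q * y * m = 0].
Proof.
move=> hx hy ha hc hd m l q.
have [s0 _ _ [o2 r]] := squares_eq0 NF hc hd hx hy ha.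
suff v0 : x * l * a * m * y * q = 0.
  by rewrite -/m -/l -/q in s0 o2 r; split; rewrite // ?o2 ?r v0 ?oppr0.
have h1 := alt6 NF hx hy hy hy ha hc hd.
have h2 := congr1 (fun A => x * l * A * x * q) (relL NF hx hy ha).
have h3 := congr1 (fun A => x * l * a * A * q) (sqR NF hx hy).
have zly z : z * l * y = 0 by rewrite -mulrA (sq0' NF hy) mulr0.
rewrite /= -/l -/m -/q !(mulrDr, mulrDl, mulrN, mulNr, mulr0, mul0r, mulrA) in h1 h2 h3.
rewrite h1 zly !mul0r !add0r in h2.
rewrite h2 addr0 in h3.
by apply/eqP; rewrite -oppr_eq0 -h3.
Qed.

(** One of the four letters, x, occurs three times among the nine, and the
    entry at i, j satisfies the relations of linear_count_eq0 for this x. The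
    last three of those are polarizations of squares_all. *)
Lemma word_letters a b c p p' q q' r r' :
  e a * (e p # e p') * e b * (e q # e q') * e c * (e r # e r') = 0.
Proof.
apply/matrixP=> i j; rewrite mxE0.
have Se := inS_e e.
pose W a b c p p' q q' r r' :=
  (e a * (e p # e p') * e b * (e q # e q') * e c * (e r # e r')) i j.
rewrite -/(W _ _ _ _ _ _ _ _ _).
have at_ij (A B : 'M[K]_3) : A = B -> A i j = B i j by move=> ->.
have sp a1 b1 c1 p1 p1' q1 q1' r1 r1' :
  W a1 b1 c1 p1 p1' q1 q1' r1 r1' = W a1 b1 c1 p1' p1 q1 q1' r1 r1' by rewrite /W (crossC (e p1)).
have sq a1 b1 c1 p1 p1' q1 q1' r1 r1' :
  W a1 b1 c1 p1 p1' q1 q1' r1 r1' = W a1 b1 c1 p1 p1' q1' q1 r1 r1' by rewrite /W (crossC (e q1)).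
have sr a1 b1 c1 p1 p1' q1 q1' r1 r1' :
  W a1 b1 c1 p1 p1' q1 q1' r1 r1' = W a1 b1 c1 p1 p1' q1 q1' r1' r1 by rewrite /W (crossC (e r1)).
have RL := relL NF; have RR := relR NF.
have RL' u v w : e u * (e v # e w) + e v * (e u # e w) + e w * (e u # e v) = 0.
  by rewrite -(RL _ _ _ (Se u) (Se v) (Se w)) (crossC (e w)).
have RR' u v w : (e v # e w) * e u + (e u # e w) * e v + (e v # e u) * e w = 0.
  by rewrite -(RR _ _ _ (Se u) (Se v) (Se w)) (crossC (e w)) (crossC (e v) (e u)).
have RR'' u v w : (e v # e w) * e u + (e u # e w) * e v + (e u # e v) * e w = 0.
  by rewrite -(RR _ _ _ (Se u) (Se v) (Se w)) (crossC (e w)).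
have [//|x hx] := @letter_thrice [:: a; b; c; p; p'; q; q'; r; r'].
apply: (@linear_count_eq0 K reg2 reg3 W sp sq sr _ _ _ _ _ x).
- move=> a1 b1 c1 p1 p1' q1 q1' r1 r1'; rewrite /W -!add3mxE -!mulrDl (crossC _ (e a1)).
  by rewrite RL' !mul0r mxE.
- move=> a1 b1 c1 p1 p1' q1 q1' r1 r1'; rewrite /W -!add3mxE -!mulrDl.
  rewrite -![e a1 * _ * _]mulrA -!mulrDr.
  by rewrite RR' mulr0 !mul0r mxE.
- move=> a1 b1 c1 p1 p1' q1 q1' r1 r1'; rewrite /W -!add3mxE -!mulrDl.
  rewrite -![_ * e _ * (_ # _)]mulrA -!mulrDr (crossC _ (e b1)).
  by rewrite RL' mulr0 !mul0r mxE.
- move=> a1 b1 c1 p1 p1' q1 q1' r1 r1'; rewrite /W -!add3mxE -!mulrDl.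
  rewrite -![_ * (_ # _) * e _]mulrA -!mulrDr.
  by rewrite RR' !mulr0 !mul0r mxE.
- move=> a1 b1 c1 p1 p1' q1 q1' r1 r1'; rewrite /W -!add3mxE.
  rewrite -![_ * e _ * (_ # _)]mulrA -!mulrDr (crossC _ (e c1)).
  by rewrite RL' !mulr0 mxE.
- move=> v p1 p1' q1 q1' r1 r1'; rewrite /W -!add3mxE.
  pose Th u v w := u * (e p1 # e p1') * v * (e q1 # e q1') * w * (e r1 # e r1').
  have Th0 u : inS u -> Th u u u = 0 by move=> hu; apply: (alt6 NF).
  have Sv := inS_add (Se x) (Se v).
  have Sv' := inS_add (Se x) (inS_scale (-1) (Se v)).
  have := Th0 _ Sv; have := Th0 _ Sv'; have := Th0 _ (Se x).
  rewrite /Th scaleN1r !(mulrDl, mulrDr, mulNr, mulrN) => t0 t1 t2.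
  suff -> : e x * (e p1 # e p1') * e x * (e q1 # e q1') * e v * (e r1 # e r1') +
    e x * (e p1 # e p1') * e v * (e q1 # e q1') * e x * (e r1 # e r1') +
    e v * (e p1 # e p1') * e x * (e q1 # e q1') * e x * (e r1 # e r1') = 0 by rewrite mxE.
  have := Th0 _ (Se v); rewrite /Th => tv.
  apply: (mx_reg2 NF); lcm (t2 ⊟ t1 ⊟ 2 ⊡ tv).
- by move=> p1 p1' q1 q1' r1 r1'; rewrite /W (alt6 NF) ?mxE.
- move=> a1 b1 c1 p1 p1' r1 r1'; rewrite /W -mulmxnE -add3mxE; apply: at_ij.
  have := cross_pair2 NF (Se x) (Se x) (Se b1) (Se c1).
  rewrite [X in X = _]crossC (cross_pair2 NF) // => h.
  have {}h := congr1 (fun A => e a1 * (e p1 # e p1') * A * (e r1 # e r1')) h.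
  rewrite /= !(mulrN, mulNr, mulrDr, mulrDl, mulrA) in h.
  lcm (0 ⊡ h ⊟ h).
- move=> a1 b1 c1 p1 p1' q1 q1' r1 r1'; rewrite /W -!add3mxE -opp3mxE; apply: at_ij.
  have h1 := star NF (Se b1) (Se c1) (Se q1) (Se q1') (Se r1) (Se r1').
  have h2 := cross_pair2 NF (Se r1) (Se r1') (Se q1) (Se q1').
  have := congr1 (fun A => e a1 * (e p1 # e p1') * A) h1.
  rewrite /= h2 !(mulrN, mulNr, mulrDr, mulrDl, mulrA) => h.
  lcm h.
- move=> u v q1 q1' r1 r1'; rewrite /W -!add3mxE.
  have := cube_zero NF (Se u) (Se v) (Se x) (Se x) (Se x) (Se r1) (Se r1') (Se q1) (Se q1').
  have z1 z : z * e x * (e x # e x) = 0 by rewrite -mulrA (sq0 NF) ?mulr0.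
  have z2 z : z * (e x # e x) * e x = 0 by rewrite -mulrA (sq0' NF) ?mulr0.
  rewrite /= !mulrA !(z1, z2, mul0r, addr0) => h.
  rewrite -[RHS](mxE0 K i j); apply: at_ij; lcm h.
- move=> u v q1 q1' r1 r1'; rewrite /W -!add3mxE -[RHS](mxE0 K i j); apply: at_ij.
  have := polar3 NF (phi := fun y b c => e x * (e q1 # e q1') * y * (e x # e x) * e v * (b # c)).
  move=> /(_ _ _ _ _ (e u) (e r1) (e r1')) h; rewrite -{}h //.
  + by rewrite (crossC (e r1) (e u)).
  + by move=> *; rewrite !(mulrDr, mulrDl).
  + by move=> *; rewrite crossDl !(mulrDr, mulrDl).
  + by move=> y b1 c1; rewrite (crossC b1).
  + by move=> y hy; have [-> _ _] := squares_all (Se x) hy (Se v) (Se q1) (Se q1').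
- move=> u v q1 q1' r1 r1'; rewrite /W -!add3mxE -[RHS](mxE0 K i j); apply: at_ij.
  have := polar3 NF (phi := fun y b c => e x * (b # c) * e v * (e r1 # e r1') * y * (e x # e x)).
  move=> /(_ _ _ _ _ (e u) (e q1) (e q1')) h; rewrite -{}h //.
  + by rewrite (crossC (e q1) (e u)).
  + by move=> *; rewrite !(mulrDr, mulrDl).
  + by move=> *; rewrite crossDl !(mulrDr, mulrDl).
  + by move=> y b1 c1; rewrite (crossC b1).
  + by move=> y hy; have [_ -> _] := squares_all (Se x) hy (Se v) (Se r1) (Se r1').
- move=> u v q1 q1' r1 r1'; rewrite /W -!add3mxE -[RHS](mxE0 K i j); apply: at_ij.
  have := polar3 NF (phi := fun y b c => e v * (b # c) * e x * (e q1 # e q1') * y * (e x # e x)).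
  move=> /(_ _ _ _ _ (e u) (e r1) (e r1')) h; rewrite -{}h //.
  + by rewrite (crossC (e r1) (e u)).
  + by move=> *; rewrite !(mulrDr, mulrDl).
  + by move=> *; rewrite crossDl !(mulrDr, mulrDl).
  + by move=> y b1 c1; rewrite (crossC b1).
  + by move=> y hy; have [_ _ ->] := squares_all (Se x) hy (Se v) (Se q1) (Se q1').
- by move: hx; rewrite /= !addnA addn0.
Qed.

Ltac linD := rewrite ?crossDl ?crossDr ?mulrDl ?mulrDr ?mulrDl ?mulrDr ?mulrDl //.
Ltac linZ := rewrite ?crossZl ?crossZr -?scalerAr -?scalerAl //.

Lemma word3_eq0 a b c p p' q q' r r' : inS a -> inS b -> inS c -> inS p -> inS p' ->
  inS q -> inS q' -> inS r -> inS r' ->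
  a * (p # p') * b * (q # q') * c * (r # r') = 0.
Proof.
move=> ha hb hc hp hp' hq hq' hr hr'; apply/matrixP=> i j; rewrite mxE0.
have ext (f : 'M[K]_3 -> 'M[K]_3) x : (forall y z, f (y + z) = f y + f z) ->
  (forall k y, f (k *: y) = k *: f y) -> inS x -> (forall k, f (e k) i j = 0) -> f x i j = 0.
  move=> fD fZ hx h; apply: (inS_lin (e := e) (f := fun x => f x i j)) => // [y z|k y].
  - by rewrite fD mxE.
  - by rewrite fZ mxE.
have cA (b' : 'M[K]_3) y z : (y + z) # b' = y # b' + z # b' by exact: crossDl.
apply: (ext (fun a => a * _ * _ * _ * _ * _)) ha _ => [u v|k u|i1]; [linD|linZ|].
apply: (ext (fun b => _ * _ * b * _ * _ * _)) hb _ => [u v|k u|i2]; [linD|linZ|].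
apply: (ext (fun b => _ * _ * _ * _ * b * _)) hc _ => [u v|k u|i3]; [linD|linZ|].
apply: (ext (fun b => _ * (b # _) * _ * _ * _ * _)) hp _ => [u v|k u|i4]; [linD|linZ|].
apply: (ext (fun b => _ * (_ # b) * _ * _ * _ * _)) hp' _ => [u v|k u|i5]; [linD|linZ|].
apply: (ext (fun b => _ * _ * _ * (b # _) * _ * _)) hq _ => [u v|k u|i6]; [linD|linZ|].
apply: (ext (fun b => _ * _ * _ * (_ # b) * _ * _)) hq' _ => [u v|k u|i7]; [linD|linZ|].
apply: (ext (fun b => _ * _ * _ * _ * _ * (b # _))) hr _ => [u v|k u|i8]; [linD|linZ|].
apply: (ext (fun b => _ * _ * _ * _ * _ * (_ # b))) hr' _ => [u v|k u|i9]; [linD|linZ|].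
by rewrite word_letters mxE.
Qed.
End Words.

(** * The span of the words *)

(** The sign changes when the first argument is exchanged with another one, up
    to elements of P. Two of five letters coincide, and an exchange makes the
    first argument one of them. *)
Lemma star5 (V : zmodType) (P : V -> Prop) :
  (forall x y, P x -> P y -> P (x - y)) -> (forall x, P (x + x) -> P x) ->
  forall f : 'I_4 -> 'I_4 -> 'I_4 -> 'I_4 -> 'I_4 -> V,
  (forall c x y z t, P (f c x y z t + f x c y z t)) ->
  (forall c x y z t, P (f c x y z t + f y x c z t)) ->
  (forall c x y z t, P (f c x y z t + f z x y c t)) ->
  (forall c x y z t, P (f c x y z t + f t x y z c)) ->
  forall c x y z t, P (f c x y z t).
Proof.
move=> PB half f s1 s2 s3 s4.
have c1 c y z t : P (f c c y z t) by apply: half; exact: s1.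
have c2 c x z t : P (f c x c z t) by apply: half; exact: s2.
have c3 c x y t : P (f c x y c t) by apply: half; exact: s3.
have c4 c x y z : P (f c x y z c) by apply: half; exact: s4.
have sub a b : P (a + b) -> P b -> P a by move=> h1 h2; rewrite -(addrK b a); exact: PB.
move=> c x y z t; case: (five_ord4P c x y z t) => [[] <-|[] <-|[] <-|<-] //.
- by apply: sub (s1 _ _ _ _ _) _.
- by apply: sub (s1 _ _ _ _ _) _.
- by apply: sub (s1 _ _ _ _ _) _.
- by apply: sub (s2 _ _ _ _ _) _.
- by apply: sub (s2 _ _ _ _ _) _.
- by apply: sub (s3 _ _ _ _ _) _.
Qed.

Section Closure.
Variables (K : comNzRingType) (e : 'I_4 -> 'M[K]_3).
Hypothesis NF : null_forms e.
Local Notation inS := (inS e).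
Ltac linD := move=> *; rewrite ?crossDl ?crossDr ?mulrDl ?mulrDr ?crossDl ?crossDr ?mulrDl ?mulrDr ?mulrDl //.
Ltac linZ := move=> *; rewrite -?scalerAr -?scalerAl ?crossZl ?crossZr -?scalerAr -?scalerAl //.
Implicit Types A B P X Y Z : 'M[K]_3.

(** The span of the words that begin and end with a letter: by word3_eq0 two
    adjugates are enough. The inductive form allows to argue word by word. *)
Inductive inW : 'M[K]_3 -> Prop :=
| W_letter a : inS a -> inW a
| W_triple a b c d : inS a -> inS b -> inS c -> inS d -> inW (a * (b # c) * d)
| W_quint a b c d f g h : inS a -> inS b -> inS c -> inS d -> inS f -> inS g -> inS h ->
    inW (a * (b # c) * d * (f # g) * h)
| W_add A B : inW A -> inW B -> inW (A + B).

Lemma inW_scale k A : inW A -> inW (k *: A).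
Proof.
elim=> [a ha|a b c d ha *|a b c d f g h ha *|X Y _ hX _ hY].
- by apply: W_letter; exact: inS_scale.
- by rewrite !scalerAl; apply: W_triple => //; exact: inS_scale.
- by rewrite !scalerAl; apply: W_quint => //; exact: inS_scale.
- by rewrite scalerDr; exact: W_add.
Qed.

Lemma inW_0 : inW 0.
Proof. by rewrite -(scale0r (e 0)); apply: inW_scale; apply: W_letter; exact: inS_e. Qed.

Lemma inW_opp A : inW A -> inW (- A).
Proof. by rewrite -scaleN1r; exact: inW_scale. Qed.

Lemma inW_sub A B : inW A -> inW B -> inW (A - B).
Proof. by move=> hA hB; apply: W_add => //; exact: inW_opp. Qed.

Lemma inW_half A : inW (A + A) -> inW A.
Proof.
have [h hh] := nf_half NF; move=> /(inW_scale h).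
by rewrite scalerDr -scalerDl hh scale1r.
Qed.

Lemma inW_sum (f : 'I_4 -> 'M[K]_3) : (forall i, inW (f i)) -> inW (\sum_i f i).
Proof. by move=> h; elim/big_ind: _ => //; [exact: inW_0 | exact: W_add]. Qed.

Lemma inW_lin (f : 'M[K]_3 -> 'M[K]_3) : (forall x y, f (x + y) = f x + f y) ->
  (forall a x, f (a *: x) = a *: f x) -> (forall i, inW (f (e i))) ->
  forall x, inS x -> inW (f x).
Proof.
move=> fD fZ fe _ [c ->].
have f0 : f 0 = 0 by have := fZ 0 0; rewrite !scale0r.
rewrite (big_morph f fD f0); apply: inW_sum => i.
by rewrite fZ; apply: inW_scale.
Qed.

Lemma inW_tr A : inW A -> inW A^T.
Proof.
have tr1 a := inS_sym NF (x := a).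
have tr2 a b := cross_sym NF (a := a) (b := b).
elim=> [a ha|a b c d *|a b c d f g h *|X Y _ hX _ hY].
- by rewrite tr1 //; exact: W_letter.
- by rewrite !trM3 tr2 // !tr1 // !mulrA; exact: W_triple.
- by rewrite !trM3 !tr2 // !tr1 // !mulrA; exact: W_quint.
- by rewrite linearD; exact: W_add.
Qed.

(** A word with three adjugate factors vanishes, so words can be prefixed
    without getting longer than five factors. *)
Lemma inW_prefix u b c A : inS u -> inS b -> inS c -> inW A -> inW (u * (b # c) * A).
Proof.
move=> hu hb hc; elim=> [a ha|a b1 c1 d *|a b1 c1 d f g h *|X Y _ hX _ hY].
- exact: W_triple.
- by rewrite !mulrA; exact: W_quint.
- by rewrite !mulrA (word3_eq0 NF) // mul0r; exact: inW_0.
- by rewrite mulrDr; exact: W_add.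
Qed.

Lemma inW_suffix u b c A : inS u -> inS b -> inS c -> inW A -> inW (A * (b # c) * u).
Proof.
move=> hu hb hc /inW_tr hA; rewrite -[_ * u]trmxK; apply: inW_tr.
by rewrite !trM3 (cross_sym NF) // (inS_sym NF hu) mulrA; exact: inW_prefix.
Qed.

(** The matrices that can take the place of an adjugate in a word. *)
Definition inD P := forall z w, inS z -> inS w -> inW (z * P * w).

Lemma inD_add P X : inD P -> inD X -> inD (P + X).
Proof. by move=> hP hX z w hz hw; rewrite mulrDr mulrDl; apply: W_add; [exact: hP|exact: hX]. Qed.
Lemma inD_opp P : inD P -> inD (- P).
Proof. by move=> hP z w hz hw; rewrite mulrN mulNr; apply: inW_opp; exact: hP. Qed.
Lemma inD_sub P X : inD P -> inD X -> inD (P - X).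
Proof. by move=> hP hX; apply: inD_add => //; exact: inD_opp. Qed.
Lemma inD_cross a b : inS a -> inS b -> inD (a # b).
Proof. by move=> ha hb z w hz hw; exact: W_triple. Qed.
Lemma inD_prefix b c u P : inS b -> inS c -> inS u -> inD P -> inD ((b # c) * u * P).
Proof.
move=> hb hc hu hP z w hz hw.
have -> : z * (b # c * u * P) * w = z * (b # c) * (u * P * w) by rewrite !mulrA.
by apply: inW_prefix => //; exact: hP.
Qed.
Lemma inD_suffix b c u P : inS b -> inS c -> inS u -> inD P -> inD (P * u * (b # c)).
Proof.
move=> hb hc hu hP z w hz hw.
rewrite (_ : _ * w = (z * P * u) * (b # c) * w) ?mulrA //.
by apply: inW_suffix => //; exact: hP.
Qed.

(** u (b # c) is trace-free, so it moves from one argument of a cross product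
    to the other and to the outside. *)
Lemma cross_moveL u b c A B : inS u -> inS b -> inS c ->
  (u * (b # c) * A) # B = - (A # (u * (b # c) * B)) - (b # c) * u * (A # B).
Proof.
move=> hu hb hc; have := cross_der (u * (b # c)) A B.
rewrite (tr1_S NF) // scale0r trM3 (cross_sym NF) // (inS_sym NF hu) => h.
lcm (h ⊞ 0 ⊡ h).
Qed.
Lemma cross_moveR u b c A B : inS u -> inS b -> inS c ->
  (A * (b # c) * u) # B = - (A # (B * (b # c) * u)) - (A # B) * u * (b # c).
Proof.
move=> hu hb hc; have := congr1 trmx (cross_moveL A^T B^T hu hb hc).
rewrite linearB linearN /= !(trmx_cross, trM3) !trmxK !(inS_sym NF) // !mulrA => ->.
by [].
Qed.

Lemma theta_crossE A B C : theta A B C = \tr (A^T * (B # C)). Proof. by []. Qed.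

Lemma thetaC12 A B C : theta A B C = theta B A C.
Proof. by rewrite !theta_crossE !mx3E; ring. Qed.
Lemma thetaC23 A B C : theta A B C = theta A C B.
Proof. by rewrite /theta crossC. Qed.

Lemma theta_rot A B C : theta A B C = theta C A B.
Proof. by rewrite thetaC23 thetaC12. Qed.

(** theta_mul at z, a and X: the letter before the cross product and the one
    inside can be exchanged, up to a product in which X stands alone. *)
Lemma outer_swapL z a X w : inS z -> inS a -> \tr (X^T * (z # a)) = 0 ->
  z * (a # X) * w + a * (z # X) * w = - (X^T * (z # a) * w).
Proof.
move=> hz ha th; have := theta_mul z a X.
rewrite theta_rot theta_crossE th.
rewrite (inS_sym NF hz) (inS_sym NF ha) scale0r (crossC X z) => /(congr1 (fun A => A * w)).
rewrite /= mul0r !mulrDl => h; lcm (h ⊞ 0 ⊡ h).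
Qed.
Lemma outer_swapR z a X w : inS w -> inS a -> \tr (X^T * (w # a)) = 0 ->
  z * (a # X) * w + z * (w # X) * a = - (z * (w # a) * X^T).
Proof.
move=> hw ha th; have th' : \tr (X^T^T * (w # a)) = 0.
  by rewrite trmxK -mxtrace_tr trM3 (cross_sym NF) // trC3.
have := congr1 trmx (outer_swapL z^T hw ha th').
rewrite linearN linearD /= !(trmx_cross, trM3) !trmxK (inS_sym NF hw) (inS_sym NF ha) !mulrA => ->.
by [].
Qed.

Lemma inW_swap (X Y Z : 'M[K]_3) : X + Y = - Z -> inW Z -> inW (X + Y).
Proof. by move=> ->; exact: inW_opp. Qed.

Lemma trT3 a b c d : inS a -> inS b -> inS c -> inS d ->
  (a * (b # c) * d)^T = d * (b # c) * a.
Proof. by move=> *; rewrite !trM3 (cross_sym NF) // !(inS_sym NF) // mulrA. Qed.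
Lemma trT5 a b c d f g h : inS a -> inS b -> inS c -> inS d -> inS f -> inS g -> inS h ->
  (a * (b # c) * d * (f # g) * h)^T = h * (f # g) * d * (b # c) * a.
Proof. by move=> *; rewrite !trM3 !(cross_sym NF) // !(inS_sym NF) // !mulrA. Qed.

(** Each of the five letters z, a, u, v, w can be exchanged with a up to sign
    and up to words, by outer_swapL and cross_moveL and their mirror images,
    so that star5 applies. *)
Lemma inD_cross_triple a u b c v : inS a -> inS u -> inS b -> inS c -> inS v ->
  inD (a # (u * (b # c) * v)).
Proof.
move=> ha hu hb hc hv z w hz hw; have Se := inS_e e.
have key := star5 (P := inW) inW_sub inW_half
  (f := fun a z u v w => e z * (e a # (e u * (b # c) * e v)) * e w).
apply: (inW_lin (f := fun a => z * (a # _) * w)) ha => [||ia]; [by linD|by linZ|].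
apply: (inW_lin (f := fun u => z * (_ # (u * _ * _)) * w)) hu => [||iu]; [by linD|by linZ|].
apply: (inW_lin (f := fun v => z * (_ # (_ * _ * v)) * w)) hv => [||iv]; [by linD|by linZ|].
apply: (inW_lin (f := fun z => z * _ * w)) hz => [||iz]; [by linD|by linZ|].
apply: (inW_lin (f := fun w => _ * w)) hw => [||iw]; [by linD|by linZ|].
apply: key => {ia iu iv iz iw} a1 z1 u1 v1 w1.
- apply: inW_swap (outer_swapL _ _ _ _) _ => //; rewrite trT3 // ?(tr2_S NF) //.
  exact: W_quint.
- rewrite -mulrDl -mulrDr (crossC (e a1)) (crossC (e u1)) cross_moveR // (crossC (e u1)).
  rewrite addrAC addNr add0r mulrN mulNr !mulrA; apply: inW_opp; exact: W_quint.
- rewrite -mulrDl -mulrDr (crossC (e a1)) cross_moveL //.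
  rewrite addrAC addNr add0r mulrN mulNr !mulrA; apply: inW_opp; exact: W_quint.
- apply: inW_swap (outer_swapR _ _ _ _) _ => //; rewrite trT3 // ?(tr2_S NF) // !mulrA.
  exact: W_quint.
Qed.

(** Up to words, the product is symmetric in a and u', and alternating in a
    and the outer letter z. Three such exchanges lead back to the product with
    the opposite sign. *)
Lemma inD_cross_quint a u b c u' b' c' v : inS a -> inS u -> inS b -> inS c ->
  inS u' -> inS b' -> inS c' -> inS v ->
  inD (a # (u * (b # c) * u' * (b' # c') * v)).
Proof.
move=> ha hu hb hc hu' hb' hc' hv.
pose f a u' := a # (u * (b # c) * u' * (b' # c') * v).
(* symmetric in the letters a and u', alternating in a and the outer letter *)
have sym x y : inS x -> inS y -> inD (f x y - f y x).
  move=> hx hy.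
  have e1 : f x y = - ((y * (b' # c') * v) # (u * (b # c) * x))
      - (b # c) * u * ((y * (b' # c') * v) # x).
    by rewrite -cross_moveL // crossC !mulrA.
  have e2 := cross_moveR y (u * (b # c) * x) hv hb' hc'.
  have -> : f x y - f y x = (y # (u * (b # c) * x)) * v * (b' # c')
      - (b # c) * u * ((y * (b' # c') * v) # x).
    rewrite -/(f y x) in e2; lcm (e1 ⊟ e2).
  apply: inD_sub; [apply: inD_suffix | rewrite (crossC _ x); apply: inD_prefix] => //;
    exact: inD_cross_triple.
have alt z x y w : inS z -> inS x -> inS y -> inS w -> z * f x y * w = - (x * f z y * w).
  move=> hz hx hy hw; apply/eqP; rewrite -addr_eq0 outer_swapL //.
    by rewrite trT5 // -!mulrA (mulrA v) !mulrA (word3_eq0 NF) // mul0r oppr0.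
  by rewrite trT5 // -!mulrA !mulrA (tr3_S NF).
move=> z w hz hw; rewrite -/(f a u'); apply: inW_half.
have h1 := sym _ _ ha hu' _ _ hz hw; have h2 := sym _ _ hz hu' _ _ ha hw.
have h3 := sym _ _ ha hz _ _ hu' hw.
have split3 : z * f a u' * w + z * f a u' * w = z * (f a u' - f u' a) * w
    - a * (f z u' - f u' z) * w + u' * (f a z - f z a) * w.
  have a1 := alt z a u' w hz ha hu' hw; have a2 := alt z u' a w hz hu' ha hw.
  have a3 := alt a u' z w ha hu' hz hw.
  rewrite !(mulrBr, mulrBl); lcm (a1 ⊞ a2 ⊟ a3).
rewrite split3; apply: W_add; first exact: inW_sub h1 h2.
exact: h3.
Qed.

Lemma inD_cross_letter a X : inS a -> inW X -> inD (a # X).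
Proof.
move=> ha; elim=> [b hb|b c d f *|b c d f g h k *|A B _ hA _ hB].
- exact: inD_cross.
- exact: inD_cross_triple.
- exact: inD_cross_quint.
- by rewrite crossDr; exact: inD_add.
Qed.

(** Prefixes u (b # c) of the first factor are moved to the second one and to
    the outside, until the first factor is a letter. *)
Lemma inD_cross_words X Y : inW X -> inW Y -> inD (X # Y).
Proof.
move=> + hY; elim=> [b hb|b c d f *|b c d f g h k *|A B _ hA _ hB].
- exact: inD_cross_letter.
- rewrite cross_moveL //; apply: inD_sub; [apply: inD_opp; apply: inD_cross_letter|apply: inD_prefix] => //.
    exact: inW_prefix.
  exact: inD_cross_letter.
- have tri u v w t Z : inS u -> inS v -> inS w -> inS t -> inW Z -> inD ((u * (v # w) * t) # Z).
    move=> hu hv hw ht hZ.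
    rewrite cross_moveL //; apply: inD_sub; [apply: inD_opp; apply: inD_cross_letter|apply: inD_prefix] => //.
      exact: inW_prefix.
    exact: inD_cross_letter.
  rewrite -!mulrA (mulrA b) cross_moveL // !mulrA.
  apply: inD_sub; [apply: inD_opp; apply: tri|apply: inD_prefix] => //.
    exact: inW_prefix.
  exact: tri.
- by rewrite crossDl; exact: inD_add.
Qed.

Lemma inD_word Z P V : inW Z -> inD P -> inW V -> inW (Z * P * V).
Proof.
move=> + hP; have left z W : inS z -> inW W -> inW (z * P * W).
  move=> hz; elim=> [w hw|b c d f *|b c d f g h k *|A B _ hA _ hB].
  - exact: hP.
  - by rewrite !mulrA; apply: inW_suffix => //; exact: hP.
  - by rewrite !mulrA; do 2!apply: inW_suffix => //; exact: hP.
  - by rewrite mulrDr; exact: W_add.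
move=> + hV; elim=> [w hw|b c d f *|b c d f g h k *|A B _ hA _ hB].
- exact: left.
- have -> : b * (c # d) * f * P * V = b * (c # d) * (f * P * V) by rewrite !mulrA.
  by apply: inW_prefix => //; exact: left.
- have -> : b * (c # d) * f * (g # h) * k * P * V = b * (c # d) * (f * (g # h) * (k * P * V)).
    by rewrite !mulrA.
  by do 2!apply: inW_prefix => //; exact: left.
- by rewrite !mulrDl; exact: W_add.
Qed.
End Closure.

(** * The trilinear form on words *)

Section Epsilon.
Variable K : comNzRingType.
(** The Levi-Civita symbol. *)
Definition eps (i j k : 'I_3) : K :=
  if (j == i + 1) && (k == i + 2) then 1
  else if (j == i + 2) && (k == i + 1) then -1 else 0.

(** The vector that corresponds to the skew part of X, and the skew matrix
    that corresponds to a vector. *)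
Definition axial (X : 'M[K]_3) : 'cV[K]_3 :=
  \col_k (X (k + 1) (k + 2) - X (k + 2) (k + 1)).
Definition skew_of (v : 'cV[K]_3) : 'M[K]_3 :=
  \matrix_(a, b) \sum_m eps m a b * v m 0.

Lemma sum_eps (f : 'I_3 -> 'I_3 -> K) k :
  \sum_i \sum_j eps i j k * f i j = f (k + 1) (k + 2) - f (k + 2) (k + 1).
Proof.
rewrite !sum3E /eps; move: k; apply: ord3P; rewrite !add3E /= ?eqxx /=; ring.
Qed.

Lemma eps_rot i j k : eps i j k = eps j k i.
Proof. by move: i j k; do 3!apply: ord3P. Qed.
Lemma eps_swap i j k : eps i j k = - eps j i k.
Proof. by move: i j k; do 3!apply: ord3P; rewrite /eps /= ?oppr0 ?opprK. Qed.

Lemma skewD u v : skew_of (u + v) = skew_of u + skew_of v.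
Proof.
apply/matrixP=> i j; rewrite !mxE -big_split; apply: eq_bigr => m _.
by rewrite mxE mulrDr.
Qed.

Lemma skewE v : (((skew_of v) 0%R 0%R = 0%R) * ((skew_of v) 1%R 1%R = 0%R) * ((skew_of v) 2%R 2%R = 0%R) *
  ((skew_of v) 0%R 1%R = v 2%R 0%R) * ((skew_of v) 1%R 2%R = v 0%R 0%R) * ((skew_of v) 2%R 0%R = v 1%R 0%R) *
  ((skew_of v) 1%R 0%R = - v 2%R 0%R) * ((skew_of v) 2%R 1%R = - v 0%R 0%R) * ((skew_of v) 0%R 2%R = - v 1%R 0%R))%type.
Proof.
by do ![split]; rewrite mxE sum3E /eps /= !(mul0r, addr0, add0r, mul1r, mulN1r).
Qed.

Lemma skew_axial X : skew_of (axial X) = X - X^T.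
Proof.
apply/matrixP; do 2!apply: ord3P; rewrite !mx3E !skewE ?mxE ?add3E; ring.
Qed.

Lemma skew_mul (M : 'M[K]_3) v :
  skew_of (M *m v) = \tr M *: skew_of v - M^T * skew_of v - skew_of v * M.
Proof.
apply/matrixP; do 2!apply: ord3P; rewrite !mx3E !skewE ?mxE ?sum3E ?skewE; ring.
Qed.

(** Together with skew_axial this turns the action of a letter on an axial
    vector into a cross product of words. *)
Lemma skew_sym_mul (b : 'M[K]_3) v : b^T = b -> skew_of (b *m v) = cross b (skew_of v).
Proof.
move=> hb; have s i j : b i j = b j i by rewrite -{1}hb mxE.
apply/matrixP; do 2!apply: ord3P; rewrite !mx3E !skewE ?mxE ?sum3E ?skewE;
 rewrite ?(s 1 0) ?(s 2 0) ?(s 2 1); ring.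
Qed.

Lemma trace_skew (X : 'M[K]_3) v : \tr (X^T * skew_of v) = \sum_k axial X k 0 * v k 0.
Proof. rewrite !mx3E !skewE sum3E !mxE !add3E; ring. Qed.
End Epsilon.

Section ThetaWords.
Variables (K : comNzRingType) (e : 'I_4 -> 'M[K]_3).
Hypothesis NF : null_forms e.
Local Notation inS := (inS e).
Local Notation inW := (inW e).
Local Notation inD := (inD e).
Implicit Types A B P X Y Z : 'M[K]_3.

Lemma thetaDl A B Y Z : theta (A + B) Y Z = theta A Y Z + theta B Y Z.
Proof. by rewrite /theta linearD mulrDl mxtraceD. Qed.
Lemma thetaZl k A Y Z : theta (k *: A) Y Z = k * theta A Y Z.
Proof. by rewrite /theta linearZ -scalerAl mxtraceZ. Qed.
Lemma thetaDm A B Y Z : theta Y (A + B) Z = theta Y A Z + theta Y B Z.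
Proof. by rewrite thetaC12 thetaDl !(thetaC12 Y). Qed.
Lemma thetaZm k A Y Z : theta Y (k *: A) Z = k * theta Y A Z.
Proof. by rewrite thetaC12 thetaZl thetaC12. Qed.
Lemma thetaDr A B Y Z : theta Y Z (A + B) = theta Y Z A + theta Y Z B.
Proof. by rewrite thetaC23 thetaDm !(thetaC23 Y Z). Qed.
Lemma thetaZr k A Y Z : theta Y Z (k *: A) = k * theta Y Z A.
Proof. by rewrite thetaC23 thetaZm thetaC23. Qed.
Lemma theta_tr A B C : theta A^T B^T C^T = theta A B C.
Proof. by rewrite /theta -trmx_cross -mxtrace_tr trM3 !trmxK trC3. Qed.

Lemma theta_move (M A B C : 'M[K]_3) : \tr M = 0 ->
  theta (M * A) B C = - theta A (M * B) C - theta A B (M * C).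
Proof.
move=> hM; rewrite /theta trM3 -mulrA; have := cross_der M B C.
rewrite hM scale0r => /eqP; rewrite addrC addr_eq0 => /eqP ->.
by rewrite mulrN mulrDr linearN linearD /= opprD.
Qed.

(** The inner parts of the words with one and with two adjugates. *)
Inductive mid : 'M[K]_3 -> Prop :=
| Mid1 b c : inS b -> inS c -> mid (b # c)
| Mid2 b c u d f : inS b -> inS c -> inS u -> inS d -> inS f ->
    mid ((b # c) * u * (d # f)).

Lemma mid_tr P : mid P -> mid P^T.
Proof.
case=> *; first by rewrite (cross_sym NF) //; exact: Mid1.
by rewrite !trM3 !(cross_sym NF) // (inS_sym NF) // mulrA; exact: Mid2.
Qed.
Lemma mid_trace P u : mid P -> inS u -> \tr (u * P) = 0.
Proof.
case=> * ; first exact: (tr1_S NF).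
by rewrite !mulrA (tr2_S NF).
Qed.
Lemma mid_prefix P u A : mid P -> inS u -> inW A -> inW (u * P * A).
Proof.
case=> [b c *|b c w d f *]; first exact: (inW_prefix NF).
have -> : u * ((b # c) * w * (d # f)) * A = u * (b # c) * (w * (d # f) * A) by rewrite !mulrA.
by do 2!apply: (inW_prefix NF) => //.
Qed.

Lemma theta_letters a b X : inS a -> inS b -> inW X -> theta a b X = 0.
Proof.
move=> ha hb; rewrite theta_rot.
elim=> [c hc|c d f g *|c d f g h k l *|A B _ hA _ hB].
- exact: (theta_S NF).
- by rewrite /theta (trT3 NF) // (tr2_S NF).
- by rewrite /theta (trT5 NF) // (tr3_S NF).
- by rewrite thetaDl hA hB addr0.
Qed.

Lemma theta_swapR a u P v Y : inS a -> inS u -> mid P -> inS v -> inW Y ->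
  theta a (u * P * v) Y + theta v (u * P * a) Y = 0.
Proof.
move=> ha hu hP hv hY; rewrite thetaC12 theta_move ?mid_trace // thetaC12.
rewrite (theta_letters hv ha) ?subr0; last exact: mid_prefix.
by rewrite thetaC12 addNr.
Qed.
Lemma theta_swapL a u P v Y : inS a -> inS u -> mid P -> inS v -> inW Y ->
  theta a (u * P * v) Y + theta u (a * P * v) Y = 0.
Proof.
move=> ha hu hP hv hY; have := theta_swapR ha hv (mid_tr hP) hu (inW_tr NF hY).
rewrite -theta_tr -[X in _ + X]theta_tr !trM3 !trmxK !(inS_sym NF) //.
by rewrite !mulrA.
Qed.

Ltac lnD := move=> *; rewrite ?mulrDl ?mulrDr ?mulrDl ?thetaDl ?thetaDm ?thetaDr //.
Ltac lnZ := move=> *; rewrite -?scalerAr -?scalerAl ?thetaZl ?thetaZm ?thetaZr //.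

(** Each of the letters b, c, d, f can be exchanged with a up to sign, so that
    star5 applies. *)
Lemma theta_mids a b P c d Q f : inS a -> inS b -> mid P -> inS c -> inS d -> mid Q -> inS f ->
  theta a (b * P * c) (d * Q * f) = 0.
Proof.
move=> ha hb hP hc hd hQ hf; have Se := inS_e e.
apply: (inS_lin (f := fun a => theta a _ _)) ha => [||ia]; [by lnD|by lnZ|].
apply: (inS_lin (f := fun b => theta _ (b * _ * _) _)) hb => [||ib]; [by lnD|by lnZ|].
apply: (inS_lin (f := fun c => theta _ (_ * c) _)) hc => [||ic]; [by lnD|by lnZ|].
apply: (inS_lin (f := fun d => theta _ _ (d * _ * _))) hd => [||id]; [by lnD|by lnZ|].
apply: (inS_lin (f := fun f => theta _ _ (_ * f))) hf => [||ig]; [by lnD|by lnZ|].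
have Wm u R v : mid R -> inS u -> inS v -> inW (u * R * v).
  by move=> hR hu hv; apply: mid_prefix => //; exact: W_letter.
apply: (star5 (P := eq^~ 0) _ (nf_reg2 NF)
  (f := fun a b c d g => theta (e a) (e b * P * e c) (e d * Q * e g))).
- by move=> x y -> ->; rewrite subr0.
- by move=> *; apply: theta_swapL => //; exact: Wm.
- by move=> *; apply: theta_swapR => //; exact: Wm.
- by move=> *; rewrite thetaC23 [X in _ + X]thetaC23; apply: theta_swapL => //; exact: Wm.
- by move=> *; rewrite thetaC23 [X in _ + X]thetaC23; apply: theta_swapR => //; exact: Wm.
Qed.

Lemma theta_letter a X Y : inS a -> inW X -> inW Y -> theta a X Y = 0.
Proof.
move=> ha hX; have mm u b c w d f v : mid ((b # c) * w * (d # f)) ->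
    u * (b # c) * w * (d # f) * v = u * ((b # c) * w * (d # f)) * v by rewrite !mulrA.
elim=> [c hc|c d f g *|c d f g h k l *|A B _ hA _ hB].
- by rewrite thetaC23 theta_letters.
- elim: hX => [b hb|b1 b2 b3 b4 *|b1 b2 b3 b4 b5 b6 b7 *|A B _ hA _ hB].
  + by rewrite theta_letters //; exact: W_triple.
  + by apply: theta_mids => //; exact: Mid1.
  + by rewrite mm; first apply: theta_mids => //; [exact: Mid2|exact: Mid1|exact: Mid2].
  + by rewrite thetaDm hA hB addr0.
- elim: hX => [b hb|b1 b2 b3 b4 *|b1 b2 b3 b4 b5 b6 b7 *|A B _ hA _ hB].
  + by rewrite theta_letters //; exact: W_quint.
  + by rewrite mm; first apply: theta_mids => //; [exact: Mid1|exact: Mid2|exact: Mid2].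
  + by rewrite !mm; first apply: theta_mids => //; exact: Mid2.
  + by rewrite thetaDm hA hB addr0.
- by rewrite thetaDr hA hB addr0.
Qed.

(** theta_move takes the trace-free prefixes u (b # c) away from the first
    argument, until a letter is left there. *)
Lemma theta_words X Y Z : inW X -> inW Y -> inW Z -> theta X Y Z = 0.
Proof.
move=> + hY hZ; elim=> [c hc|c d f g *|c d f g h k l *|A B _ hA _ hB].
- exact: theta_letter.
- by rewrite theta_move ?(tr1_S NF) // !theta_letter ?subr0 ?oppr0 //; exact: (inW_prefix NF).
- have -> : c * (d # f) * g * (h # k) * l = c * (d # f) * (g * (h # k) * l) by rewrite !mulrA.
  have W3 A : inW A -> inW (g * (h # k) * A) by move=> *; exact: (inW_prefix NF).
  have W3' A : inW A -> inW (c * (d # f) * A) by move=> *; exact: (inW_prefix NF).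
  have tri A B : inW A -> inW B -> theta (g * (h # k) * l) A B = 0.
    move=> hA hB; rewrite theta_move ?(tr1_S NF) // !theta_letter ?subr0 ?oppr0 //; exact: W3.
  by rewrite theta_move ?(tr1_S NF) // !tri ?subr0 ?oppr0 //; exact: W3'.
- by rewrite thetaDl hA hB addr0.
Qed.

(** A loop with label X amounts to the vector axial X. Here this vector is
    carried along an edge with label C and read as a matrix at the next
    vertex. *)
Lemma skew_words C X : inW C -> inW X -> inD (skew_of (C *m axial X)).
Proof.
move=> + hX; have letter b : inS b -> inD (skew_of (b *m axial X)).
  move=> hb; rewrite (skew_sym_mul _ (inS_sym NF hb)) skew_axial.
  apply: (inD_cross_words NF); first exact: W_letter.
  by apply: inW_sub => //; exact: (inW_tr NF).
have pre u b c (v : 'cV_3) : inS u -> inS b -> inS c -> inD (skew_of v) ->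
    inD (skew_of ((u * (b # c)) *m v)).
  move=> hu hb hc hv; rewrite skew_mul (tr1_S NF) // scale0r add0r.
  rewrite trM3 (cross_sym NF) // (inS_sym NF) // mulrA.
  by apply: inD_sub; [apply: inD_opp; exact: (inD_prefix NF) | exact: (inD_suffix NF)].
elim=> [c hc|c d f g *|c d f g h k l *|A B _ hA _ hB].
- exact: letter.
- by rewrite -mulmxA; apply: (pre) => //; exact: letter.
- have -> : c * (d # f) * g * (h # k) * l = c * (d # f) * (g * (h # k) * l) by rewrite !mulrA.
  by rewrite -mulmxA; apply: (pre) => //; rewrite -mulmxA; apply: (pre) => //; exact: letter.
- by rewrite mulmxDl skewD; exact: inD_add.
Qed.

(** The graph of two loops X and Z that are joined by an edge C. *)
Lemma axial_words C X Z : inW C -> inW X -> inW Z ->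
  \sum_k axial Z k 0 * (C *m axial X) k 0 = 0.
Proof.
rewrite -trace_skew => + hX; have letter b Y : inS b -> inW Y -> \tr (Y^T * skew_of (b *m axial X)) = 0.
  move=> hb hY; rewrite (skew_sym_mul _ (inS_sym NF hb)) skew_axial.
  apply: theta_words => //; first exact: W_letter.
  by apply: inW_sub => //; exact: (inW_tr NF).
have pre u b c (v : 'cV_3) Y : inS u -> inS b -> inS c -> inW Y ->
  (forall Y', inW Y' -> \tr (Y'^T * skew_of v) = 0) ->
  \tr (Y^T * skew_of ((u * (b # c)) *m v)) = 0.
  move=> hu hb hc hY hv; rewrite skew_mul (tr1_S NF) // scale0r add0r.
  have h1 := hv _ (inW_prefix NF hu hb hc hY).
  have h2 := hv _ (inW_suffix NF hu hb hc hY).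
  rewrite !trM3 (cross_sym NF) // (inS_sym NF hu) !mulrA in h1 h2 *.
  rewrite mulrBr mulrN linearB linearN /= !mulrA h1 oppr0 add0r.
  by rewrite -[_ * _ * (b # c)]mulrA trC3 !mulrA h2 oppr0.
move=> hC; elim: hC Z => [c hc|c d f g ? ? ? ?|c d f g h k l ? ? ? ? ? ? ?|A B _ hA _ hB] Z hZ.
- exact: letter.
- by rewrite -mulmxA; apply: (pre) => // *; exact: letter.
- have -> : c * (d # f) * g * (h # k) * l = c * (d # f) * (g * (h # k) * l) by rewrite !mulrA.
  rewrite -mulmxA; apply: (pre) => // Y hY; rewrite -mulmxA; apply: (pre) => // Y' hY'.
  exact: letter.
- by rewrite mulmxDl skewD mulrDr linearD /= hA // hB // addr0.
Qed.
End ThetaWords.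

(** * Contraction graphs *)

(** Assignments of indices to the names of half-edges. *)
Notation env := (nat -> 'I_3).
Definition upd (r : env) n i : env := fun m => if m == n then i else r m.

Lemma upd_same r n i : upd r n i n = i. Proof. by rewrite /upd eqxx. Qed.
Lemma upd_other r n i m : m != n -> upd r n i m = r m. Proof. by rewrite /upd => /negPf ->. Qed.
Lemma updC r n m i j : n != m -> upd (upd r n i) m j = upd (upd r m j) n i.
Proof.
move=> nm; apply/funext => x; rewrite /upd; case: (eqVneq x m) => // ->.
by rewrite eq_sym (negPf nm).
Qed.

Section SumN.
Variable V : nmodType.
Implicit Types (f : env -> V) (s t : seq nat).

Fixpoint sumN s f (r : env) : V :=
  if s is n :: s' then \sum_i sumN s' f (upd r n i) else f r.

Lemma eq_sumN s f g : f =1 g -> sumN s f =1 sumN s g.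
Proof. by move=> fg; elim: s => //= n s IH r; apply: eq_bigr => i _. Qed.

Lemma sumN_cat s t f r : sumN (s ++ t) f r = sumN s (sumN t f) r.
Proof. by elim: s r => //= n s IH r; apply: eq_bigr. Qed.

Lemma sumN_swap n m f r : n != m -> sumN [:: n; m] f r = sumN [:: m; n] f r.
Proof.
move=> nm /=; rewrite exchange_big; apply: eq_bigr => i _; apply: eq_bigr => j _.
by rewrite updC.
Qed.

Lemma sumN_front n s f r : n \notin s -> sumN (n :: s) f r = sumN (rcons s n) f r.
Proof.
elim: s r => //= m s IH r; rewrite inE negb_or => /andP[nm ns].
have := sumN_swap (sumN s f) r nm; rewrite /= => ->.
by apply: eq_bigr => i _; rewrite -IH.
Qed.

Lemma sumN_perm s t f r : uniq s -> perm_eq s t -> sumN s f r = sumN t f r.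
Proof.
elim: s t r => [|n s IH] t r; first by move=> _; rewrite perm_sym => /perm_nilP ->.
move=> /= /andP[ns us] st.
have nt : n \in t by rewrite -(perm_mem st) mem_head.
case/splitPr: nt st => t1 t2; rewrite -(cat1s n t2) perm_sym perm_catCA /= perm_cons perm_sym => st.
rewrite -cat_rcons sumN_cat.
have nt1 : n \notin t1.
  by apply: contra ns; rewrite (perm_mem st) mem_cat => ->.
rewrite -(sumN_front (sumN t2 f) _ nt1) /=; apply: eq_bigr => i _.
by rewrite -sumN_cat; exact: IH.
Qed.

Lemma sumN0 s r : sumN s (fun=> 0) r = 0.
Proof. by elim: s r => //= n s IH r; rewrite big1. Qed.

Lemma sumND s f g r : sumN s (fun x => f x + g x) r = sumN s f r + sumN s g r.
Proof.
elim: s r => //= n s IH r; rewrite -big_split; exact: eq_bigr.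
Qed.

Lemma sumN_sum (J : Type) (l : seq J) (P : pred J) s (f : J -> env -> V) r :
  sumN s (fun x => \sum_(j <- l | P j) f j x) r = \sum_(j <- l | P j) sumN s (f j) r.
Proof.
elim: s r => //= n s IH r; rewrite exchange_big; exact: eq_bigr.
Qed.

Definition indep s (g : env -> V) := forall n, n \in s -> forall r i, g (upd r n i) = g r.

End SumN.

Lemma sumN_morph (V W : nmodType) (phi : {additive V -> W}) s f r :
  phi (sumN s f r) = sumN s (phi \o f) r.
Proof. by elim: s r => //= n s IH r; rewrite raddf_sum; apply: eq_bigr. Qed.

Lemma sumN_mulr (R : pzRingType) s (f h : env -> R) r : indep s h ->
  sumN s (fun x => f x * h x) r = sumN s f r * h r.
Proof.
elim: s r => //= n s IH r hs; rewrite big_distrl; apply: eq_bigr => i _ /=.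
rewrite IH; first by rewrite hs // mem_head.
by move=> m ms; apply: hs; rewrite inE ms orbT.
Qed.

Lemma sumN_opp (V : zmodType) s (f : env -> V) r : sumN s (fun x => - f x) r = - sumN s f r.
Proof. by rewrite (sumN_morph (@GRing.opp V)). Qed.

Section Graphs.
Variable K : comNzRingType.
Notation edge := (nat * nat * 'M[K]_3)%type.
Notation bracket := (nat * nat * nat)%type.
Implicit Types (E : seq edge) (B : seq bracket) (r : env).

Definition enames E : seq nat := flatten [seq [:: x.1.1; x.1.2] | x <- E].
Definition bnames B : seq nat := flatten [seq [:: b.1.1; b.1.2; b.2] | b <- B].
Definition eweight E r : K := \prod_(x <- E) x.2 (r x.1.1) (r x.1.2).
Definition bweight B r : K := \prod_(b <- B) eps K (r b.1.1) (r b.1.2) (r b.2).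
(** An edge (h, l, X) joins the half-edges h and l, and a bracket (h, l, k) is
    a vertex at three half-edges. The value of a graph is the sum over all
    indices at the half-edges of the product of the entries of the labels and
    of the Levi-Civita symbols of the brackets. *)
Definition ev E B : K := sumN (enames E) (fun r => eweight E r * bweight B r) (fun=> 0).

Definition cubic E B := uniq (enames E) && perm_eq (enames E) (bnames B).

Lemma eweight_cons x E r : eweight (x :: E) r = x.2 (r x.1.1) (r x.1.2) * eweight E r.
Proof. by rewrite /eweight big_cons. Qed.
Lemma bweight_cons b B r : bweight (b :: B) r = eps K (r b.1.1) (r b.1.2) (r b.2) * bweight B r.
Proof. by rewrite /bweight big_cons. Qed.

Lemma eweight_indep E s : {in s, forall n, n \notin enames E} -> indep s (eweight E).
Proof.
move=> h n /h {h}; elim: E => [|x E IH] nE r i; first by rewrite /eweight !big_nil.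
move: nE; rewrite /= !inE !negb_or => /and3P[n1 n2 nE].
by rewrite !eweight_cons IH // !upd_other // eq_sym.
Qed.
Lemma bweight_indep B s : {in s, forall n, n \notin bnames B} -> indep s (bweight B).
Proof.
move=> h n /h {h}; elim: B => [|x B IH] nB r i; first by rewrite /bweight !big_nil.
move: nB; rewrite /= !inE !negb_or => /and4P[n1 n2 n3 nB].
by rewrite !bweight_cons IH // !upd_other // eq_sym.
Qed.

(** Equality up to order and orientation. The last clause speaks of all the
    properties of labels that are stable under transposition, so that the
    reorientations need not be named. *)
Definition same_edges E E' := [/\ perm_eq (enames E) (enames E'), eweight E =1 eweight E'
  & forall W : 'M[K]_3 -> Prop, (forall A, W A -> W A^T) ->
    (forall x, x \in E -> W x.2) -> forall x, x \in E' -> W x.2].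

Lemma same_edges_refl E : same_edges E E. Proof. by split. Qed.
Lemma same_edges_trans E1 E2 E3 : same_edges E1 E2 -> same_edges E2 E3 -> same_edges E1 E3.
Proof.
move=> [p1 w1 h1] [p2 w2 h2]; split=> [|r|W hW h]; first exact: perm_trans p1 p2.
- by rewrite w1 w2.
- by apply: (h2 W hW); exact: (h1 W hW).
Qed.
Lemma same_edges_cons x E E' : same_edges E E' -> same_edges (x :: E) (x :: E').
Proof.
move=> [p w h]; split=> [|r|W hW hE y].
- by rewrite /= !perm_cons.
- by rewrite !eweight_cons w.
- rewrite inE => /predU1P[->|]; first by apply: hE; rewrite mem_head.
  by apply: (h W hW) => z zE; apply: hE; rewrite inE zE orbT.
Qed.
Lemma same_edges_swap x y E : same_edges (x :: y :: E) (y :: x :: E).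
Proof.
split=> [|r|W hW hE z].
- by apply/permP => P /=; rewrite !addnA; lia.
- by rewrite !eweight_cons mulrCA.
- by rewrite !inE orbCA => h; apply: hE; rewrite !inE.
Qed.
Lemma same_edges_flip h l X E : same_edges ((h, l, X) :: E) ((l, h, X^T) :: E).
Proof.
split=> [|r|W hW hE z].
- by apply/permP => P /=; rewrite !addnA; lia.
- by rewrite !eweight_cons mxE.
- rewrite inE => /predU1P[->|zE]; last by apply: hE; rewrite inE zE orbT.
  by apply: hW; apply: (hE (h, l, X)); rewrite mem_head.
Qed.

Lemma pull_edge n E : n \in enames E -> exists m X E', same_edges E ((n, m, X) :: E').
Proof.
elim: E => //= -[[h l] X] E IH; rewrite !inE /= orbA => /orP[/orP[]/eqP ->|].
- by exists l, X, E; exact: same_edges_refl.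
- by exists h, X^T, E; exact: same_edges_flip.
- move=> /IH[m [Y [E' e]]]; exists m, Y, ((h, l, X) :: E').
  exact: same_edges_trans (same_edges_cons _ e) (same_edges_swap _ _ _).
Qed.

(** The brackets agree up to order and orientation; b is the parity of the
    changes of orientation. *)
Definition same_brackets B B' := perm_eq (bnames B) (bnames B') /\ size B = size B' /\
  exists b : bool, forall r, bweight B r = (-1) ^+ b * bweight B' r.

Lemma same_brackets_refl B : same_brackets B B.
Proof. by split=> //; split=> //; exists false => r; rewrite mul1r. Qed.
Lemma same_brackets_trans B1 B2 B3 : same_brackets B1 B2 -> same_brackets B2 B3 -> same_brackets B1 B3.
Proof.
move=> [p1 [s1 [b1 w1]]] [p2 [s2 [b2 w2]]]; split; first exact: perm_trans p1 p2.
split; first by rewrite s1.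
by exists (b1 (+) b2) => r; rewrite w1 w2 mulrA signr_addb.
Qed.
Lemma same_brackets_cons x B B' : same_brackets B B' -> same_brackets (x :: B) (x :: B').
Proof.
move=> [p [s [b w]]]; split; first by rewrite /= !perm_cons.
by split; [rewrite /= s|exists b => r; rewrite !bweight_cons w mulrCA].
Qed.
Lemma same_brackets_exch x y B : same_brackets (x :: y :: B) (y :: x :: B).
Proof.
split; first by apply/permP => P /=; rewrite !addnA; lia.
by split=> //; exists false => r; rewrite !bweight_cons mul1r mulrCA.
Qed.
Lemma same_brackets_rot i j k B : same_brackets ((i, j, k) :: B) ((j, k, i) :: B).
Proof.
split; first by apply/permP => P /=; rewrite !addnA; lia.
by split=> //; exists false => r; rewrite !bweight_cons mul1r /= eps_rot.
Qed.
Lemma same_brackets_swap i j k B : same_brackets ((i, j, k) :: B) ((j, i, k) :: B).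
Proof.
split; first by apply/permP => P /=; rewrite !addnA; lia.
by split=> //; exists true => r; rewrite !bweight_cons mulN1r /= eps_swap mulNr.
Qed.

Lemma pull_bracket n B : n \in bnames B -> exists i j B', same_brackets B ((n, i, j) :: B').
Proof.
elim: B => //= -[[i j] k] B IH; rewrite !inE /= => /or4P[/eqP ->|/eqP ->|/eqP ->|].
- by exists j, k, B; exact: same_brackets_refl.
- by exists k, i, B; exact: same_brackets_rot.
- by exists i, j, B; apply: same_brackets_trans (same_brackets_rot _ _ _ _) (same_brackets_rot _ _ _ _).
- move=> /IH[a [b [B' e]]]; exists a, b, ((i, j, k) :: B').
  exact: same_brackets_trans (same_brackets_cons _ e) (same_brackets_exch _ _ _).
Qed.

Lemma cubic_eq E E' B B' : same_edges E E' -> same_brackets B B' -> cubic E B -> cubic E' B'.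
Proof.
move=> [p _ _] [q _] /andP[u pE]; rewrite /cubic -(perm_uniq p) u /=.
by apply: perm_trans q; apply: perm_trans pE; rewrite perm_sym.
Qed.

Lemma ev_eq0 E E' B B' : same_edges E E' -> same_brackets B B' -> cubic E B -> ev E' B' = 0 -> ev E B = 0.
Proof.
move=> [p w _] [q [_ [b wb]]] /andP[u _] h; rewrite /ev (sumN_perm _ _ u p).
rewrite (eq_sumN _ (g := fun r => eweight E' r * bweight B' r * (-1) ^+ b)); last first.
  by move=> r; rewrite w wb mulrCA mulrC.
by rewrite sumN_mulr // [X in X * _]h mul0r.
Qed.

Lemma ev_same_edges E E' B : uniq (enames E) -> same_edges E E' -> ev E B = ev E' B.
Proof.
move=> u [p w _]; rewrite /ev (sumN_perm _ _ u p).
by apply: eq_sumN => r; rewrite w.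
Qed.

End Graphs.

(** * Identities between brackets *)

Section LocalSums.
Variable K : comNzRingType.
Notation eps := (eps K).
Implicit Types A B C X Y Z : 'M[K]_3.

Lemma sum_eps_axial X k c :
  \sum_i \sum_j X i j * c * eps i j k = axial X k 0 * c.
Proof.
rewrite mxE -(sum_eps X k) mulr_suml; apply: eq_bigr => i _.
by rewrite mulr_suml; apply: eq_bigr => j _; ring.
Qed.

Lemma sum_eps_cross X Y z w c :
  \sum_x \sum_y \sum_p \sum_q X x p * Y y q * c * (eps x y z * eps p q w) = (X # Y) z w * c.
Proof.
transitivity (\sum_x \sum_y eps x y z * (X x (w+1) * Y y (w+2) - X x (w+2) * Y y (w+1)) * c).
  apply: eq_bigr => x _; apply: eq_bigr => y _.
  rewrite -(sum_eps (fun p q => X x p * Y y q)) mulr_sumr mulr_suml.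
  by apply: eq_bigr => p _; rewrite mulr_sumr mulr_suml; apply: eq_bigr => q _; ring.
transitivity ((\sum_x \sum_y eps x y z * (X x (w+1) * Y y (w+2) - X x (w+2) * Y y (w+1))) * c).
  by rewrite mulr_suml; apply: eq_bigr => x _; rewrite mulr_suml.
by rewrite sum_eps crossE; ring.
Qed.

(** The product X p x Y q y, symmetrized in X and Y and contracted with a
    symbol in x, y, is alternating in p, q. *)
Lemma sum_eps_swap X Y p q z :
  \sum_x \sum_y (X p x * Y q y + Y p x * X q y) * eps x y z =
  \sum_r eps p q r * (X # Y) r z.
Proof.
transitivity (\sum_x \sum_y eps x y z * (X p x * Y q y + Y p x * X q y)).
  by apply: eq_bigr => x _; apply: eq_bigr => y _; rewrite mulrC.
rewrite sum_eps sum3E !crossE; move: p q; do 2!apply: ord3P;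
rewrite /eps /= !add3E; ring.
Qed.

Lemma eps_eps q r b c : \sum_p eps p q r * eps p b c =
  ((q == b) && (r == c))%:R - ((q == c) && (r == b))%:R.
Proof.
rewrite sum3E; move: q r b c; do 4!apply: ord3P;
 rewrite /eps /=; ring.
Qed.

Lemma eps_eps_eps r b c d f : \sum_p \sum_q eps p q r * (eps p b c * eps q d f) =
  (r == c)%:R * eps b d f - (r == b)%:R * eps c d f.
Proof.
rewrite exchange_big.
transitivity (\sum_q (((q == b) && (r == c))%:R - ((q == c) && (r == b))%:R) * eps q d f).
  apply: eq_bigr => q _; rewrite -eps_eps mulr_suml; apply: eq_bigr => p _; ring.
have delta (g : 'I_3 -> K) m (t : bool) : \sum_q ((q == m) && t)%:R * g q = t%:R * g m.
  rewrite (bigD1 m) //= eqxx big1 ?addr0 // => q nq; by rewrite (negPf nq) mul0r.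
by rewrite -(delta (fun q => eps q d f)) -(delta (fun q => eps q d f)) -sumrB;
  apply: eq_bigr => q _; rewrite mulrBl.
Qed.

Let epsz (i j k : nat) : int :=
  if (j == i.+1 %% 3)%N && (k == i.+2 %% 3)%N then 1
  else if (j == i.+2 %% 3)%N && (k == i.+1 %% 3)%N then -1 else 0.
Let epszE (i j k : 'I_3) : eps i j k = (epsz i j k)%:~R.
Proof. by move: i j k; do 3!apply: ord3P; rewrite /eps /epsz. Qed.

(** The Grassmann-Pluecker relation for vectors of the standard basis. The
    finitely many cases are computed over the integers. *)
Lemma plucker i a b j c d : eps i a b * eps j c d =
  eps j a b * eps i c d + eps c a b * eps j i d + eps d a b * eps j c i.
Proof.
have : all (fun i => all (fun a => all (fun b => all (fun j => all (fun c => all (fun d =>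
  epsz i a b * epsz j c d ==
  epsz j a b * epsz i c d + epsz c a b * epsz j i d + epsz d a b * epsz j c i)
  (iota 0 3)) (iota 0 3)) (iota 0 3)) (iota 0 3)) (iota 0 3)) (iota 0 3) by vm_compute.
have I3 (k : 'I_3) : nat_of_ord k \in iota 0 3 by rewrite mem_iota ltn_ord.
move=> /allP/(_ _ (I3 i))/allP/(_ _ (I3 a))/allP/(_ _ (I3 b))/allP/(_ _ (I3 j)).
move=> /allP/(_ _ (I3 c))/allP/(_ _ (I3 d))/eqP h.
by rewrite !epszE -!rmorphM h !rmorphD.
Qed.

(** The Levi-Civita symbol is annihilated by the trace-free matrices. *)
Lemma leibniz_eps (M : 'M[K]_3) (u v w : 'I_3 -> K) : \tr M = 0 ->
  \sum_i \sum_a \sum_b ((\sum_k M i k * u k) * v a * w b + u i * (\sum_k M a k * v k) * w b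
    + u i * v a * (\sum_k M b k * w k)) * eps i a b = 0.
Proof.
move=> hM.
transitivity (\tr M * \sum_i \sum_a \sum_b u i * v a * w b * eps i a b); last by rewrite hM mul0r.
rewrite tr3E !sum3E /eps /=; gen9 M.
generalize (u 0) (u 1) (u 2) (v 0) (v 1) (v 2) (w 0) (w 1) (w 2); intros; ring.
Qed.
End LocalSums.

(** * Summation over a part of a graph *)

Ltac conj_split := repeat match goal with H : is_true (_ && _) |- _ =>
  let H1 := fresh "ne" in let H2 := fresh "ne" in case/andP: H => H1 H2 end.
Ltac nerw := repeat match goal with H : is_true (?a != ?b) |- _ =>
  rewrite ?(eq_sym b a) ?(negPf H); clear H end.
(* permutations of explicit lists of names *)
Ltac perm_tac := let P := fresh in apply/permP => P; rewrite /enames /bnames /= ?count_cat /=;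
  repeat match goal with |- context [nat_of_bool ?b] => move: (nat_of_bool b) => ? end;
  repeat match goal with |- context [count P ?s] => move: (count P s) => ? end; clear; lia.

Section Surgery.
Variable K : comNzRingType.
Notation eps := (eps K).
Notation edge := (nat * nat * 'M[K]_3)%type.
Notation bracket := (nat * nat * nat)%type.
Implicit Types (E : seq edge) (B : seq bracket) (r : env).

Lemma enames_cat E1 E2 : enames (E1 ++ E2) = enames E1 ++ enames E2.
Proof. by rewrite /enames map_cat flatten_cat. Qed.
Lemma bnames_cat B1 B2 : bnames (B1 ++ B2) = bnames B1 ++ bnames B2.
Proof. by rewrite /bnames map_cat flatten_cat. Qed.

Lemma cubic_mem E B : cubic E B -> enames E =i bnames B.
Proof. by case/andP=> _ /perm_mem. Qed.
Lemma cubic_uniqB E B : cubic E B -> uniq (bnames B).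
Proof. by case/andP=> u p; rewrite -(perm_uniq p). Qed.

Lemma cubic_uniq E B t s : cubic E B -> perm_eq (enames E) (t ++ s) -> uniq t.
Proof. by case/andP=> u _ p; move: u; rewrite (perm_uniq p) cat_uniq => /andP[]. Qed.

Lemma cubic_sub E B E' B' s : cubic E B -> perm_eq (enames E) (enames E' ++ s) ->
  perm_eq (bnames B) (bnames B' ++ s) -> cubic E' B'.
Proof.
move=> /andP[u p] pE pB; apply/andP; split.
  by move: u; rewrite (perm_uniq pE) cat_uniq => /andP[].
rewrite -(perm_cat2r s) -(permPr pB) -(permPl pE) perm_sym; by rewrite perm_sym.
Qed.

Lemma sum_local s s1 s2 (f h G : env -> K) r0 : uniq s -> perm_eq s (s2 ++ s1) -> indep s1 h ->
  (forall r, sumN s1 f r = G r) ->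
  sumN s (fun r => f r * h r) r0 = sumN s2 (fun r => G r * h r) r0.
Proof.
move=> u p hi hG; rewrite (sumN_perm _ _ u p) sumN_cat.
by apply: eq_sumN => r; rewrite sumN_mulr // hG.
Qed.

(** The names of a part of a graph are summed first. *)
Lemma ev_local s1 s2 E1 E B1 B2 G : cubic (E1 ++ E) (B1 ++ B2) ->
  perm_eq (enames (E1 ++ E)) (s2 ++ s1) ->
  {subset s1 <= enames E1} -> {subset s1 <= bnames B1} ->
  (forall r, sumN s1 (fun r => eweight E1 r * bweight K B1 r) r = G r) ->
  ev (E1 ++ E) (B1 ++ B2) =
  sumN s2 (fun r => G r * (eweight E r * bweight K B2 r)) (fun=> 0).
Proof.
move=> c p hE hB h; have /andP[u _] := c; have uB := cubic_uniqB c; rewrite /ev.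
rewrite (eq_sumN _ (g := fun r => eweight E1 r * bweight K B1 r * (eweight E r * bweight K B2 r))).
  apply: (@sum_local _ s1 s2 _ _ _ _ u p _ h).
  move=> n ns x i; rewrite (@eweight_indep _ E s1) // ?(@bweight_indep _ B2 s1) // => m ms.
    move: uB; rewrite bnames_cat cat_uniq => /and3P[_ /hasPn hn _].
    by apply/negP => /hn; rewrite /= hB.
  move: (andP c).1; rewrite enames_cat cat_uniq => /and3P[_ /hasPn hn _].
  by apply/negP => /hn; rewrite /= hE.
by move=> x; rewrite /eweight /bweight !big_cat /= -!mulrA; congr (_ * _); rewrite mulrCA.
Qed.

Lemma ev_local0 s1 s2 E1 E B1 B2 : cubic (E1 ++ E) (B1 ++ B2) ->
  perm_eq (enames (E1 ++ E)) (s2 ++ s1) ->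
  {subset s1 <= enames E1} -> {subset s1 <= bnames B1} ->
  (forall r, sumN s1 (fun r => eweight E1 r * bweight K B1 r) r = 0) ->
  ev (E1 ++ E) (B1 ++ B2) = 0.
Proof.
move=> c p hE hB h; rewrite (ev_local c p hE hB (G := fun=> 0)) //.
rewrite (eq_sumN _ (g := fun=> 0)) ?sumN0 // => r; by rewrite mul0r.
Qed.

Lemma ev_merge s1 E1 E B1 B2 a b (Y : 'M[K]_3) : cubic (E1 ++ E) (B1 ++ B2) ->
  perm_eq (enames (E1 ++ E)) (a :: b :: enames E ++ s1) ->
  {subset s1 <= enames E1} -> {subset s1 <= bnames B1} ->
  (forall r, sumN s1 (fun r => eweight E1 r * bweight K B1 r) r = Y (r a) (r b)) ->
  ev (E1 ++ E) (B1 ++ B2) = ev ((a, b, Y) :: E) B2.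
Proof.
move=> c p hE hB h.
rewrite (ev_local (s2 := a :: b :: enames E) c p hE hB (G := fun r => Y (r a) (r b))) //.
by apply: eq_sumN => r; rewrite eweight_cons mulrA.
Qed.

Lemma eweight_nil r : eweight ([::] : seq edge) r = 1. Proof. exact: big_nil. Qed.
Lemma bweight_nil r : bweight K [::] r = 1. Proof. exact: big_nil. Qed.

Lemma mulmx3_sum (A S D : 'M[K]_3) p q :
  (A^T * S * D) p q = \sum_a \sum_b A a p * D b q * S a b.
Proof.
rewrite mxE exchange_big; apply: eq_bigr => b _; rewrite mxE mulr_suml.
by apply: eq_bigr => a _; rewrite mxE; ring.
Qed.

(** The values of the parts that are replaced by a single edge, here and in
    bigon_sum, and of the closed parts that remain instead when this edge
    would be attached to itself. *)
Lemma loop_sum i j k m a b a' b' (X C A D : 'M[K]_3) r : uniq [:: i; j; k; m; a; b; a'; b'] ->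
  sumN [:: a; b; m; k; i; j] (fun r => eweight [:: (i, j, X); (k, m, C); (a, a', A); (b, b', D)] r
    * bweight K [:: (i, j, k); (m, a, b)] r) r
  = (A^T * skew_of (C^T *m axial X) * D) (r a') (r b').
Proof.
move=> u; rewrite (eq_sumN _ (g := fun r => X (r i) (r j) *
  (C (r k) (r m) * (A (r a) (r a') * D (r b) (r b')) * eps (r m) (r a) (r b)) *
  eps (r i) (r j) (r k))); last first.
  by move=> x; rewrite !eweight_cons !bweight_cons eweight_nil bweight_nil /=; ring.
rewrite /= !inE !negb_or in u; conj_split; rewrite /= /upd ?eqxx; nerw.
rewrite mulmx3_sum; apply: eq_bigr => a0 _; apply: eq_bigr => b0 _.
rewrite mxE mulr_sumr; apply: eq_bigr => m0 _.
rewrite mxE !mulr_sumr; apply: eq_bigr => k0 _.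
by rewrite sum_eps_axial [(C^T)%R _ _]mxE; ring.
Qed.

Lemma dumbbell_sum i j k m a b (X C Z : 'M[K]_3) r : uniq [:: i; j; k; m; a; b] ->
  sumN [:: m; k; i; j; a; b] (fun r => eweight [:: (i, j, X); (k, m, C); (a, b, Z)] r
    * bweight K [:: (i, j, k); (m, a, b)] r) r
  = \sum_m axial Z m 0 * (C^T *m axial X) m 0.
Proof.
move=> u; rewrite (eq_sumN _ (g := fun r => Z (r a) (r b) * (X (r i) (r j) * C (r k) (r m) *
  eps (r i) (r j) (r k)) * eps (r a) (r b) (r m) )); last first.
  move=> x; rewrite !eweight_cons !bweight_cons eweight_nil bweight_nil /=.
  by rewrite (eps_rot _ (x m)); ring.
rewrite /= !inE !negb_or in u; conj_split; rewrite /= /upd ?eqxx; nerw.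
apply: eq_bigr => m0 _; rewrite [(_ *m _) _ _]mxE !mulr_sumr; apply: eq_bigr => k0 _.
transitivity (\sum_i0 \sum_j0 X i0 j0 * (axial Z m0 0 * C k0 m0) * eps i0 j0 k0).
  apply: eq_bigr => i0 _; apply: eq_bigr => j0 _; rewrite sum_eps_axial; ring.
by rewrite sum_eps_axial !mxE; ring.
Qed.

Lemma bigon_sum x y z p q w z' w' (X Y Z V : 'M[K]_3) r : uniq [:: x; y; z; p; q; w; z'; w'] ->
  sumN [:: z; w; x; y; p; q] (fun r => eweight [:: (x, p, X); (y, q, Y); (z, z', Z); (w, w', V)] r
    * bweight K [:: (x, y, z); (p, q, w)] r) r
  = (Z^T * (X # Y) * V) (r z') (r w').
Proof.
move=> u; rewrite (eq_sumN _ (g := fun r => X (r x) (r p) * Y (r y) (r q) *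
   (Z (r z) (r z') * V (r w) (r w')) * (eps (r x) (r y) (r z) * eps (r p) (r q) (r w)))); last first.
  by move=> g; rewrite !eweight_cons !bweight_cons eweight_nil bweight_nil /=; ring.
rewrite /= !inE !negb_or in u; conj_split; rewrite /= /upd ?eqxx; nerw.
rewrite mulmx3_sum; apply: eq_bigr => z0 _; apply: eq_bigr => w0 _.
by rewrite sum_eps_cross mulrC.
Qed.

Lemma theta_sum x y z p q w (X Y Z : 'M[K]_3) r : uniq [:: x; y; z; p; q; w] ->
  sumN [:: z; w; x; y; p; q] (fun r => eweight [:: (x, p, X); (y, q, Y); (z, w, Z)] r
    * bweight K [:: (x, y, z); (p, q, w)] r) r = theta Z X Y.
Proof.
move=> u; rewrite (eq_sumN _ (g := fun r => X (r x) (r p) * Y (r y) (r q) *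
   Z (r z) (r w) * (eps (r x) (r y) (r z) * eps (r p) (r q) (r w)))); last first.
  by move=> g; rewrite !eweight_cons !bweight_cons eweight_nil bweight_nil /=; ring.
rewrite /= !inE !negb_or in u; conj_split; rewrite /= /upd ?eqxx; nerw.
rewrite /theta /mxtrace exchange_big; apply: eq_bigr => w0 _.
by rewrite mxE; apply: eq_bigr => z0 _; rewrite sum_eps_cross [(Z^T)%R _ _]mxE mulrC.
Qed.
End Surgery.

(** * Loops *)

(* membership of a name in the remaining edges or brackets of a closed graph *)
Ltac mem_tac c n := let u := fresh in let v := fresh in
  move: (cubic_mem c n); have /andP[u _] := c; have v := cubic_uniqB c;
  rewrite /= !inE ?negb_or in u v; rewrite /= !inE; conj_split; nerw;
  rewrite ?eqxx ?orbT ?orbF /=; first [by move=> -> | by move=> <-].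

Section Reduction.
Variables (K : comNzRingType) (e : 'I_4 -> 'M[K]_3).
Hypothesis NF : null_forms e.
Notation edge := (nat * nat * 'M[K]_3)%type.
Notation bracket := (nat * nat * nat)%type.
Local Notation inW := (inW e).
Implicit Types (E : seq edge) (B : seq bracket) (r : env).

Definition labels E := forall x, x \in E -> inW x.2.
Definition vanish k := forall E B, size B = k -> cubic E B -> labels E -> ev E B = 0.

Lemma labels_cons x E : labels (x :: E) <-> inW x.2 /\ labels E.
Proof.
split=> [h|[hx h] y]; last by rewrite inE => /predU1P[->|/h].
by split=> [|y yE]; apply: h; rewrite inE ?eqxx ?yE ?orbT.
Qed.

Lemma labels_eq E E' : same_edges E E' -> labels E -> labels E'.
Proof. by move=> [_ _ h]; apply: h; exact: (inW_tr NF). Qed.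

(** The loop is the axial vector of X, carried along an edge to the next
    bracket. There it fuses the two other edges to a single one with a label
    in the span of the words (loop_sum), or it meets a second loop
    (dumbbell_sum). *)
Lemma loop_eq0 k E B i j n X : ((0 < k)%N -> vanish k) -> size B = k.+1 ->
  cubic ((i, j, X) :: E) ((i, j, n) :: B) -> labels ((i, j, X) :: E) ->
  ev ((i, j, X) :: E) ((i, j, n) :: B) = 0.
Proof.
move=> IH sB c l.
have nE : n \in enames E by mem_tac c n.
have [m [C [E1 e1]]] := pull_edge nE.
have {}e1 := same_edges_cons (i, j, X) e1.
apply: (ev_eq0 e1 (same_brackets_refl _ _) c); have {}l := labels_eq e1 l.
have {c} c := cubic_eq e1 (same_brackets_refl K _) c.
have mB : m \in bnames B by mem_tac c m.
have [a [b [B1 b1]]] := pull_bracket K mB.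
have sB1 : size B1 = k by case: b1 => _ [+ _]; rewrite sB => -[].
have {}b1 := same_brackets_cons (i, j, n) b1.
apply: (ev_eq0 (same_edges_refl _) b1 c); have {c} c := cubic_eq (same_edges_refl _) b1 c.
have aE : a \in enames E1 by mem_tac c a.
have [a' [A [E2 e2]]] := pull_edge aE.
have {}e2 := same_edges_cons (i, j, X) (same_edges_cons (n, m, C) e2).
apply: (ev_eq0 e2 (same_brackets_refl _ _) c); have {}l := labels_eq e2 l.
have {c} c := cubic_eq e2 (same_brackets_refl K _) c.
case: (eqVneq b a') => [ba|ba].
  rewrite -ba in c l *.
  apply: (ev_local0 (s1 := [:: m; n; i; j; a; b]) (s2 := enames E2)
    (E1 := [:: (i, j, X); (n, m, C); (a, b, A)]) (B1 := [:: (i, j, n); (m, a, b)]) c).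
  - by rewrite /=; perm_tac.
  - by move=> x; rewrite /= !inE; do 6!case: (x == _).
  - by move=> x; rewrite /= !inE; do 6!case: (x == _).
  move=> r; rewrite dumbbell_sum; last first.
    by apply: (cubic_uniq (s := enames E2) c); perm_tac.
  move/labels_cons: l => [hX /labels_cons[hC /labels_cons[hA _]]].
  by apply: (axial_words NF) => //; exact: (inW_tr NF).
have bE : b \in enames E2 by mem_tac c b.
have [b' [D [E3 e3]]] := pull_edge bE.
have {}e3 := same_edges_cons (i, j, X) (same_edges_cons (n, m, C) (same_edges_cons (a, a', A) e3)).
apply: (ev_eq0 e3 (same_brackets_refl _ _) c); have {}l := labels_eq e3 l.
have {c} c := cubic_eq e3 (same_brackets_refl K _) c.
rewrite (ev_merge (s1 := [:: a; b; m; n; i; j]) (a := a') (b := b')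
    (Y := A^T * skew_of (C^T *m axial X) * D) (E := E3)
    (E1 := [:: (i, j, X); (n, m, C); (a, a', A); (b, b', D)])
    (B1 := [:: (i, j, n); (m, a, b)]) c).
- have c' : cubic ((a', b', A^T * skew_of (C^T *m axial X) * D) :: E3) B1.
    by apply: (cubic_sub (s := [:: i; j; n; m; a; b]) c) => /=; perm_tac.
  apply: (IH _ _ _ _ c') => //.
    have /andP[_ /perm_size] := c'; rewrite /= -sB1.
    by case: (B1).
  apply/labels_cons; move: l.
  move/labels_cons => [hX /labels_cons[hC /labels_cons[hA /labels_cons[hD hE]]]].
  split=> //=; apply: (inD_word NF) => //; first exact: (inW_tr NF).
  by apply: (skew_words NF) => //; exact: (inW_tr NF).
- by rewrite /=; perm_tac.
- by move=> x; rewrite /= !inE; do 6!case: (x == _); rewrite ?orbT.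
- by move=> x; rewrite /= !inE; do 6!case: (x == _).
move=> r; rewrite loop_sum //.
by apply: (cubic_uniq (s := enames E3) c); perm_tac.
Qed.
End Reduction.

(** * Skew labels and bigons *)

Section EvLinear.
Variable K : comNzRingType.
Notation edge := (nat * nat * 'M[K]_3)%type.
Notation bracket := (nat * nat * nat)%type.
Notation eps := (eps K).
Implicit Types (E : seq edge) (B : seq bracket) (r : env).

Lemma ev_addl i j (X Y : 'M[K]_3) E B :
  ev ((i, j, X + Y) :: E) B = ev ((i, j, X) :: E) B + ev ((i, j, Y) :: E) B.
Proof.
rewrite /ev -sumND; apply: eq_sumN => r.
by rewrite !eweight_cons /= mxE !mulrDl.
Qed.
Lemma ev_scalel a i j (X : 'M[K]_3) E B :
  ev ((i, j, a *: X) :: E) B = a * ev ((i, j, X) :: E) B.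
Proof.
rewrite /ev [RHS]mulrC -(@sumN_mulr _ _ _ (fun=> a)) //; apply: eq_sumN => r.
by rewrite !eweight_cons /= mxE; ring.
Qed.

Lemma ev_same_brackets B B' : same_brackets K B B' ->
  exists s : K, forall E, ev E B = s * ev E B'.
Proof.
move=> [_ [_ [b h]]]; exists ((-1) ^+ b) => E.
rewrite /ev [RHS]mulrC -(@sumN_mulr _ _ _ (fun=> (-1) ^+ b)) //; apply: eq_sumN => r; rewrite h; ring.
Qed.

Lemma ev_plucker i a b j c d E B : ev E ((i, a, b) :: (j, c, d) :: B) =
  ev E ((j, a, b) :: (i, c, d) :: B) + ev E ((c, a, b) :: (j, i, d) :: B)
  + ev E ((d, a, b) :: (j, c, i) :: B).
Proof.
rewrite /ev -!sumND; apply: eq_sumN => r.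
rewrite !bweight_cons /= -!mulrDr; congr (_ * _).
by rewrite !mulrA -!mulrDl plucker.
Qed.

Lemma ev_swap_ends i j a b c d (N : 'M[K]_3) E B : N^T = - N ->
  cubic ((i, j, N) :: E) ((i, a, b) :: (j, c, d) :: B) ->
  ev ((i, j, N) :: E) ((j, a, b) :: (i, c, d) :: B) =
  - ev ((i, j, N) :: E) ((i, a, b) :: (j, c, d) :: B).
Proof.
move=> hN cu; have cu' : cubic ((i, j, N) :: E) ((j, a, b) :: (i, c, d) :: B).
  by apply: (cubic_sub (s := [::]) cu); perm_tac.
have u : uniq [:: i; j; a; b; c; d].
  by have := cubic_uniqB cu; rewrite (perm_uniq (s2 := [:: i; j; a; b; c; d] ++ bnames B)) ?cat_uniq => [/andP[]|] //; perm_tac.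
rewrite (ev_local (s1 := [:: i; j]) (s2 := enames E) (E1 := [:: (i, j, N)])
  (B1 := [:: (i, a, b); (j, c, d)]) cu (G := fun r => \sum_i0 \sum_j0 N i0 j0 *
    (eps i0 (r a) (r b) * eps j0 (r c) (r d)))).
- rewrite (ev_local (s1 := [:: i; j]) (s2 := enames E) (E1 := [:: (i, j, N)])
  (B1 := [:: (j, a, b); (i, c, d)]) cu' (G := fun r => - \sum_i0 \sum_j0 N i0 j0 *
    (eps i0 (r a) (r b) * eps j0 (r c) (r d)))).
  + by rewrite -sumN_opp; apply: eq_sumN => r; rewrite mulNr.
  + by rewrite /=; perm_tac.
  + by move=> x; rewrite /= !inE.
  + by move=> x; rewrite /= !inE; do 3!case: (x == _); rewrite ?orbT.
  move=> r; rewrite (eq_sumN _ (g := fun r => N (r i) (r j) * (eps (r j) (r a) (r b) * eps (r i) (r c) (r d)))).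
    rewrite /= !inE !negb_or in u; conj_split; rewrite /= /upd ?eqxx; nerw.
    rewrite exchange_big -sumrN; apply: eq_bigr => i0 _; rewrite -sumrN; apply: eq_bigr => j0 _.
    by have := congr1 (fun A : 'M_3 => A i0 j0) hN; rewrite !mxE => ->; rewrite mulNr.
  by move=> x; rewrite !eweight_cons !bweight_cons eweight_nil bweight_nil /=; ring.
- by rewrite /=; perm_tac.
- by move=> x; rewrite /= !inE.
- by move=> x; rewrite /= !inE; do 4!case: (x == _); rewrite ?orbT.
move=> r; rewrite (eq_sumN _ (g := fun r => N (r i) (r j) * (eps (r i) (r a) (r b) * eps (r j) (r c) (r d)))).
  by rewrite /= !inE !negb_or in u; conj_split; rewrite /= /upd ?eqxx; nerw.
by move=> x; rewrite !eweight_cons !bweight_cons eweight_nil bweight_nil /=; ring.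
Qed.
End EvLinear.

Section GraphVanishing.
Variables (K : comNzRingType) (e : 'I_4 -> 'M[K]_3).
Hypothesis NF : null_forms e.
Notation edge := (nat * nat * 'M[K]_3)%type.
Notation bracket := (nat * nat * nat)%type.
Local Notation labels := (labels e).
Local Notation vanish := (vanish e).
Implicit Types (E : seq edge) (B : seq bracket) (r : env).

(** By the Grassmann-Pluecker relation of the brackets at the ends of the
    edge. Two of its terms have a loop, and the third one is minus the left-
    hand side because the label is skew. *)
Lemma skew_edge_eq0 n E B i j (N : 'M[K]_3) : ((0 < n)%N -> vanish n) -> size B = n.+2 ->
  cubic ((i, j, N) :: E) B -> labels ((i, j, N) :: E) -> N^T = - N ->
  ev ((i, j, N) :: E) B = 0.
Proof.
move=> IH sB c l hN.
have iB : i \in bnames B by mem_tac c i.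
have [a [b [B1 b1]]] := pull_bracket K iB.
have sB1 : size B1 = n.+1 by case: b1 => _ [+ _]; rewrite sB => -[].
apply: (ev_eq0 (same_edges_refl _) b1 c); have {c} c := cubic_eq (same_edges_refl _) b1 c.
have loop p q m B2 : size B2 = n.+1 -> cubic ((i, j, N) :: E) ((p, q, m) :: B2) ->
    same_brackets K ((p, q, m) :: B2) ((i, j, m) :: B2) \/
    same_brackets K ((p, q, m) :: B2) ((i, j, p) :: B2) \/
    same_brackets K ((p, q, m) :: B2) ((i, j, q) :: B2) -> ev ((i, j, N) :: E) ((p, q, m) :: B2) = 0.
  by move=> sB2 cu [|[]] b2; apply: (ev_eq0 (same_edges_refl _) b2 cu);
    apply: (loop_eq0 NF IH) => //; exact: (cubic_eq (same_edges_refl _) b2 cu).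
have jn : [|| j == a, j == b | j \in bnames B1].
  have /andP[u _] := c; move: (cubic_mem c j); rewrite /= !inE eqxx orbT => /esym.
  by rewrite (negPf (_ : j != i)) //; move: u; rewrite /= inE negb_or eq_sym => /andP[/andP[]].
case/or3P: jn => [/eqP ja|/eqP jb|jB].
- by rewrite -ja in c *; apply: loop => //; left; exact: same_brackets_refl.
- rewrite -jb in c *; apply: loop => //; right; right.
  exact: same_brackets_trans (same_brackets_rot _ _ _ _ _) (same_brackets_trans
    (same_brackets_rot _ _ _ _ _) (same_brackets_trans (same_brackets_swap _ _ _ _ _) (same_brackets_refl _ _))).
have [d [f [B2 b2]]] := pull_bracket K jB.
have sB2 : size B2 = n by case: b2 => _ [+ _]; rewrite sB1 => -[].
have {}b2 := same_brackets_cons (i, a, b) b2.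
apply: (ev_eq0 (same_edges_refl _) b2 c); have {c} c := cubic_eq (same_edges_refl _) b2 c.
have loop' p q m s B3 : same_brackets K B3 ((i, j, p) :: (q, m, s) :: B2) ->
    cubic ((i, j, N) :: E) B3 -> ev ((i, j, N) :: E) B3 = 0.
  move=> b3 c3; apply: (ev_eq0 (same_edges_refl _) b3 c3).
  by apply: (loop_eq0 NF IH) => //=; [rewrite sB2|exact: (cubic_eq (same_edges_refl _) b3 c3)].
have h := ev_plucker i a b j d f ((i, j, N) :: E) B2.
have c' g : perm_eq (bnames ((i, a, b) :: (j, d, f) :: B2)) (bnames g ++ [::]) ->
    cubic ((i, j, N) :: E) g.
  by move=> p; apply: (cubic_sub (s := [::]) c _ p); rewrite cats0.
rewrite ev_swap_ends // in h.
rewrite (loop' f d a b ((d, a, b) :: (j, i, f) :: B2)) in h; first last.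
- by apply: c'; perm_tac.
- exact: same_brackets_trans (same_brackets_exch _ _ _ _) (same_brackets_swap _ _ _ _ _).
rewrite (loop' d f a b ((f, a, b) :: (j, d, i) :: B2)) in h; first last.
- by apply: c'; perm_tac.
- apply: same_brackets_trans (same_brackets_exch _ _ _ _) _.
  exact: same_brackets_trans (same_brackets_rot _ _ _ _ _) (same_brackets_rot _ _ _ _ _).
by apply: (nf_reg2 NF); lc (h ⊞ 0 ⊡ h).
Qed.

(** The difference is a graph with a skew label. *)
Lemma edge_flip n E B i j (X : 'M[K]_3) : ((0 < n)%N -> vanish n) -> size B = n.+2 ->
  cubic ((i, j, X) :: E) B -> labels ((i, j, X) :: E) ->
  ev ((i, j, X) :: E) B = ev ((i, j, X^T) :: E) B.
Proof.
move=> IH sB c /labels_cons[/= hX hE]; apply/eqP; rewrite -subr_eq0; apply/eqP.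
rewrite -mulN1r -ev_scalel scaleN1r -ev_addl.
apply: (skew_edge_eq0 IH sB (c : cubic ((i, j, X - X^T) :: E) B)).
  by apply/labels_cons; split=> //=; apply: inW_sub => //; exact: (inW_tr NF).
by rewrite linearB /= trmxK opprB.
Qed.

(** Two parallel edges contract to the cross product of their labels, which
    together with the adjacent edges makes a single edge with a label in the
    span of the words, or a value of theta. *)
Lemma bigon_eq0 n E B x y z p q w (X Y : 'M[K]_3) : ((0 < n)%N -> vanish n) -> size B = n ->
  let E0 := (x, p, X) :: (y, q, Y) :: E in let B0 := (x, y, z) :: (p, q, w) :: B in
  cubic E0 B0 -> labels E0 -> ev E0 B0 = 0.
Proof.
move=> IH sB E0 B0 c l; rewrite /E0 /B0 in c l *.
have zE : z \in enames E by mem_tac c z.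
have [z' [Z [E1 e1]]] := pull_edge zE.
have {}e1 := same_edges_cons (x, p, X) (same_edges_cons (y, q, Y) e1).
apply: (ev_eq0 e1 (same_brackets_refl _ _) c); have {}l := labels_eq NF e1 l.
have {c} c := cubic_eq e1 (same_brackets_refl K _) c.
case: (eqVneq w z') => [wz|wz].
  rewrite -wz in c l *.
  apply: (ev_local0 (s1 := [:: z; w; x; y; p; q]) (s2 := enames E1)
    (E1 := [:: (x, p, X); (y, q, Y); (z, w, Z)]) (B1 := [:: (x, y, z); (p, q, w)]) c).
  - by rewrite /=; perm_tac.
  - by move=> v; rewrite /= !inE; do 6!case: (v == _).
  - by move=> v; rewrite /= !inE; do 6!case: (v == _).
  move=> r; rewrite theta_sum; last by apply: (cubic_uniq (s := enames E1) c); perm_tac.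
  move/labels_cons: l => [hX /labels_cons[hY /labels_cons[hZ _]]].
  exact: (theta_words NF).
have wE : w \in enames E1 by mem_tac c w.
have [w' [V [E2 e2]]] := pull_edge wE.
have {}e2 := same_edges_cons (x, p, X) (same_edges_cons (y, q, Y) (same_edges_cons (z, z', Z) e2)).
apply: (ev_eq0 e2 (same_brackets_refl _ _) c); have {}l := labels_eq NF e2 l.
have {c} c := cubic_eq e2 (same_brackets_refl K _) c.
rewrite (ev_merge (s1 := [:: z; w; x; y; p; q]) (a := z') (b := w')
    (Y := Z^T * (X # Y) * V) (E := E2)
    (E1 := [:: (x, p, X); (y, q, Y); (z, z', Z); (w, w', V)])
    (B1 := [:: (x, y, z); (p, q, w)]) c).
- have c' : cubic ((z', w', Z^T * (X # Y) * V) :: E2) B.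
    by apply: (cubic_sub (s := [:: x; y; z; p; q; w]) c) => /=; perm_tac.
  apply: (IH _ _ _ _ c') => //.
    have /andP[_ /perm_size] := c'; rewrite /= -sB.
    by case: (B).
  apply/labels_cons; move: l.
  move/labels_cons => [hX /labels_cons[hY /labels_cons[hZ /labels_cons[hV hE]]]].
  split=> //=; apply: (inD_word NF) => //; first exact: (inW_tr NF).
  exact: (inD_cross_words NF).
- by rewrite /=; perm_tac.
- by move=> v; rewrite /= !inE; do 6!case: (v == _); rewrite ?orbT.
- by move=> v; rewrite /= !inE; do 6!case: (v == _).
move=> r; rewrite bigon_sum //.
by apply: (cubic_uniq (s := enames E2) c); perm_tac.
Qed.
End GraphVanishing.

(** * Exchange of the labels around an edge *)

Section SwapSum.
Variable K : comNzRingType.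
Notation edge := (nat * nat * 'M[K]_3)%type.
Notation bracket := (nat * nat * nat)%type.
Notation eps := (eps K).
Implicit Types (E : seq edge) (B : seq bracket) (r : env).

Lemma swap_local (X Y : 'M[K]_3) (b c d f z : 'I_3) :
  \sum_p \sum_q \sum_x \sum_y (X p x * Y q y + Y p x * X q y) *
    (eps x y z * (eps p b c * eps q d f)) =
  (X # Y) c z * eps b d f - (X # Y) b z * eps c d f.
Proof.
transitivity (\sum_r (X # Y) r z * \sum_p \sum_q eps p q r * (eps p b c * eps q d f)).
  transitivity (\sum_p \sum_q (\sum_r eps p q r * (X # Y) r z) * (eps p b c * eps q d f)).
    apply: eq_bigr => p _; apply: eq_bigr => q _; rewrite -sum_eps_swap mulr_suml.
    by apply: eq_bigr => x _; rewrite mulr_suml; apply: eq_bigr => y _; rewrite mulrA.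
  transitivity (\sum_p \sum_q \sum_r (X # Y) r z * (eps p q r * (eps p b c * eps q d f))).
    apply: eq_bigr => p _; apply: eq_bigr => q _; rewrite mulr_suml.
    by apply: eq_bigr => r _; ring.
  under eq_bigr do rewrite exchange_big; rewrite exchange_big; apply: eq_bigr => r _.
  by rewrite mulr_sumr; apply: eq_bigr => p _; rewrite mulr_sumr.
have delta (m : 'I_3) (g : 'I_3 -> K) : \sum_r g r * (r == m)%:R = g m.
  rewrite (bigD1 m) //= eqxx mulr1 big1 ?addr0 // => r nr; by rewrite (negPf nr) mulr0.
rewrite -(delta c (fun t => (X # Y) t z)) -(delta b (fun t => (X # Y) t z)) !mulr_suml -sumrB.
by apply: eq_bigr => r _; rewrite eps_eps_eps; ring.
Qed.

Lemma swap_merge s b c d f z z' b' c' (M Z C D : 'M[K]_3) E B :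
  uniq s -> perm_eq s (c' :: z' :: b :: b' :: enames E ++ [:: c; z]) ->
  uniq (bnames ((b, d, f) :: B) ++ [:: c; z]) ->
  sumN s (fun r => M (r c) (r z) * (Z (r z) (r z') * C (r c) (r c')) *
    (eweight ((b, b', D) :: E) r * bweight K ((b, d, f) :: B) r)) (fun=> 0) =
  ev ((c', z', C^T * M * Z) :: (b, b', D) :: E) ((b, d, f) :: B).
Proof.
move=> u p uB; have us := u; rewrite (perm_uniq p) in us.
rewrite (@sum_local _ s [:: c; z] [:: c', z', b, b' & enames E] _ _
  (fun r => (C^T * M * Z) (r c') (r z')) _ u) //.
- rewrite /ev; apply: eq_sumN => r; by rewrite [eweight (_ :: _ :: _) _]eweight_cons mulrA.
- move=> n ns r i; rewrite (@eweight_indep _ _ [:: c; z]) ?(@bweight_indep _ _ [:: c; z]) //.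
  + move=> m ms; move: uB; rewrite cat_uniq => /and3P[_ /hasPn hn _].
    exact: hn.
  + move=> m ms; move: us; rewrite -[X in uniq X]/([:: c', z', b, b' & enames E] ++ [:: c; z]).
    rewrite cat_uniq => /and3P[_ /hasPn hn _]; apply/negP => h.
    by move/negP: (hn _ ms); apply; rewrite /= !inE; move: h; rewrite /= !inE => /or3P[] ->; rewrite ?orbT.
move=> r; have : uniq [:: c; z; c'; z'].
  have pp : perm_eq [:: c', z', b, b' & enames E ++ [:: c; z]] ([:: c; z; c'; z'] ++ [:: b, b' & enames E]).
    by perm_tac.
  by move: us; rewrite (perm_uniq pp) cat_uniq => /andP[].
rewrite /= !inE !negb_or => v; conj_split; rewrite /= /upd ?eqxx; nerw.
rewrite mulmx3_sum; apply: eq_bigr => c0 _; apply: eq_bigr => z0 _; ring.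
Qed.

Lemma ev_leibniz i j a a' b b' (M Y1 Y2 Y3 : 'M[K]_3) E B : \tr M = 0 ->
  cubic ((i, j, Y1) :: (a, a', Y2) :: (b, b', Y3) :: E) ((i, a, b) :: B) ->
  ev ((i, j, M * Y1) :: (a, a', Y2) :: (b, b', Y3) :: E) ((i, a, b) :: B)
  + ev ((i, j, Y1) :: (a, a', M * Y2) :: (b, b', Y3) :: E) ((i, a, b) :: B)
  + ev ((i, j, Y1) :: (a, a', Y2) :: (b, b', M * Y3) :: E) ((i, a, b) :: B) = 0.
Proof.
move=> hM cu.
have u : uniq [:: i; a; b; j; a'; b'] by apply: (cubic_uniq (s := enames E) cu); perm_tac.
pose G (A1 A2 A3 : 'M[K]_3) (r : env) := \sum_i0 \sum_a0 \sum_b0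
  A1 i0 (r j) * A2 a0 (r a') * A3 b0 (r b') * eps i0 a0 b0.
have L (A1 A2 A3 : 'M[K]_3) :
  ev ((i, j, A1) :: (a, a', A2) :: (b, b', A3) :: E) ((i, a, b) :: B) =
  sumN (j :: a' :: b' :: enames E) (fun r => G A1 A2 A3 r * (eweight E r * bweight K B r)) (fun=> 0).
  have cu' : cubic ((i, j, A1) :: (a, a', A2) :: (b, b', A3) :: E) ((i, a, b) :: B) by exact: cu.
  apply: (ev_local (s1 := [:: i; a; b]) (E1 := [:: (i, j, A1); (a, a', A2); (b, b', A3)])
    (B1 := [:: (i, a, b)]) cu').
  - by rewrite /=; perm_tac.
  - by move=> x; rewrite /= !inE; do 3!case: (x == _); rewrite ?orbT.
  - by move=> x; rewrite /= !inE.
  move=> r; rewrite (eq_sumN _ (g := fun r => A1 (r i) (r j) * A2 (r a) (r a') * A3 (r b) (r b') *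
    eps (r i) (r a) (r b))).
    by rewrite /= !inE !negb_or in u; conj_split; rewrite /= /upd ?eqxx; nerw.
  by move=> x; rewrite !eweight_cons !bweight_cons eweight_nil bweight_nil /=; ring.
rewrite !L -!sumND (eq_sumN _ (g := fun=> 0)) ?sumN0 // => r.
rewrite -!mulrDl (_ : _ + _ + _ = 0) ?mul0r //.
rewrite /G -!big_split /= -[RHS](leibniz_eps (fun k => Y1 k (r j)) (fun k => Y2 k (r a'))
  (fun k => Y3 k (r b')) hM).
apply: eq_bigr => i0 _; rewrite -!big_split; apply: eq_bigr => a0 _.
rewrite -!big_split; apply: eq_bigr => b0 _ /=.
by rewrite !mxE -!mulrDl.
Qed.
End SwapSum.

Section Config.
Variables (K : comNzRingType) (e : 'I_4 -> 'M[K]_3).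
Hypothesis NF : null_forms e.
Notation eps := (eps K).
Notation edge := (nat * nat * 'M[K]_3)%type.
Notation bracket := (nat * nat * nat)%type.
Local Notation inW := (inW e).
Local Notation labels := (labels e).
Local Notation vanish := (vanish e).
Implicit Types (E : seq edge) (B : seq bracket) (r : env).

(** The two edges end at different brackets p, q and meet in the bracket of x,
    y. Symmetrizing their labels and using sum_eps_swap and eps_eps_eps
    removes two of the three brackets, so that the induction hypothesis
    applies to the two remaining terms. *)
Lemma swap_edges n p q x y z z' b b' c c' d f (X Y Z C D : 'M[K]_3) E B :
  vanish n.+1 -> size B = n ->
  let E0 X Y := (p, x, X) :: (q, y, Y) :: (z, z', Z) :: (c, c', C) :: (b, b', D) :: E in
  let B0 := (x, y, z) :: (p, b, c) :: (q, d, f) :: B in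
  cubic (E0 X Y) B0 -> labels (E0 X Y) -> ev (E0 X Y) B0 + ev (E0 Y X) B0 = 0.
Proof.
move=> IH sB E0 B0 cu l; rewrite /E0 /B0 in cu l *.
pose E' := (z, z', Z) :: (c, c', C) :: (b, b', D) :: E.
pose G (X Y : 'M[K]_3) (r : env) := \sum_p0 \sum_q0 \sum_x0 \sum_y0 X p0 x0 * Y q0 y0 *
    (eps x0 y0 (r z) * (eps p0 (r b) (r c) * eps q0 (r d) (r f))).
have u : uniq [:: p; q; x; y; z; b; c; d; f].
  have pp : perm_eq (bnames B0) ([:: p; q; x; y; z; b; c; d; f] ++ bnames B) by rewrite /B0; perm_tac.
  by have := cubic_uniqB cu; rewrite (perm_uniq pp) cat_uniq => /andP[].
have L (A1 A2 : 'M[K]_3) : ev ((p, x, A1) :: (q, y, A2) :: E') B0 =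
    sumN (enames E') (fun r => G A1 A2 r * (eweight E' r * bweight K B r)) (fun=> 0).
  have cu' : cubic ((p, x, A1) :: (q, y, A2) :: E') B0 by exact: cu.
  apply: (ev_local (s1 := [:: p; q; x; y]) (E1 := [:: (p, x, A1); (q, y, A2)])
    (B1 := [:: (x, y, z); (p, b, c); (q, d, f)]) cu').
  - by rewrite /=; perm_tac.
  - by move=> v; rewrite /= !inE; do 4!case: (v == _); rewrite ?orbT.
  - by move=> v; rewrite /= !inE; do 4!case: (v == _); rewrite ?orbT.
  move=> r; rewrite (eq_sumN _ (g := fun r => A1 (r p) (r x) * A2 (r q) (r y) *
    (eps (r x) (r y) (r z) * (eps (r p) (r b) (r c) * eps (r q) (r d) (r f))))).
    by rewrite /= !inE !negb_or in u; conj_split; rewrite /= /upd ?eqxx; nerw.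
  by move=> v; rewrite !eweight_cons !bweight_cons eweight_nil bweight_nil /=; ring.
rewrite -/E' -/B0 !L -sumND.
have uE : uniq (enames E').
  by apply: (cubic_uniq (s := [:: p; x; q; y]) cu); perm_tac.
pose H b0 c0 (C0 D0 : 'M[K]_3) b0' c0' (r : env) := (X # Y) (r c0) (r z) * (Z (r z) (r z') * C0 (r c0) (r c0')) *
    (eweight ((b0, b0', D0) :: E) r * bweight K ((b0, d, f) :: B) r).
rewrite (eq_sumN _ (g := fun r => H b c C D b' c' r - H c b D C c' b' r)); last first.
  move=> r; rewrite -mulrDl (_ : G X Y r + G Y X r = (X # Y) (r c) (r z) * eps (r b) (r d) (r f)
     - (X # Y) (r b) (r z) * eps (r c) (r d) (r f)).
    by rewrite /H !eweight_cons !bweight_cons /=; ring.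
  rewrite /G -swap_local -big_split; apply: eq_bigr => p0 _ /=; rewrite -big_split; apply: eq_bigr => q0 _ /=.
  rewrite -big_split; apply: eq_bigr => x0 _ /=; rewrite -big_split; apply: eq_bigr => y0 _ /=.
  by rewrite -mulrDl.
have uB : uniq (bnames B0) by exact: cubic_uniqB cu.
rewrite sumND sumN_opp /H !swap_merge //; last first.
- have pp : perm_eq (bnames B0) ((bnames ((b, d, f) :: B) ++ [:: c; z]) ++ [:: x; y; p; q]).
    by rewrite /B0; perm_tac.
  by move: uB; rewrite (perm_uniq pp) cat_uniq => /andP[].
- by rewrite /E'; perm_tac.
- have pp : perm_eq (bnames B0) ((bnames ((c, d, f) :: B) ++ [:: b; z]) ++ [:: x; y; p; q]).
    by rewrite /B0; perm_tac.
  by move: uB; rewrite (perm_uniq pp) cat_uniq => /andP[].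
- by rewrite /E'; perm_tac.
move/labels_cons: l => [hX /labels_cons[hY /labels_cons[hZ /labels_cons[hC /labels_cons[hD hE]]]]].
have hm (V : 'M[K]_3) : inW V -> inW (V^T * (X # Y) * Z).
  move=> hV; apply: (inD_word NF) => //; first exact: (inW_tr NF).
  exact: (inD_cross_words NF).
rewrite !IH ?subr0 //=; do ?[by rewrite sB].
- by apply: (cubic_sub (s := [:: x; y; z; p; q; b]) cu); rewrite /B0; perm_tac.
- by apply/labels_cons; split; [exact: hm|apply/labels_cons].
- by apply: (cubic_sub (s := [:: x; y; z; p; q; c]) cu); rewrite /B0; perm_tac.
- by apply/labels_cons; split; [exact: hm|apply/labels_cons].
Qed.

(** The neighbourhood of the edge (i, j): the brackets at its ends, and the
    four other edges at these. *)
Definition cfg (i j a b c d a' b' c' d' : nat) E B (Yc Y1 Y2 Y3 Y4 : 'M[K]_3) :=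
  ev ((i, j, Yc) :: (a, a', Y1) :: (b, b', Y2) :: (c, c', Y3) :: (d, d', Y4) :: E)
    ((i, a, b) :: (j, c, d) :: B).

Definition cfg_cubic (i j a b c d a' b' c' d' : nat) E B :=
  cubic ((i, j, 0) :: (a, a', 0) :: (b, b', 0) :: (c, c', 0) :: (d, d', 0) :: E)
    ((i, a, b) :: (j, c, d) :: B).

(** swap_edges for the brackets of j and of a', which are joined by way of the
    bracket of i. *)
Lemma center_swap n i j a b c d a' b' c' d' E B Yc Y1 Y2 Y3 Y4 : vanish n -> size B = n ->
  cfg_cubic i j a b c d a' b' c' d' E B -> labels E ->
  inW Yc -> inW Y1 -> inW Y2 -> inW Y3 -> inW Y4 ->
  cfg i j a b c d a' b' c' d' E B Yc Y1 Y2 Y3 Y4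
  + cfg i j a b c d a' b' c' d' E B Y1 Yc Y2 Y3 Y4 = 0.
Proof.
move=> IH sB cu lE hc h1 h2 h3 h4; rewrite /cfg_cubic in cu.
have aB : a' \in bnames B by mem_tac cu a'.
have [g [h [B0 b0]]] := pull_bracket K aB.
have sB0 : n = (size B0).+1 by case: b0 => _ [+ _]; rewrite sB.
have {}b0 := same_brackets_cons (i, a, b) (same_brackets_cons (j, c, d) b0).
have [s hs] := ev_same_brackets b0.
have ed (Z1 Z2 : 'M[K]_3) : same_edges
    ((i, j, Z1) :: (a, a', Z2) :: (b, b', Y2) :: (c, c', Y3) :: (d, d', Y4) :: E)
    ((j, i, Z1^T) :: (a', a, Z2^T) :: (b, b', Y2) :: (d, d', Y4) :: (c, c', Y3) :: E).
  apply: same_edges_trans (same_edges_flip _ _ _ _) _; apply: same_edges_cons.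
  apply: same_edges_trans (same_edges_flip _ _ _ _) _; do 2!apply: same_edges_cons.
  exact: same_edges_swap.
rewrite /cfg !hs (ev_same_edges _ _ (ed Yc Y1)) ?(ev_same_edges _ _ (ed Y1 Yc)); try exact: (andP cu).1.
rewrite -mulrDr (swap_edges (n := size B0)) ?mulr0 -?sB0 //.
- exact: (cubic_eq (ed Yc Y1) b0 cu).
- by do 5!(apply/labels_cons; split=> //=; try exact: (inW_tr NF)).
Qed.

(** This symmetry and cfg_ij transport center_swap to the three other edges. *)
Lemma cfg_ab i j a b c d a' b' c' d' E B : cfg_cubic i j a b c d a' b' c' d' E B ->
  exists s : K, forall Yc Y1 Y2 Y3 Y4, cfg i j a b c d a' b' c' d' E B Yc Y1 Y2 Y3 Y4
    = s * cfg i j b a c d b' a' c' d' E B Yc Y2 Y1 Y3 Y4.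
Proof.
move=> cu; have b0 : same_brackets K ((i, a, b) :: (j, c, d) :: B) ((i, b, a) :: (j, c, d) :: B).
  apply: same_brackets_trans (same_brackets_rot _ _ _ _ _) _.
  apply: same_brackets_trans (same_brackets_swap _ _ _ _ _) _.
  by apply: same_brackets_trans (same_brackets_rot _ _ _ _ _) (same_brackets_rot _ _ _ _ _).
have [s hs] := ev_same_brackets b0; exists s => Yc Y1 Y2 Y3 Y4.
rewrite /cfg hs; congr (_ * _); apply: ev_same_edges; first exact: (andP cu).1.
by apply: same_edges_cons; exact: same_edges_swap.
Qed.

Lemma cfg_ij n i j a b c d a' b' c' d' E B : vanish n -> size B = n ->
  cfg_cubic i j a b c d a' b' c' d' E B -> labels E ->
  forall Yc Y1 Y2 Y3 Y4, inW Yc -> inW Y1 -> inW Y2 -> inW Y3 -> inW Y4 ->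
  cfg i j a b c d a' b' c' d' E B Yc Y1 Y2 Y3 Y4
    = cfg j i c d a b c' d' a' b' E B Yc Y3 Y4 Y1 Y2.
Proof.
move=> IH sB cu lE Yc Y1 Y2 Y3 Y4 hc h1 h2 h3 h4.
rewrite /cfg (edge_flip NF (n := n)) //=; last 2 first.
- by rewrite sB.
- by do 5!(apply/labels_cons; split=> //=).
rewrite (ev_same_edges _ _ (same_edges_flip _ _ _ _)) ?trmxK; last exact: (andP cu).1.
have e2 : same_edges ((j, i, Yc) :: (a, a', Y1) :: (b, b', Y2) :: (c, c', Y3) :: (d, d', Y4) :: E)
   ((j, i, Yc) :: (c, c', Y3) :: (d, d', Y4) :: (a, a', Y1) :: (b, b', Y2) :: E).
  apply: same_edges_cons.
  apply: same_edges_trans (same_edges_cons _ (same_edges_swap _ _ _)) _.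
  apply: same_edges_trans (same_edges_swap _ _ _) _; apply: same_edges_cons.
  apply: same_edges_trans (same_edges_cons _ (same_edges_swap _ _ _)) _.
  exact: same_edges_swap.
rewrite (ev_same_edges _ _ e2); last first.
  have pp : perm_eq (enames [:: (i, j, Yc), (a, a', Y1), (b, b', Y2), (c, c', Y3), (d, d', Y4) & E])
    (enames [:: (j, i, Yc), (a, a', Y1), (b, b', Y2), (c, c', Y3), (d, d', Y4) & E]) by perm_tac.
  by rewrite -(perm_uniq pp); exact: (andP cu).1.
rewrite /ev; apply: eq_sumN => r; rewrite !bweight_cons; ring.
Qed.
End Config.

(** * Vanishing of the graphs *)

Section StarForms.
Variables (T : Type) (V : comNzRingType) (reg3 : forall x : V, x + x + x = 0 -> x = 0).
Variables (F : T -> T -> T -> T -> T -> V) (M : T -> T).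
Hypothesis s1 : forall c x y z t, F c x y z t + F x c y z t = 0.
Hypothesis s2 : forall c x y z t, F c x y z t + F y x c z t = 0.
Hypothesis s3 : forall c x y z t, F c x y z t + F z x y c t = 0.
Hypothesis s4 : forall c x y z t, F c x y z t + F t x y z c = 0.
Hypothesis leib : forall c x y z t,
  F (M c) x y z t + F c (M x) y z t + F c x (M y) z t = 0.

Let e1 c x y z t : F c x y z t = - F x c y z t.
Proof. by apply/eqP; rewrite -addr_eq0 s1. Qed.
Let e2 c x y z t : F c x y z t = - F y x c z t.
Proof. by apply/eqP; rewrite -addr_eq0 s2. Qed.
Let e3 c x y z t : F c x y z t = - F z x y c t.
Proof. by apply/eqP; rewrite -addr_eq0 s3. Qed.
Let e4 c x y z t : F c x y z t = - F t x y z c.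
Proof. by apply/eqP; rewrite -addr_eq0 s4. Qed.
Let e34 c x y z t : F c x y z t = - F c x z y t.
Proof. by rewrite e2 e3 e2 !opprK. Qed.
Let e35 c x y z t : F c x y z t = - F c x t z y.
Proof. by rewrite e2 e4 e2 !opprK. Qed.
Let e25 c x y z t : F c x y z t = - F c t y z x.
Proof. by rewrite e1 e4 e1 !opprK. Qed.
Let rot5 c x y z t : F y z t c x = F c x y z t.
Proof. by rewrite e3 e25 opprK e35 e34 opprK. Qed.

(** The derivation relation at one bracket, used for several triples of the
    five labels, makes the five terms of the derivation proportional. *)
Lemma leibniz_alternating c x y z t : F (M c) x y z t = 0.
Proof.
have third c' x' y' z' t' : F c' x' (M y') z' t' = 0.
  apply: reg3.
  have l1 := leib c' x' y' z' t'; have l2 := leib c' x' z' y' t'.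
  have l3 := leib c' x' t' z' y'; have l4 := leib y' z' t' c' x'.
  rewrite !(e34 _ _ z') in l2; rewrite (e34 _ _ (M z')) in l2; rewrite !(e35 _ _ t') (e35 _ _ (M t')) in l3.
  rewrite !(rot5 c' x') in l4.
  by lc (2 ⊡ l1 ⊞ l2 ⊞ l3 ⊞ l4).
by rewrite e2 third oppr0.
Qed.
End StarForms.

Section Vanishing.
Variables (K : comNzRingType) (e : 'I_4 -> 'M[K]_3).
Hypothesis NF : null_forms e.
Notation edge := (nat * nat * 'M[K]_3)%type.
Notation bracket := (nat * nat * nat)%type.
Local Notation inW := (inW e).
Local Notation labels := (labels e).
Local Notation vanish := (vanish e).
Implicit Types (E : seq edge) (B : seq bracket).

Let word := {A : 'M[K]_3 | inW A}.
Let letter (i : 'I_4) : word := exist _ (e i) (W_letter (inS_e e i)).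

(** By leibniz_alternating a label with a trace-free prefix gives zero, so
    that only letters remain, and star5 applies to these. *)
Lemma star_words_eq0 (F : 'M[K]_3 -> 'M[K]_3 -> 'M[K]_3 -> 'M[K]_3 -> 'M[K]_3 -> K) :
  (forall x y a b c d, F (x + y) a b c d = F x a b c d + F y a b c d) ->
  (forall k x a b c d, F (k *: x) a b c d = k * F x a b c d) ->
  (forall c x y z t, inW c -> inW x -> inW y -> inW z -> inW t -> F c x y z t + F x c y z t = 0) ->
  (forall c x y z t, inW c -> inW x -> inW y -> inW z -> inW t -> F c x y z t + F y x c z t = 0) ->
  (forall c x y z t, inW c -> inW x -> inW y -> inW z -> inW t -> F c x y z t + F z x y c t = 0) ->
  (forall c x y z t, inW c -> inW x -> inW y -> inW z -> inW t -> F c x y z t + F t x y z c = 0) ->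
  (forall M c x y z t, \tr M = 0 -> F (M * c) x y z t + F c (M * x) y z t + F c x (M * y) z t = 0) ->
  forall c x y z t, inW c -> inW x -> inW y -> inW z -> inW t -> F c x y z t = 0.
Proof.
move=> FD FZ s1 s2 s3 s4 leib.
pose G (c x y z t : word) := F (sval c) (sval x) (sval y) (sval z) (sval t).
have g1 c x y z t : G c x y z t + G x c y z t = 0 by apply: s1; exact: svalP.
have g2 c x y z t : G c x y z t + G y x c z t = 0 by apply: s2; exact: svalP.
have g3 c x y z t : G c x y z t + G z x y c t = 0 by apply: s3; exact: svalP.
have g4 c x y z t : G c x y z t + G t x y z c = 0 by apply: s4; exact: svalP.
have FM u b f A (x y z t : word) : inS e u -> inS e b -> inS e f -> inW A ->
    F (u * (b # f) * A) (sval x) (sval y) (sval z) (sval t) = 0.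
  move=> hu hb hf hA.
  pose M (Y : word) : word := exist _ (u * (b # f) * sval Y) (inW_prefix NF hu hb hf (svalP Y)).
  apply: (leibniz_alternating (nf_reg3 NF) g1 g2 g3 g4 (M := M) _ (exist _ A hA)) => *.
  by apply: leib; exact: (tr1_S NF).
have red (x y z t : word) : (forall i, G (letter i) x y z t = 0) -> forall c, G c x y z t = 0.
  move=> h [c hc]; rewrite /G /=; elim: hc => [a ha|a b f d *|a b f d g h' k *|A A' _ hA _ hA'].
  - exact: (inS_lin (f := fun c => F c _ _ _ _)) ha.
  - by apply: FM => //; exact: W_letter.
  - by rewrite -!mulrA (mulrA a); apply: FM => //; rewrite mulrA; exact: W_triple.
  - by rewrite FD hA hA' addr0.
have sw (a b : K) : a + b = 0 -> b = 0 -> a = 0 by move=> + h; rewrite h addr0.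
have all c x y z t : G c x y z t = 0.
  apply: (red) => {c} i1; apply: (sw _ _ (g1 _ _ _ _ _)).
  apply: (red) => {x} i2; apply: (sw _ _ (g2 _ _ _ _ _)).
  apply: (red) => {y} i3; apply: (sw _ _ (g3 _ _ _ _ _)).
  apply: (red) => {z} i4; apply: (sw _ _ (g4 _ _ _ _ _)).
  apply: (red) => {t} i5.
  apply: (star5 (P := eq^~ 0) _ (nf_reg2 NF) (f := fun a b c d f =>
    G (letter a) (letter b) (letter c) (letter d) (letter f))) => //.
  by move=> u v -> ->; rewrite subr0.
move=> c x y z t hc hx hy hz ht.
exact: (all (exist _ c hc) (exist _ x hx) (exist _ y hy) (exist _ z hz) (exist _ t ht)).
Qed.

Lemma cfg_eq0 n i j a b c d a' b' c' d' E B : vanish n -> size B = n ->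
  cfg_cubic i j a b c d a' b' c' d' E B -> labels E ->
  forall Yc Y1 Y2 Y3 Y4, inW Yc -> inW Y1 -> inW Y2 -> inW Y3 -> inW Y4 ->
  cfg i j a b c d a' b' c' d' E B Yc Y1 Y2 Y3 Y4 = 0.
Proof.
move=> IH sB cu lE.
have cu_ab : cfg_cubic i j b a c d b' a' c' d' E B.
  by apply: (cubic_sub (s := [::]) cu); perm_tac.
have cu_ij : cfg_cubic j i c d a b c' d' a' b' E B.
  by apply: (cubic_sub (s := [::]) cu); perm_tac.
have cu_ijab : cfg_cubic j i d c a b d' c' a' b' E B.
  by apply: (cubic_sub (s := [::]) cu); perm_tac.
have [s hs] := cfg_ab cu; have [s' hs'] := cfg_ab cu_ij.
apply: star_words_eq0.
- by move=> *; exact: ev_addl.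
- by move=> *; exact: ev_scalel.
- by move=> *; exact: (center_swap NF IH).
- by move=> *; rewrite !hs -mulrDr (center_swap NF IH) ?mulr0.
- by move=> *; rewrite !(cfg_ij NF IH sB cu lE) //; exact: (center_swap NF IH).
- move=> *; rewrite !(cfg_ij NF IH sB cu lE) // !hs' -mulrDr (center_swap NF IH) ?mulr0 //.
- by move=> M *; exact: ev_leibniz.
Qed.

(** Induction on the number of brackets. A loop and a bigon can be contracted.
    Otherwise the edge (x, p) has four distinct further edges at its ends, and
    cfg_eq0 applies. *)
Theorem graph_eq0 k : (0 < k)%N -> vanish k.
Proof.
elim/ltn_ind: k => -[//|[|n]] IHk _ E B sB cu l.
  (* a single bracket has an odd number of ends *)
  case: B sB cu => [//|x [|//]] _ /andP[_ /perm_size /=].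
  have : ~~ odd (size (enames E)) by elim: (E) => //= y E' IH; rewrite negbK.
  by move=> + eq3; rewrite eq3.
have IH : (0 < n)%N -> vanish n by move=> n0; exact: IHk.
have loop E' E'' B' h m w X B'' : same_edges E' ((h, m, X) :: E'') ->
    same_brackets K B' ((h, m, w) :: B'') -> size B' = n.+2 -> cubic E' B' -> labels E' ->
    ev E' B' = 0.
  move=> e1 b1 sB' c' l'; apply: (ev_eq0 e1 b1 c').
  apply: (loop_eq0 NF IH); [|exact: cubic_eq e1 b1 c'|exact: (labels_eq NF e1 l')].
  by case: b1 => _ [+ _]; rewrite sB' => -[].
have bigon E' E'' B' x y z p q w X Y B'' : same_edges E' ((x, p, X) :: (y, q, Y) :: E'') ->
    same_brackets K B' ((x, y, z) :: (p, q, w) :: B'') -> size B' = n.+2 -> cubic E' B' -> labels E' ->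
    ev E' B' = 0.
  move=> e1 b1 sB' c' l'; apply: (ev_eq0 e1 b1 c').
  apply: (bigon_eq0 NF IH); [|exact: cubic_eq e1 b1 c'|exact: (labels_eq NF e1 l')].
  by case: b1 => _ [+ _]; rewrite sB' => -[].
have rfl := same_edges_refl; have bswap := same_brackets_swap K; have brot := same_brackets_rot K.
have brfl := same_brackets_refl K.
case: B sB cu => [//|[[x y] z] B1] [sB] cu.
have xE : x \in enames E by mem_tac cu x.
have [p [X [E1 e1]]] := pull_edge xE.
apply: (ev_eq0 e1 (brfl _) cu); have {}l := labels_eq NF e1 l.
have {}cu := cubic_eq e1 (brfl _) cu.
have sB' : size ((x, y, z) :: B1) = n.+2 by rewrite /= sB.
case: (eqVneq p y) => [py|py].
  by rewrite py in cu l *; exact: (loop _ _ _ _ _ _ _ _ (rfl _ _) (brfl _) sB' cu l).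
case: (eqVneq p z) => [pz|pz].
  rewrite pz in cu l *; apply: (loop _ _ _ _ _ _ _ _ (rfl _ _) _ sB' cu l).
  exact: same_brackets_trans (brot _ _ _ _) (same_brackets_trans (brot _ _ _ _) (same_brackets_trans (bswap _ _ _ _) (brfl _))).
have pB : p \in bnames B1 by mem_tac cu p.
have [b [c [B2 b2]]] := pull_bracket K pB.
have sB2 : size B2 = n by case: b2 => _ [+ _]; rewrite sB => -[].
have {}b2 := same_brackets_cons (x, y, z) b2.
apply: (ev_eq0 (rfl _ _) b2 cu); have {}cu := cubic_eq (rfl _ _) b2 cu.
have {}sB' : size ((x, y, z) :: (p, b, c) :: B2) = n.+2 by rewrite /= sB2.
have yE : y \in enames E1 by mem_tac cu y.
have [q [Y [E2 e2]]] := pull_edge yE.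
have {}e2 := same_edges_cons (x, p, X) e2.
apply: (ev_eq0 e2 (brfl _) cu); have {}l := labels_eq NF e2 l.
have {}cu := cubic_eq e2 (brfl _) cu.
case: (eqVneq q z) => [qz|qz].
  rewrite qz in cu l *; apply: (loop _ _ _ _ _ _ _ _ (same_edges_swap _ _ _) _ sB' cu l).
  exact: brot.
case: (eqVneq q b) => [qb|qb].
  by rewrite qb in cu l *; exact: (bigon _ _ _ _ _ _ _ _ _ _ _ _ (rfl _ _) (brfl _) sB' cu l).
have b_pcb u v w B' : same_brackets K ((u, v, w) :: B') ((u, w, v) :: B').
  apply: same_brackets_trans (brot _ _ _ _) _.
  apply: same_brackets_trans (bswap _ _ _ _) _.
  exact: same_brackets_trans (brot _ _ _ _) (brot _ _ _ _).
case: (eqVneq q c) => [qc|qc].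
  rewrite qc in cu l *; apply: (bigon _ _ _ _ _ _ _ _ _ _ _ _ (rfl _ _) _ sB' cu l).
  exact: same_brackets_cons (b_pcb _ _ _ _).
have qB : q \in bnames B2 by mem_tac cu q.
have n0 : (0 < n)%N by rewrite -sB2; case: (B2) qB.
have zE : z \in enames E2 by mem_tac cu z.
have [r [Z [E3 e3]]] := pull_edge zE.
have {}e3 := same_edges_cons (x, p, X) (same_edges_cons (y, q, Y) e3).
apply: (ev_eq0 e3 (brfl _) cu); have {}l := labels_eq NF e3 l.
have {}cu := cubic_eq e3 (brfl _) cu.
have ez : same_edges ((x, p, X) :: (y, q, Y) :: (z, r, Z) :: E3)
  ((x, p, X) :: (z, r, Z) :: (y, q, Y) :: E3) by apply: same_edges_cons; exact: same_edges_swap.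
case: (eqVneq r b) => [rb|rb].
  rewrite rb in cu l ez *; apply: (bigon _ _ _ _ _ _ _ _ _ _ _ _ ez _ sB' cu l).
  exact: b_pcb.
case: (eqVneq r c) => [rc|rc].
  rewrite rc in cu l ez *; apply: (bigon _ _ _ _ _ _ _ _ _ _ _ _ ez _ sB' cu l).
  exact: same_brackets_trans (b_pcb _ _ _ _) (same_brackets_cons _ (b_pcb _ _ _ _)).
have bE : b \in enames E3 by mem_tac cu b.
have [b' [D [E4 e4]]] := pull_edge bE.
have {}e4 := same_edges_cons (x, p, X) (same_edges_cons (y, q, Y) (same_edges_cons (z, r, Z) e4)).
apply: (ev_eq0 e4 (brfl _) cu); have {}l := labels_eq NF e4 l.
have {}cu := cubic_eq e4 (brfl _) cu.
case: (eqVneq c b') => [cb|cb].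
  rewrite -cb in cu l *.
  have eb : same_edges ((x, p, X) :: (y, q, Y) :: (z, r, Z) :: (b, c, D) :: E4)
    ((b, c, D) :: (x, p, X) :: (y, q, Y) :: (z, r, Z) :: E4).
    apply: same_edges_trans (same_edges_cons _ (same_edges_cons _ (same_edges_swap _ _ _))) _.
    apply: same_edges_trans (same_edges_cons _ (same_edges_swap _ _ _)) _.
    exact: same_edges_swap.
  apply: (loop _ _ _ _ _ _ _ _ eb _ sB' cu l).
  exact: same_brackets_trans (same_brackets_exch _ _ _ _) (brot _ _ _ _).
have cE : c \in enames E4 by mem_tac cu c.
have [c' [C [E5 e5]]] := pull_edge cE.
have {}e5 := same_edges_cons (x, p, X) (same_edges_cons (y, q, Y) (same_edges_cons (z, r, Z) (same_edges_cons (b, b', D) e5))).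
apply: (ev_eq0 e5 (brfl _) cu); have {}l := labels_eq NF e5 l.
have {}cu := cubic_eq e5 (brfl _) cu.
move/labels_cons: l => [hX /labels_cons[hY /labels_cons[hZ /labels_cons[hD /labels_cons[hC hE]]]]].
exact: (cfg_eq0 (IH n0) sB2 (cu : cfg_cubic x p y z b c q r b' c' E5 B2) hE).
Qed.
End Vanishing.

(** * Quotient by an ideal *)

Section IdealQuotient.
Variable A : comNzRingType.

Record ideal := Ideal { ideal_pred :> A -> Prop;
  ideal_1 : ~ ideal_pred 1;
  ideal_0 : ideal_pred 0;
  ideal_lin : forall a u v, ideal_pred u -> ideal_pred v -> ideal_pred (a * u + v) }.

Definition in_ideal (J : ideal) : {pred A} := fun a => `[< J a >].

Lemma in_ideal_closed J : idealr_closed (in_ideal J).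
Proof.
split; rewrite ?unfold_in.
- by apply/asboolP; exact: ideal_0.
- by apply/asboolP; exact: ideal_1.
- by move=> a u v /asboolP hu /asboolP hv; apply/asboolP; exact: ideal_lin.
Qed.
HB.instance Definition _ (J : ideal) := isIdealr.Build A (in_ideal J) (in_ideal_closed J).

Lemma quotient_by_ideal (J : ideal) :
  exists (Q : comNzRingType) (pi : {rmorphism A -> Q}), forall a, pi a = 0 <-> J a.
Proof.
exists {ideal_quot (in_ideal J)}, (\pi_{ideal_quot (in_ideal J)})%qT => a.
rewrite -[X in _ = X](rmorph0 (\pi_{ideal_quot (in_ideal J)})%qT).
split=> [/eqP|h].
  by rewrite -Quotient.idealrBE subr0 => /asboolP.
by apply/eqP; rewrite -Quotient.idealrBE subr0; apply/asboolP.
Qed.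
End IdealQuotient.

(** * Polynomials that vanish everywhere *)

Section Infinite.
Variable F : numFieldType.

Lemma poly_eq0_nz (p : {poly F}) : (forall t, t != 0 -> p.[t] = 0) -> p = 0.
Proof.
move=> h; apply/eqP; apply: contraT => p0.
pose rs := [seq (n.+1%:R : F) | n <- iota 0 (size p)].
have := @max_poly_roots _ p rs p0; rewrite size_map size_iota ltnn; apply.
  by apply/allP => _ /mapP[n _ ->]; apply/rootP/h; rewrite pnatr_eq0.
rewrite map_inj_uniq ?iota_uniq // => n m /eqP; rewrite eqr_nat => /eqP; exact: succn_inj.
Qed.

Lemma digits_inj D n (f g : 'I_n -> nat) :
  (forall i, (f i < D)%N) -> (forall i, (g i < D)%N) ->
  (\sum_i f i * D ^ i = \sum_i g i * D ^ i)%N -> f =1 g.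
Proof.
elim: n f g => [|n IH] f g hf hg; first by move=> _ [].
have step (h : 'I_n.+1 -> nat) : (\sum_i h i * D ^ i =
    (\sum_i h (lift ord0 i) * D ^ i) * D + h ord0)%N.
  rewrite big_ord_recl expn0 muln1 addnC big_distrl /=; congr (_ + _)%N.
  by apply: eq_bigr => i _; rewrite /bump expnS mulnCA mulnC.
rewrite !step => e.
have D0 : (0 < D)%N by apply: leq_ltn_trans (hf ord0).
have e0 : f ord0 = g ord0.
  by have := congr1 (modn^~ D) e; rewrite /= !modnMDl !modn_small.
have e1 : (\sum_i f (lift ord0 i) * D ^ i = \sum_i g (lift ord0 i) * D ^ i)%N.
  by have := congr1 (divn^~ D) e; rewrite /= !divnMDl // !divn_small // !addn0.
move=> i; case: (unliftP ord0 i) => [j|] -> //.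
exact: (IH (fun i => f (lift ord0 i)) (fun i => g (lift ord0 i))).
Qed.

(** Kronecker's substitution reduces this to one variable. *)
Lemma mpoly_eq0 n (p : {mpoly F[n]}) : (forall v, p.@[v] = 0) -> p = 0.
Proof.
move=> h; pose D := (msize p).+1; pose w (m : 'X_{1..n}) := (\sum_i m i * D ^ i)%N.
have small m i : m \in msupp p -> (m i < D)%N.
  move=> hm; rewrite ltnS; apply: leq_trans (ltnW (msize_mdeg_lt hm)).
  by rewrite mdegE (bigD1 i) //= leq_addr.
have q0 : \sum_(m <- msupp p) p@_m *: 'X^(w m) = 0 :> {poly F}.
  apply: poly_eq0_nz => t _; rewrite horner_sum -[RHS](h (fun i => t ^+ (D ^ i))) mevalE.
  apply: eq_bigr => m _; rewrite hornerZ hornerXn; congr (_ * _).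
  rewrite /w -prodrXr; apply: eq_bigr => i _.
  by rewrite mulnC exprM.
apply/mpolyP => m; rewrite mcoeff0; case: (boolP (m \in msupp p)) => [hm|]; last exact: memN_msupp_eq0.
have := congr1 (fun q : {poly F} => q`_(w m)) q0; rewrite coef0 coef_sum (bigD1_seq m) //=.
  rewrite coefZ coefXn eqxx mulr1 big_seq_cond big1 ?addr0 // => m' /andP[hm' nm].
  rewrite coefZ coefXn; case: eqP => [e|]; last by rewrite mulr0.
  case/eqP: nm; apply/mnmP; apply: (digits_inj (D := D)) => // [i|i]; exact: small.
Qed.
End Infinite.

(** * Cayley's operator *)

Section Omega.
Variable F : numFieldType.
Notation P := {mpoly F[3 * 3]}.
Implicit Types (p q : P) (i j a b c : 'I_3).

(** The entries of a generic matrix, as variables, and the derivatives with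
    respect to them. *)
Definition gv i a : P := 'X_(mxvec_index i a).
Definition gd i a p : P := mderiv (mxvec_index i a) p.

Lemma mxvec_index_eq i a j b :
  (mxvec_index i a == mxvec_index j b :> 'I_(3 * 3)) = (i == j) && (a == b).
Proof.
apply/eqP/andP=> [h|[/eqP -> /eqP ->] //].
case: (curry_mxvec_bij 3 3) => f fK _.
by have := fK (j, b) isT; rewrite /= -h => e; have := fK (i, a) isT; rewrite /= e => -[-> ->].
Qed.

Lemma gdD i a : {morph gd i a : p q / p + q}. Proof. exact: mderivD. Qed.
Lemma gdZ i a (k : F) p : gd i a (k *: p) = k *: gd i a p. Proof. exact: mderivZ. Qed.
Lemma gd0 i a : gd i a 0 = 0. Proof. exact: mderiv0. Qed.
Lemma gdM i a p q : gd i a (p * q) = gd i a p * q + p * gd i a q. Proof. exact: mderivM. Qed.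
Lemma gdC i a (k : F) : gd i a k%:MP = 0. Proof. exact: mderivC. Qed.
Lemma gd1 i a : gd i a 1 = 0. Proof. by rewrite -mpolyC1 gdC. Qed.
Lemma gd_gv i a j b : gd i a (gv j b) = ((i == j) && (a == b))%:R.
Proof.
rewrite /gd /gv mderivX mnmE mxvec_index_eq eq_sym [b == a]eq_sym.
case: eqP => [<-|_] /=; last by rewrite scale0r.
by case: eqP => [<-|_] /=; rewrite ?scale0r // scale1r (_ : (_ - _)%MM = 0%MM) ?mpolyX0 //; apply/mnmP => x; rewrite mnmBE subnn mnm0E.
Qed.
Lemma gd_sum i a (J : Type) (l : seq J) (Q : pred J) (f : J -> P) :
  gd i a (\sum_(x <- l | Q x) f x) = \sum_(x <- l | Q x) gd i a (f x).
Proof. exact: (big_morph _ (gdD i a) (gd0 i a)). Qed.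
Lemma gd_exp i a p k : gd i a (p ^+ k.+1) = k.+1%:R * p ^+ k * gd i a p.
Proof.
elim: k => [|k IH]; first by rewrite expr1 expr0 !mul1r.
by rewrite exprS gdM IH (exprS p k) -(natr1 k.+1); ring.
Qed.

(** The determinant of the matrix of partial derivatives. *)
Definition Omega p : P :=
  \sum_a \sum_b \sum_c eps F a b c *: gd 0 a (gd 1 b (gd 2 c p)).

Lemma OmegaD : {morph Omega : p q / p + q}.
Proof.
move=> p q; rewrite /Omega -big_split; apply: eq_bigr => a _; rewrite -big_split.
by apply: eq_bigr => b _; rewrite -big_split; apply: eq_bigr => c _; rewrite !gdD scalerDr.
Qed.
Lemma OmegaZ k p : Omega (k *: p) = k *: Omega p.
Proof.
rewrite /Omega scaler_sumr; apply: eq_bigr => a _; rewrite scaler_sumr; apply: eq_bigr => b _.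
by rewrite scaler_sumr; apply: eq_bigr => c _; rewrite !gdZ !scalerA mulrC.
Qed.
Lemma sum3_eps (V : lmodType F) (f : 'I_3 -> 'I_3 -> 'I_3 -> V) :
  \sum_a \sum_b \sum_c eps F a b c *: f a b c =
  f 0 1 2 - f 0 2 1 - f 1 0 2 + f 1 2 0 + f 2 0 1 - f 2 1 0.
Proof.
rewrite !sum3E /eps /= !scale0r !scale1r !scaleN1r !(addr0, add0r).
by rewrite !addrA.
Qed.

Definition gdet : P := \sum_a \sum_b \sum_c eps F a b c *: (gv 0 a * gv 1 b * gv 2 c).

Definition minor i a : P := gv (i+1) (a+1) * gv (i+2) (a+2) - gv (i+1) (a+2) * gv (i+2) (a+1).

Lemma gd_opp i a p : gd i a (- p) = - gd i a p.
Proof. by rewrite -scaleN1r gdZ scaleN1r. Qed.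

Lemma gdetE : gdet = gv 0 0 * gv 1 1 * gv 2 2 - gv 0 0 * gv 1 2 * gv 2 1 - gv 0 1 * gv 1 0 * gv 2 2
   + gv 0 1 * gv 1 2 * gv 2 0 + gv 0 2 * gv 1 0 * gv 2 1 - gv 0 2 * gv 1 1 * gv 2 0.
Proof. by rewrite /gdet sum3_eps. Qed.

Lemma gd_gdet i a : gd i a gdet = minor i a.
Proof.
rewrite /minor gdetE !(gdD, gd_opp, gdM) !gd_gv.
by move: i a; do 2!apply: ord3P; rewrite /= !add3E; ring.
Qed.

Lemma gd_gdet_exp i a k p : gd i a (gdet ^+ k * p) =
  k%:R * gdet ^+ k.-1 * minor i a * p + gdet ^+ k * gd i a p.
Proof.
rewrite gdM; case: k => [|k]; first by rewrite !expr0 gd1 !mul0r.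
by rewrite gd_exp gd_gdet.
Qed.

Lemma det_minors (g : 'I_3 -> 'I_3 -> P) :
  let m i a := g (i+1) (a+1) * g (i+2) (a+2) - g (i+1) (a+2) * g (i+2) (a+1) in
  m 0 0 * m 1 1 * m 2 2 - m 0 0 * m 1 2 * m 2 1 - m 0 1 * m 1 0 * m 2 2
  + m 0 1 * m 1 2 * m 2 0 + m 0 2 * m 1 0 * m 2 1 - m 0 2 * m 1 1 * m 2 0 =
  (g 0 0 * g 1 1 * g 2 2 - g 0 0 * g 1 2 * g 2 1 - g 0 1 * g 1 0 * g 2 2
   + g 0 1 * g 1 2 * g 2 0 + g 0 2 * g 1 0 * g 2 1 - g 0 2 * g 1 1 * g 2 0) ^+ 2.
Proof. by rewrite /= !add3E; ring. Qed.

(** By Leibniz's rule the third derivative of a power of the determinant is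
    a sum of terms with one, two or three of its factors derived; their
    alternating sums are multiples of powers of the determinant. *)
Lemma Cayley k : Omega (gdet ^+ k.+1) = (k.+1 * k.+2 * k.+3)%:R * gdet ^+ k.
Proof.
pose f3 a b c := minor 0 a * minor 1 b * minor 2 c.
pose f2 a b c := gd 0 a (minor 1 b) * minor 2 c + minor 1 b * gd 0 a (minor 2 c)
  + minor 0 a * gd 1 b (minor 2 c).
pose f1 a b c := gd 0 a (gd 1 b (minor 2 c)).
pose alt (f : 'I_3 -> 'I_3 -> 'I_3 -> P) :=
  f 0 1 2 - f 0 2 1 - f 1 0 2 + f 1 2 0 + f 2 0 1 - f 2 1 0.
have third a b c : gd 0 a (gd 1 b (gd 2 c (gdet ^+ k.+1))) = k.+1%:R *
    (k%:R * k.-1%:R * gdet ^+ k.-2 * f3 a b c + k%:R * gdet ^+ k.-1 * f2 a b c + gdet ^+ k * f1 a b c).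
  have gdnM i x (n : nat) p : gd i x (n%:R * p) = n%:R * gd i x p.
    by rewrite gdM -[n%:R in X in X + _]mpolyC_nat gdC mul0r add0r.
  rewrite gd_exp gd_gdet -mulrA gdnM gd_gdet_exp -!mulrA gdnM gdD gdnM !gd_gdet_exp gdM.
  by rewrite /f1 /f2 /f3; ring.
have a3 : alt f3 = gdet ^+ 2 by rewrite /alt /f3 gdetE; exact: det_minors.
have a2 : alt f2 = 6 * gdet.
  rewrite /alt /f2 /minor !add3E !(gdD, gd_opp, gdM, gd_gv) /= gdetE; ring.
have a1 : alt f1 = 6.
  have gdn i x (n : nat) : gd i x n%:R = 0 by rewrite -mpolyC_nat gdC.
  rewrite /alt /f1 /minor !add3E !(gdD, gd_opp, gdM, gd_gv, gdn) /=; ring.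
rewrite /Omega sum3_eps !third.
transitivity (k.+1%:R * (k%:R * k.-1%:R * gdet ^+ k.-2 * alt f3 + k%:R * gdet ^+ k.-1 * alt f2
  + gdet ^+ k * alt f1)).
  by rewrite /alt; clear third a1 a2 a3; move: f1 f2 f3 (gdet ^+ k) (gdet ^+ k.-1) (gdet ^+ k.-2) => *; ring.
rewrite a1 a2 a3; case: k {third} => [|[|k]] /=.
- rewrite expr0; ring.
- rewrite expr1; ring.
rewrite !exprS !natrM -(natr1 k.+2) -(natr1 k.+1) -!(natr1 k) ; ring.
Qed.
End Omega.

(** * Cayley's operator on monomials and under translations *)

Lemma mpoly_ring_ind (R : comNzRingType) n (Q : {mpoly R[n]} -> Prop) :
  (forall c, Q c%:MP) -> (forall i, Q 'X_i) -> (forall p q, Q p -> Q q -> Q (p + q)) ->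
  (forall p q, Q p -> Q q -> Q (p * q)) -> forall p, Q p.
Proof.
move=> QC QX QD QM; elim/mpolyind => [|c m p _ _ hp]; first by rewrite -mpolyC0.
apply: (QD) => //; rewrite -mul_mpolyC; apply: (QM) => //; rewrite mpolyXE_id.
elim/big_ind: _ => [|x y hx hy|i _]; [by rewrite -mpolyC1|exact: QM|].
elim: (m i) => [|k IH]; first by rewrite expr0 -mpolyC1.
by rewrite exprS; exact: QM.
Qed.

Lemma det3E (R : comNzRingType) (A : 'M[R]_3) : \det A =
  A 0 0 * A 1 1 * A 2 2 - A 0 0 * A 1 2 * A 2 1 - A 0 1 * A 1 0 * A 2 2
  + A 0 1 * A 1 2 * A 2 0 + A 0 2 * A 1 0 * A 2 1 - A 0 2 * A 1 1 * A 2 0.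
Proof.
pose f i j := A (inord i) (inord j).
have AE i j : A i j = f i j by rewrite /f !inord_val.
rewrite (expand_det_row _ 0) !big_ord_recl big_ord0 /cofactor.
rewrite !(expand_det_row _ 0) !big_ord_recl !big_ord0 /cofactor !det_mx11 !mxE !AE /=.
by rewrite /bump /= ?expr0 ?expr1 ?expr2; ring.
Qed.

Section OmegaFunctional.
Variable F : numFieldType.
Notation P := {mpoly F[3 * 3]}.
Notation gv := (gv F).
Notation gd := (@gd F).
Notation Omega := (@Omega F).
Notation gdet := (gdet F).
Implicit Types (p q : P) (i j a b c : 'I_3).

Definition mproduct (rho : nat -> 'I_3) (s : seq nat) (r : env) : P :=
  \prod_(h <- s) gv (rho h) (r h).

Lemma gd_product i a rho s r : uniq s ->
  gd i a (mproduct rho s r) =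
  \sum_(h <- s | (rho h == i) && (r h == a)) mproduct rho (rem h s) r.
Proof.
rewrite /mproduct; elim: s => [|h s IH] /=; first by rewrite !big_nil gd1.
move=> /andP[hs us]; rewrite !big_cons gdM gd_gv IH //=.
rewrite eqxx [i == _]eq_sym [a == _]eq_sym.
have -> : gv (rho h) (r h) * (\sum_(k <- s | (rho k == i) && (r k == a)) \prod_(l <- rem k s) gv (rho l) (r l))
   = \sum_(k <- s | (rho k == i) && (r k == a)) \prod_(l <- (if h == k then s else h :: rem k s)) gv (rho l) (r l).
  rewrite mulr_sumr big_seq_cond [RHS]big_seq_cond; apply: eq_bigr => k /andP[ks _].
  have /negPf -> : h != k by apply: contraNneq hs => ->.
  by rewrite big_cons.
by case: ifP => _; rewrite ?mul1r ?mul0r ?add0r.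
Qed.

Lemma Omega_product rho s r : uniq s -> Omega (mproduct rho s r) =
  \sum_(h3 <- s | rho h3 == 2) \sum_(h2 <- rem h3 s | rho h2 == 1)
  \sum_(h1 <- rem h2 (rem h3 s) | rho h1 == 0)
    eps F (r h1) (r h2) (r h3) *: mproduct rho (rem h1 (rem h2 (rem h3 s))) r.
Proof.
move=> us; have u3 h3 : uniq (rem h3 s) by exact: rem_uniq.
have u2 h3 h2 : uniq (rem h2 (rem h3 s)) by exact: rem_uniq.
have pick (l : seq nat) i (G : 'I_3 -> nat -> P) :
    \sum_a \sum_(h <- l | (rho h == i) && (r h == a)) G a h = \sum_(h <- l | rho h == i) G (r h) h.
  rewrite (exchange_big_dep (fun h => rho h == i)) /=; last by move=> a h _ /andP[].
  apply: eq_bigr => h /eqP ->; rewrite (bigD1 (r h)) ?eqxx //= big1 ?addr0 //.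
  by move=> a /andP[/eqP ->]; rewrite eqxx.
rewrite /Omega.
transitivity (\sum_a \sum_b \sum_c \sum_(h3 <- s | (rho h3 == 2) && (r h3 == c))
  \sum_(h2 <- rem h3 s | (rho h2 == 1) && (r h2 == b))
  \sum_(h1 <- rem h2 (rem h3 s) | (rho h1 == 0) && (r h1 == a))
    eps F a b c *: mproduct rho (rem h1 (rem h2 (rem h3 s))) r).
  apply: eq_bigr => a _; apply: eq_bigr => b _; apply: eq_bigr => c _.
  rewrite gd_product // !gd_sum scaler_sumr; apply: eq_bigr => h3 _.
  rewrite gd_product // gd_sum scaler_sumr; apply: eq_bigr => h2 _.
  by rewrite gd_product // scaler_sumr.
transitivity (\sum_a \sum_(h3 <- s | rho h3 == 2) \sum_b \sum_(h2 <- rem h3 s | (rho h2 == 1) && (r h2 == b))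
  \sum_(h1 <- rem h2 (rem h3 s) | (rho h1 == 0) && (r h1 == a))
    eps F a b (r h3) *: mproduct rho (rem h1 (rem h2 (rem h3 s))) r).
  apply: eq_bigr => a _; rewrite [RHS]exchange_big; apply: eq_bigr => b _ /=.
  exact: (pick s 2 (fun c h3 => _)).
rewrite exchange_big; apply: eq_bigr => h3 _ /=.
transitivity (\sum_a \sum_(h2 <- rem h3 s | rho h2 == 1)
  \sum_(h1 <- rem h2 (rem h3 s) | (rho h1 == 0) && (r h1 == a))
    eps F a (r h2) (r h3) *: mproduct rho (rem h1 (rem h2 (rem h3 s))) r).
  by apply: eq_bigr => a _; exact: (pick _ 1 (fun b h2 => _)).
rewrite exchange_big; apply: eq_bigr => h2 _ /=.
exact: (pick _ 0 (fun a h1 => _)).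
Qed.

(** The ways of grouping the names in s to brackets with one name in each of
    the rows 0, 1, 2, the row of the name h being rho h. *)
Fixpoint completions N (rho : nat -> 'I_3) (s : seq nat) : seq (seq (nat * nat * nat)) :=
  if N is N'.+1 then
    flatten [seq flatten [seq flatten [seq
        [seq (h1, h2, h3) :: B | B <- completions N' rho (rem h1 (rem h2 (rem h3 s)))]
      | h1 <- rem h2 (rem h3 s) & rho h1 == 0] | h2 <- rem h3 s & rho h2 == 1] | h3 <- s & rho h3 == 2]
  else [:: [::]].

Lemma completions_perm N rho s B : size s = (3 * N)%N -> B \in completions N rho s ->
  perm_eq s (bnames B) /\ size B = N.
Proof.
elim: N s B => [|N IH] s B sz /=.
  by rewrite inE => /eqP ->; move/eqP: sz; rewrite muln0 size_eq0 => /eqP ->.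
move=> /flatten_mapP[h3]; rewrite mem_filter => /andP[_ h3s].
move=> /flatten_mapP[h2]; rewrite mem_filter => /andP[_ h2s].
move=> /flatten_mapP[h1]; rewrite mem_filter => /andP[_ h1s].
move=> /mapP[B' hB' ->]; have [|p sB] := IH _ _ _ hB'.
  by rewrite !size_rem // sz mulnS.
split; last by rewrite /= sB.
have p1 := permP (perm_to_rem h1s); have p2 := permP (perm_to_rem h2s).
have p3 := permP (perm_to_rem h3s).
apply/permP => x; rewrite p3 /= p2 /= p1 /= (permP p) /bnames /=; lia.
Qed.

Lemma iter_OmegaD N : {morph iter N Omega : p q / p + q}.
Proof. by elim: N => [|N IH] p q; rewrite ?iterS ?IH ?OmegaD. Qed.
Lemma iter_OmegaZ N k p : iter N Omega (k *: p) = k *: iter N Omega p.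
Proof. by elim: N => [|N IH] //; rewrite !iterS IH OmegaZ. Qed.
Lemma iter_Omega_sum N (J : Type) (l : seq J) (Q : pred J) (f : J -> P) :
  iter N Omega (\sum_(x <- l | Q x) f x) = \sum_(x <- l | Q x) iter N Omega (f x).
Proof.
apply: (big_morph _ (iter_OmegaD N)).
by have := iter_OmegaZ N 0 0; rewrite !scale0r.
Qed.

(** Cayley's operator pairs the variables of a monomial into brackets in all
    ways that are compatible with the rows. *)
Lemma iter_Omega_product N rho s r : uniq s -> size s = (3 * N)%N ->
  iter N Omega (mproduct rho s r) = \sum_(B <- completions N rho s) (bweight F B r)%:MP.
Proof.
elim: N s => [|N IH] s us sz.
  move/eqP: sz; rewrite muln0 size_eq0 => /eqP -> /=.
  by rewrite big_seq1 /mproduct /bweight !big_nil mpolyC1.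
rewrite iterSr Omega_product // iter_Omega_sum /= big_flatten big_map big_filter.
rewrite big_seq_cond [RHS]big_seq_cond; apply: eq_bigr => h3 /andP[h3s _].
rewrite iter_Omega_sum big_flatten big_map big_filter.
rewrite big_seq_cond [RHS]big_seq_cond; apply: eq_bigr => h2 /andP[h2s _].
rewrite iter_Omega_sum big_flatten big_map big_filter.
rewrite big_seq_cond [RHS]big_seq_cond; apply: eq_bigr => h1 /andP[h1s _].
rewrite iter_OmegaZ IH ?rem_uniq //; last by rewrite !size_rem // sz mulnS.
rewrite big_map scaler_sumr; apply: eq_bigr => B _.
by rewrite bweight_cons mpolyCM mul_mpolyC.
Qed.

(** Only the constant term is kept: nothing is lost for forms of degree 3 N,
    and the result is a linear functional. *)
Definition LOmega N p : F := (iter N Omega p).@[fun=> 0].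

Lemma LOmegaD N p q : LOmega N (p + q) = LOmega N p + LOmega N q.
Proof. by rewrite /LOmega iter_OmegaD mevalD. Qed.
Lemma LOmegaZ N k p : LOmega N (k *: p) = k * LOmega N p.
Proof. by rewrite /LOmega iter_OmegaZ mevalZ. Qed.
Lemma LOmega_sum N (J : Type) (l : seq J) (Q : pred J) (f : J -> P) :
  LOmega N (\sum_(x <- l | Q x) f x) = \sum_(x <- l | Q x) LOmega N (f x).
Proof. by rewrite /LOmega iter_Omega_sum raddf_sum. Qed.

Lemma LOmega_product N rho s r : uniq s -> size s = (3 * N)%N ->
  LOmega N (mproduct rho s r) = \sum_(B <- completions N rho s) bweight F B r.
Proof.
move=> us sz; rewrite /LOmega iter_Omega_product // raddf_sum.
by apply: eq_bigr => B _; exact: mevalC.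
Qed.

Lemma LOmega_det N : LOmega N (gdet ^+ N) != 0.
Proof.
rewrite /LOmega; suff [c c0 ->] : exists2 c : F, c != 0 & iter N Omega (gdet ^+ N) = c%:MP.
  by rewrite mevalC.
elim: N => [|N [c c0 IH]]; first by exists 1; rewrite ?oner_neq0 // expr0 mpolyC1.
exists ((N.+1 * N.+2 * N.+3)%:R * c); first by rewrite mulf_neq0 // pnatr_eq0.
by rewrite iterSr Cayley -mpolyC_nat mul_mpolyC iter_OmegaZ IH -mul_mpolyC -mpolyCM.
Qed.

(** Right translation of the generic matrix by h. *)
Section Translation.
Variable h : 'M[F]_3.
Definition row_col (v : 'I_(3 * 3)) : 'I_3 * 'I_3 :=
  enum_val (cast_ord (esym (mxvec_cast 3 3)) v).
Lemma row_colK i a : row_col (mxvec_index i a) = (i, a).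
Proof. by rewrite /row_col cast_ordK enum_rankK. Qed.
Definition translate p : P := p \mPo
  [tuple let: (i, a) := row_col v in \sum_b h b a *: gv i b | v < 3 * 3].

Lemma translate_gv i a : translate (gv i a) = \sum_b h b a *: gv i b.
Proof. by rewrite /translate comp_mpolyXU -tnth_nth tnth_mktuple row_colK. Qed.
Lemma translateD : {morph translate : p q / p + q}. Proof. exact: comp_mpolyD. Qed.
Lemma translateM : {morph translate : p q / p * q}.
Proof. by move=> p q; rewrite /translate rmorphM. Qed.
Lemma translateC (k : F) : translate k%:MP = k%:MP. Proof. exact: comp_mpolyC. Qed.
Lemma translateZ k p : translate (k *: p) = k *: translate p. Proof. exact: comp_mpolyZ. Qed.
Lemma translate_sum (J : Type) (l : seq J) (Q : pred J) (f : J -> P) :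
  translate (\sum_(x <- l | Q x) f x) = \sum_(x <- l | Q x) translate (f x).
Proof. exact: raddf_sum. Qed.

Lemma gd_translate i a p : gd i a (translate p) = \sum_b h a b *: translate (gd i b p).
Proof.
elim/mpoly_ring_ind: p => [c|v|p q hp hq|p q hp hq].
- by rewrite translateC gdC big1 // => b _; rewrite gdC -mpolyC0 translateC mpolyC0 scaler0.
- case/mxvec_indexP: v => j c; rewrite -/(gv j c) translate_gv gd_sum.
  rewrite (bigD1 a) //= [RHS](bigD1 c) //= !big1 ?addr0; first last.
  + by move=> b nb; rewrite gdZ gd_gv [a == b]eq_sym (negPf nb) andbF scaler0.
  + move=> b nb; rewrite gd_gv (negPf nb) andbF.
    by rewrite -mpolyC0 translateC mpolyC0 scaler0.
  rewrite gdZ !gd_gv !eqxx !andbT -mpolyC_nat translateC. by [].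
- by rewrite translateD gdD hp hq -big_split; apply: eq_bigr => b _; rewrite gdD translateD scalerDr.
- rewrite translateM gdM hp hq mulr_suml mulr_sumr -big_split; apply: eq_bigr => b _ /=.
  by rewrite gdM translateD !translateM scalerDr scalerAl scalerAr.
Qed.

Lemma eps_det a b c : \sum_i \sum_j \sum_k eps F i j k * (h i a * h j b * h k c) = \det h * eps F a b c.
Proof.
have -> := sum3_eps (V := F^o) (fun i j k => h i a * h j b * h k c).
by rewrite det3E; move: a b c; do 3!apply: ord3P; rewrite /eps /=; gen9 h; ring.
Qed.

Let exch3 (V : nmodType) (f : 'I_3 -> 'I_3 -> 'I_3 -> 'I_3 -> V) :
  \sum_i \sum_j \sum_k \sum_a f i j k a = \sum_a \sum_i \sum_j \sum_k f i j k a.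
Proof.
rewrite [RHS]exchange_big; apply: eq_bigr => i _; rewrite [RHS]exchange_big; apply: eq_bigr => j _.
exact: exchange_big.
Qed.

Let rev3 (V : nmodType) (f : 'I_3 -> 'I_3 -> 'I_3 -> V) :
  \sum_a \sum_b \sum_c f a b c = \sum_c \sum_b \sum_a f a b c.
Proof.
rewrite exchange_big [RHS]exchange_big; apply: eq_bigr => b _; exact: exchange_big.
Qed.

(** The chain rule produces a product of three entries of h with a symbol,
    which is the determinant by eps_det. *)
Lemma Omega_translate p : Omega (translate p) = \det h *: translate (Omega p).
Proof.
transitivity (\sum_c \sum_b \sum_a \sum_i \sum_j \sum_k
    (eps F i j k * (h i a * h j b * h k c)) *: translate (gd 0 a (gd 1 b (gd 2 c p)))).
  transitivity (\sum_i \sum_j \sum_k \sum_c \sum_b \sum_a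
    (eps F i j k * (h i a * h j b * h k c)) *: translate (gd 0 a (gd 1 b (gd 2 c p)))).
    apply: eq_bigr => i _; apply: eq_bigr => j _; apply: eq_bigr => k _.
    rewrite gd_translate (gd_sum 1 j) (gd_sum 0 i) scaler_sumr; apply: eq_bigr => c _.
    rewrite (gdZ 1 j) gd_translate (gdZ 0 i) (gd_sum 0 i) !scaler_sumr; apply: eq_bigr => b _.
    rewrite (gdZ 0 i) gd_translate !scaler_sumr; apply: eq_bigr => a _.
    by rewrite !scalerA; congr (_ *: _); ring.
  by rewrite exch3; apply: eq_bigr => c _; rewrite exch3; apply: eq_bigr => b _; rewrite exch3.
rewrite -(rev3 (fun a b c => \sum_i \sum_j \sum_k _ *: _)).
rewrite /Omega translate_sum scaler_sumr; apply: eq_bigr => a _.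
rewrite translate_sum scaler_sumr; apply: eq_bigr => b _.
rewrite translate_sum scaler_sumr; apply: eq_bigr => c _.
rewrite translateZ scalerA -eps_det scaler_suml; apply: eq_bigr => i _.
by rewrite scaler_suml; apply: eq_bigr => j _; rewrite scaler_suml.
Qed.

Lemma LOmega_translate N p : LOmega N (translate p) = \det h ^+ N * LOmega N p.
Proof.
rewrite /LOmega; suff -> : iter N Omega (translate p) = \det h ^+ N *: translate (iter N Omega p).
  rewrite mevalZ /translate comp_mpoly_meval; congr (_ * _); apply: meval_eq => v.
  rewrite tnth_mktuple; case: row_col => i a; rewrite raddf_sum big1 // => b _.
  by rewrite /= mevalZ mevalXU mulr0.
elim: N => [|N IH] /=; first by rewrite scale1r.
by rewrite IH OmegaZ Omega_translate scalerA exprSr.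
Qed.
End Translation.
End OmegaFunctional.

(** * The ideal of the generators *)

Section Morphisms.
Variables (K K' : comNzRingType) (f : {rmorphism K -> K'}).
Implicit Types A B D : 'M[K]_3.

Lemma map_cross A B : map_mx f (cross A B) = cross (map_mx f A) (map_mx f B).
Proof. by apply/matrixP => i j; rewrite !mxE !(rmorphB, rmorphD, rmorphM). Qed.

Lemma map_mx_mul A B : map_mx f (A * B) = map_mx f A * map_mx f B.
Proof. exact: map_mxM. Qed.

Lemma map_theta A B D : theta (map_mx f A) (map_mx f B) (map_mx f D) = f (theta A B D).
Proof. by rewrite /theta -map_cross map_trmx -map_mx_mul -trace_map_mx. Qed.

Lemma map_ev (E : seq (nat * nat * 'M[K]_3)) (B : seq (nat * nat * nat)) :
  ev [seq (x.1, map_mx f x.2) | x <- E] B = f (ev E B).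
Proof.
rewrite /ev (sumN_morph f) /enames -map_comp; apply: eq_sumN => r /=.
rewrite rmorphM /eweight big_map rmorph_prod; congr (_ * _).
  by apply: eq_bigr => x _; rewrite mxE.
rewrite /bweight rmorph_prod; apply: eq_bigr => b _.
by rewrite /eps; do 2?case: ifP => _; rewrite ?rmorphN ?rmorph1 ?rmorph0.
Qed.
End Morphisms.

Lemma cross0 (K : comNzRingType) (A : 'M[K]_3) : cross 0 A = 0.
Proof. by have := crossZl 0 0 A; rewrite !scale0r. Qed.
Lemma theta0 (K : comNzRingType) (A B : 'M[K]_3) : theta 0 A B = 0.
Proof. by rewrite /theta trmx0 mul0r mxtrace0. Qed.

(** cross_cross in the sextic form. When the cubics vanish, so do the products
    of traces, and the sextic form is a multiple of the trace in null_forms. *)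
Lemma trace_sextic (K : comNzRingType) (u v p q : 'M[K]_3) :
  u^T = u -> v^T = v -> p^T = p -> q^T = q ->
  \tr (u * q * v * p) + \tr (u * q * v * p) =
  \tr (q * u) * \tr (p * v) + \tr (q * v) * \tr (p * u) - theta p q (cross u v).
Proof.
move=> hu hv hp hq.
have e : \tr (p * (v * q * u)) = \tr (u * q * v * p).
  by rewrite -mxtrace_tr !trM3 hu hv hp hq !mulrA.
have e' : \tr (p * (u * q * v)) = \tr (u * q * v * p) by rewrite trC3.
rewrite /theta cross_cross hp hq mulrBr mulrDr linearB linearD /= -!scalerAr !mxtraceZ.
rewrite mulrDr linearD /= e e'.
by rewrite opprB addrC addrCA -!addrA; ring.
Qed.

Section GenericForms.
Variable R : realType.
Notation C := R[i].
Notation N := #|{: 'I_4 * 'I_3 * 'I_3}|.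
Notation P := {mpoly C[N]}.

(** The generic symmetric matrices. Only one of the two coordinates of an off-
    diagonal entry is used, which makes the matrix symmetric as a matrix of
    polynomials. *)
Definition gen (k : 'I_4) : 'M[P]_3 := \matrix_(i, j)
  if (i <= j)%N then 'X_(enum_rank (k, i, j)) else 'X_(enum_rank (k, j, i)).

Lemma gen_sym k : (gen k)^T = gen k.
Proof.
apply/matrixP => i j; rewrite !mxE; case: (leqP j i) => [ji|ij]; case: (leqP i j) => // ij'.
- by have -> : i = j by apply: val_inj; apply/eqP; rewrite eqn_leq ij' ji.
- by move: (leq_trans ij (ltnW ij')); rewrite ltnn.
Qed.

Lemma gen_eval (x : copies R 4) k : map_mx (meval (coords x)) (gen k) = x k.
Proof.
apply/matrixP => i j; rewrite !mxE; case: ifP => _; rewrite mevalXU /coords enum_rankK //.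
by rewrite -[in RHS](tr_sym3 (x k)) mxE.
Qed.

Notation T := ('I_4 * 'I_4 * 'I_4 + 'I_4 * 'I_4 * 'I_4 * ('I_4 * 'I_4 * 'I_4))%type.

(** The polarized determinants, and the polarizations of theta at three
    adjugates. *)
Definition generator (K : comNzRingType) (x : 'I_4 -> 'M[K]_3) (t : T) : K :=
  match t with
  | inl (i, j, k) => theta (x i) (x j) (x k)
  | inr (i, j, k, (l, m, n)) =>
      theta (cross (x i) (x j)) (cross (x k) (x l)) (cross (x m) (x n))
  end.

Lemma generator_map (K K' : comNzRingType) (f : {rmorphism K -> K'}) x t :
  generator (fun k => map_mx f (x k)) t = f (generator x t).
Proof.
by case: t => [[[i j] k]|[[[i j] k] [[l m] n]]]; rewrite /= -?map_cross map_theta.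
Qed.

Definition inI (p : P) := exists c : T -> P, p = \sum_t c t * generator gen t.

Lemma inI_lin a u v : inI u -> inI v -> inI (a * u + v).
Proof.
move=> [c ->] [d ->]; exists (fun t => a * c t + d t).
rewrite mulr_sumr -big_split; apply: eq_bigr => t _ /=.
by rewrite mulrA mulrDl.
Qed.
Lemma inI_0 : inI 0.
Proof. by exists (fun=> 0); rewrite big1 // => t _; rewrite mul0r. Qed.
Lemma inI_generator t : inI (generator gen t).
Proof.
exists (fun s => (s == t)%:R); rewrite (bigD1 t) //= eqxx mul1r big1 ?addr0 // => s nst.
by rewrite (negPf nst) mul0r.
Qed.
Lemma inI_1 : ~ inI 1.
Proof.
move=> [c]; move=> /(congr1 (meval (fun=> 0))); rewrite meval1 raddf_sum big1.
  by move/eqP; rewrite oner_eq0.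
move=> t _; rewrite /= mevalM -generator_map.
suff -> : generator (fun k => map_mx (meval (fun=> 0)) (gen k)) t = 0 by rewrite mulr0.
have g0 k : map_mx (meval (fun=> 0)) (gen k) = 0.
  by apply/matrixP => i j; rewrite !mxE; case: ifP => _; rewrite mevalXU.
by case: t => [[[i j] k]|[[[i j] k] [[l m] n]]]; rewrite /generator !g0 ?cross0 theta0.
Qed.

Lemma generic_null_forms (Q : comNzRingType) (pi : {rmorphism P -> Q}) :
  (forall t, pi (generator gen t) = 0) -> null_forms (fun k => map_mx pi (gen k)).
Proof.
move=> hpi; have hg t : generator (fun k => map_mx pi (gen k)) t = 0.
  by rewrite generator_map hpi.
have sym i : (map_mx pi (gen i))^T = map_mx pi (gen i) by rewrite map_trmx gen_sym.
have half : exists h : Q, h + h = 1.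
  exists (pi (2^-1)%:MP); rewrite -rmorphD -mpolyCD.
  have -> : 2^-1 + 2^-1 = 1 :> C by field.
  by rewrite mpolyC1 rmorph1.
have th i j k : theta (map_mx pi (gen i)) (map_mx pi (gen j)) (map_mx pi (gen k)) = 0.
  exact: (hg (inl (i, j, k))).
have third : exists t : Q, t + t + t = 1.
  exists (pi (3^-1)%:MP); rewrite -!rmorphD /=.
  have -> : 3^-1 + 3^-1 + 3^-1 = 1 :> C by field.
  by rewrite mpolyC1 rmorph1.
split=> // i j k l m n.
have cs a b : (cross (map_mx pi (gen a)) (map_mx pi (gen b)))^T =
    cross (map_mx pi (gen a)) (map_mx pi (gen b)) by rewrite trmx_cross !sym.
have tz a b d : \tr (cross (map_mx pi (gen b)) (map_mx pi (gen d)) * map_mx pi (gen a)) = 0.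
  by rewrite trC3; have := th a b d; rewrite /theta sym.
have [h hh] := half; have := trace_sextic (sym i) (sym l) (cs m n) (cs j k).
have hs := hg (inr (m, n, j, (k, i, l))); rewrite /generator in hs; rewrite hs.
rewrite !tz !mul0r addr0 subr0 => e.
by rewrite -[LHS]mul1r -hh mulrDl -mulrDr e mulr0.
Qed.

Definition edges_of (K : comNzRingType) (x : 'I_4 -> 'M[K]_3) (L : seq (nat * nat * 'I_4)) :=
  [seq (e.1, x e.2) | e <- L].

(** graph_eq0 over the quotient by the ideal of the generators. *)
Lemma graph_in_ideal L B : (0 < size B)%N -> cubic (edges_of gen L) B ->
  inI (ev (edges_of gen L) B).
Proof.
move=> sB cu; pose J := Ideal inI_1 inI_0 inI_lin.
have [Q [pi hpi]] := quotient_by_ideal J.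
have nf : null_forms (fun k => map_mx pi (gen k)).
  by apply: generic_null_forms => t; apply/hpi; exact: inI_generator.
apply/hpi; rewrite -map_ev.
have -> : [seq (x.1, map_mx pi x.2) | x <- edges_of gen L] = edges_of (fun k => map_mx pi (gen k)) L.
  by rewrite /edges_of -map_comp.
apply: (graph_eq0 nf sB erefl).
  by move: cu; rewrite /cubic /enames /edges_of -!map_comp.
move=> x /mapP[y _ ->] /=; apply: W_letter; exact: (inS_e (fun k => map_mx pi (gen k))).
Qed.
End GenericForms.

(** * Transforms by the generic matrix *)

Section Monomials.
Variable R : realType.
Notation C := R[i].
Notation N := #|{: 'I_4 * 'I_3 * 'I_3}|.
Notation P := {mpoly C[N]}.
Notation G := {mpoly C[3 * 3]}.
Notation gv := (gv C).
Notation entry := ('I_4 * 'I_3 * 'I_3)%type.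

(** The (i, j) entry of the transform of X by the generic matrix. *)
Definition gx (X : 'M[C]_3) i j : G := \sum_a \sum_b X a b *: (gv i a * gv j b).

(** A monomial is read as a graph: each of its factors is an edge, with two
    half-edges of consecutive names, and the indices of the factor are the
    rows of these names. *)
Fixpoint entry_edges m (l : seq entry) : seq (nat * nat * 'I_4) :=
  if l is x :: l' then (m, m.+1, x.1.1) :: entry_edges m.+2 l' else [::].
Fixpoint rows (l : seq entry) : seq 'I_3 :=
  if l is x :: l' then x.1.2 :: x.2 :: rows l' else [::].

Lemma enames_entry (K : comNzRingType) (x : 'I_4 -> 'M[K]_3) m l :
  enames (edges_of x (entry_edges m l)) = iota m (2 * size l)%N.
Proof.
elim: l m => [|y l IH] m //; rewrite [size _]/= mulnS add2n /= -IH.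
by [].
Qed.

Lemma prod_gx (x : 'I_4 -> 'M[C]_3) rho m l r0 :
  (forall h, rho (m + h)%N = nth 0 (rows l) h) ->
  \prod_(y <- l) gx (x y.1.1) y.1.2 y.2 =
  sumN (iota m (2 * size l)%N) (fun r => eweight (edges_of x (entry_edges m l)) r *:
    mproduct C rho (iota m (2 * size l)%N) r) r0.
Proof.
elim: l m r0 => [|y l IH] m r0 hrho.
  by rewrite big_nil /= /eweight /mproduct !big_nil scale1r.
have hrho' h : rho (m.+2 + h)%N = nth 0 (rows l) h by have := hrho h.+2; rewrite !addnS -!addSn.
have r_0 : rho m = y.1.2 by rewrite -[m in LHS]addn0 hrho.
have r_1 : rho m.+1 = y.2 by rewrite -[m.+1]addn1 hrho.
have e2 : (2 * size (y :: l) = (2 * size l).+2)%N by rewrite /= mulnS add2n.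
rewrite big_cons e2 /= /gx mulr_suml; apply: eq_bigr => a _.
rewrite mulr_suml; apply: eq_bigr => b _.
set r := upd _ _ _; rewrite (IH m.+2 r hrho') mulrC.
pose f z := (x y.1.1 (z m) (z m.+1))%:MP * (gv (rho m) (z m) * gv (rho m.+1) (z m.+1)) : G.
have rm : r m = a by rewrite /r upd_other ?upd_same // neq_ltn ltnSn.
have rm1 : r m.+1 = b by rewrite /r upd_same.
have -> : x y.1.1 a b *: (gv y.1.2 a * gv y.2 b) = f r.
  by rewrite /f rm rm1 r_0 r_1 mul_mpolyC.
rewrite -(@sumN_mulr _ _ _ f).
  apply: eq_sumN => z; rewrite eweight_cons /mproduct !big_cons /f /= -!mul_mpolyC mpolyCM; ring.
move=> n ns z i; rewrite mem_iota in ns; rewrite /f !upd_other //; apply/eqP; lia.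
Qed.

Lemma LOmega_sumN k s (f : env -> G) r :
  LOmega k (sumN s f r) = sumN s (fun z => LOmega k (f z)) r.
Proof. by elim: s r => //= n s IH r; rewrite LOmega_sum; apply: eq_bigr. Qed.

(** In the substituted monomial the columns of the generic matrix are
    summation indices, and the operator joins the variables to brackets in all
    ways that respect the rows. *)
Lemma LOmega_monomial (x : 'I_4 -> 'M[C]_3) n l rho : size l = (3 * n)%N ->
  (forall h, rho h = nth 0 (rows l) h) ->
  LOmega (2 * n)%N (\prod_(y <- l) gx (x y.1.1) y.1.2 y.2) =
  \sum_(B <- completions (2 * n)%N rho (iota 0 (2 * size l)%N)) ev (edges_of x (entry_edges 0 l)) B.
Proof.
move=> sl hrho; rewrite (prod_gx x (rho := rho) (m := 0) (fun=> 0)) // LOmega_sumN.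
rewrite (eq_sumN _ (g := fun r => \sum_(B <- completions (2 * n)%N rho (iota 0 (2 * size l)%N))
   eweight (edges_of x (entry_edges 0 l)) r * bweight C B r)).
  by rewrite sumN_sum; apply: eq_bigr => B _; rewrite /ev enames_entry.
move=> r; rewrite LOmegaZ LOmega_product ?iota_uniq ?mulr_sumr //.
by rewrite size_iota sl; lia.
Qed.

Lemma ev_eval (y : copies R 4) L B :
  (ev (edges_of (@gen R) L) B).@[coords y] = ev (edges_of (fun k => y k : 'M_3) L) B.
Proof.
rewrite -(map_ev (meval (coords y))); congr ev.
by rewrite /edges_of -map_comp; apply: eq_map => e /=; rewrite gen_eval.
Qed.

Lemma monomial_in_ideal n l : (0 < n)%N -> size l = (3 * n)%N ->
  exists q : P, inI q /\ forall y : copies R 4,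
    LOmega (2 * n)%N (\prod_(z <- l) gx (y z.1.1) z.1.2 z.2) = q.@[coords y].
Proof.
move=> n0 sl; pose rho h := nth 0 (rows l) h.
exists (\sum_(B <- completions (2 * n)%N rho (iota 0 (2 * size l)%N)) ev (edges_of (@gen R) (entry_edges 0 l)) B).
split; last first.
  move=> y; rewrite (LOmega_monomial (fun k => y k) sl (rho := rho)) // raddf_sum.
  by apply: eq_bigr => B _; rewrite /= ev_eval.
have sum_in (s : seq (seq (nat * nat * nat))) : {subset s <= completions (2 * n)%N rho (iota 0 (2 * size l)%N)} ->
    inI (\sum_(B <- s) ev (edges_of (@gen R) (entry_edges 0 l)) B).
  elim: s => [|B s IH] hs; first by rewrite big_nil; exact: inI_0.
  rewrite big_cons -[ev _ _]mul1r; apply: inI_lin; last by apply: IH => B' h; apply: hs; rewrite inE h orbT.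
  have [|p sB] := completions_perm _ (hs _ (mem_head _ _)).
    by rewrite size_iota sl; lia.
  apply: graph_in_ideal; first by rewrite sB; lia.
  by rewrite /cubic enames_entry iota_uniq.
exact: sum_in.
Qed.

(** The transform of a polynomial by the generic matrix. *)
Definition subst (y : copies R 4) (p : P) : G :=
  mmap (@mpolyC _ C) (fun v => let: (k, i, j) := enum_val v in gx (y k) i j) p.

Lemma substD y : {morph subst y : p q / p + q}. Proof. by move=> p q; rewrite /subst mmapD. Qed.
Lemma substM y : {morph subst y : p q / p * q}. Proof. by move=> p q; rewrite /subst rmorphM. Qed.
Lemma substC y c : subst y c%:MP = c%:MP. Proof. exact: mmapC. Qed.
Lemma substZ y c p : subst y (c *: p) = c *: subst y p.
Proof. by rewrite -mul_mpolyC substM substC mul_mpolyC. Qed.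
Lemma subst_sum y (J : Type) (l : seq J) (f : J -> P) :
  subst y (\sum_(x <- l) f x) = \sum_(x <- l) subst y (f x).
Proof. by rewrite /subst raddf_sum. Qed.
Lemma substX y v : subst y 'X_v = let: (k, i, j) := enum_val v in gx (y k) i j.
Proof. by rewrite /subst mmapX mmap1U. Qed.

Definition entries (m : 'X_{1..N}) : seq entry :=
  flatten [seq nseq (m v) (enum_val v) | v : 'I_N].

Lemma size_entries m : size (entries m) = mdeg m.
Proof.
rewrite /entries size_flatten /shape -map_comp mdegE sumnE big_map.
by rewrite big_enum /=; apply: eq_bigr => v _; rewrite size_nseq.
Qed.

Lemma subst_monomial y m :
  subst y 'X_[m] = \prod_(z <- entries m) gx (y z.1.1) z.1.2 z.2.
Proof.
rewrite /subst mmapX /mmap1 /entries big_flatten big_map big_enum /=.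
apply: eq_bigr => v _; rewrite big_nseq -Monoid.iteropE /=.
case: (enum_val v) => [[k i] j] /=.
by elim: (m v) => // d IH; rewrite exprS IH.
Qed.

Lemma subst_in_ideal n (p : P) : (0 < n)%N -> (forall m, m \in msupp p -> mdeg m = (3 * n)%N) ->
  exists q : P, inI q /\ forall y, LOmega (2 * n)%N (subst y p) = q.@[coords y].
Proof.
move=> n0 hp; rewrite [p]mpolyE.
have : {subset msupp p <= msupp p} by [].
elim: {1 3}(msupp p) => [|m s IH] hs.
  exists 0; split=> [|y]; first exact: inI_0.
  rewrite big_nil meval0 -(mpolyC0 _ C) substC.
  by have := LOmegaZ (2 * n)%N 0 (0 : G); rewrite scale0r mul0r -mpolyC0.
have [|q [hq eq]] := IH; first by move=> m' h; apply: hs; rewrite inE h orbT.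
have [q' [hq' eq']] := @monomial_in_ideal n (entries m) n0
  (etrans (size_entries m) (hp m (hs _ (mem_head _ _)))).
exists (p@_m *: q' + q); split=> [|y].
  by rewrite -mul_mpolyC; exact: inI_lin.
rewrite [RHS]mevalD mevalZ -eq -eq' big_cons substD LOmegaD substZ LOmegaZ subst_monomial.
by [].

Qed.
End Monomials.

(** * Points, scalars and degrees *)

Section Points.
Variable R : realType.
Notation C := R[i].
Notation N := #|{: 'I_4 * 'I_3 * 'I_3}|.
Notation P := {mpoly C[N]}.
Notation G := {mpoly C[3 * 3]}.
Notation gv := (gv C).
Notation gdet := (gdet C).
Implicit Types (x y : copies R 4) (h : 'M[C]_3) (p q : P).

Definition pt h (v : 'I_(3 * 3)) : C := let: (i, a) := row_col v in h i a.

Lemma pt_gv h i a : (gv i a).@[pt h] = h i a.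
Proof. by rewrite -[gv i a]/'X_(mxvec_index i a) mevalXU /pt row_colK. Qed.

Lemma eq_at_points (p q : G) : (forall h, p.@[pt h] = q.@[pt h]) -> p = q.
Proof.
move=> e; apply/eqP; rewrite -subr_eq0; apply/eqP/mpoly_eq0 => v.
have ev r : r.@[v] = r.@[pt (\matrix_(i, a) v (mxvec_index i a))].
  by apply: meval_eq => w; case/mxvec_indexP: w => i a; rewrite /pt row_colK mxE.
by rewrite ev mevalB e subrr.
Qed.

Lemma gdet_pt h : gdet.@[pt h] = \det h.
Proof.
have -> : \det h = \sum_a \sum_b \sum_c eps C a b c * (h 0 a * h 1 b * h 2 c).
  by rewrite det3E; symmetry; exact: (sum3_eps (V := C^o) (fun a b c => h 0 a * h 1 b * h 2 c)).
rewrite raddf_sum; apply: eq_bigr => a _; rewrite /= raddf_sum; apply: eq_bigr => b _.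
rewrite /= raddf_sum; apply: eq_bigr => c _; rewrite /= mevalZ; congr (_ * _).
have := pt_gv h; move: gv => f E; by rewrite 2!mevalM !E.
Qed.

Lemma gdet_neq0 : gdet != 0.
Proof.
apply/eqP => /(congr1 (meval (pt 1))); rewrite gdet_pt meval0 det1.
by move/eqP; rewrite oner_eq0.
Qed.

Definition acts h x : copies R 4 := [ffun k => sl_act h (x k)].

Lemma gx_pt h (X : 'M[C]_3) i j : (gx X i j).@[pt h] = (h *m X *m h^T) i j.
Proof.
rewrite /gx raddf_sum mxE; under [RHS]eq_bigr do rewrite mxE mulr_suml.
rewrite [RHS]exchange_big; apply: eq_bigr => a _; rewrite /= raddf_sum; apply: eq_bigr => b _ /=.
by rewrite mevalZ mevalM !pt_gv !mxE; ring.
Qed.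

Lemma subst_pt h x p : (subst x p).@[pt h] = p.@[coords (acts h x)].
Proof.
elim/mpoly_ring_ind: p => [c|v|p q hp hq|p q hp hq].
- by rewrite substC !mevalC.
- rewrite substX mevalXU /coords; case: (enum_val v) => [[k i] j].
  by rewrite gx_pt /acts ffunE.
- rewrite substD; apply: etrans (mevalD _ _ _) _; apply: etrans (esym (mevalD _ _ _)).
  exact: congr2 hp hq.
- rewrite substM; apply: etrans (mevalM _ _ _) _; apply: etrans (esym (mevalM _ _ _)).
  exact: congr2 hp hq.
Qed.

Lemma acts_mul h k x : acts h (acts k x) = acts (h *m k) x.
Proof.
apply/ffunP => m; rewrite !ffunE; apply: val_inj => /=.
by rewrite trmx_mul !mulmxA.
Qed.

Lemma translate_pt h k (p : G) : (translate h p).@[pt k] = p.@[pt (k *m h)].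
Proof.
elim/mpoly_ring_ind: p => [c|v|p q hp hq|p q hp hq].
- by rewrite translateC !mevalC.
- case/mxvec_indexP: v => i a; rewrite -/(gv i a) translate_gv pt_gv raddf_sum mxE.
  by apply: eq_bigr => b _; rewrite /= mevalZ pt_gv mulrC.
- rewrite translateD; apply: etrans (mevalD _ _ _) _; apply: etrans (esym (mevalD _ _ _)).
  exact: congr2 hp hq.
- rewrite translateM; apply: etrans (mevalM _ _ _) _; apply: etrans (esym (mevalM _ _ _)).
  exact: congr2 hp hq.
Qed.

Lemma subst_acts h x p : subst (acts h x) p = translate h (subst x p).
Proof. by apply: eq_at_points => k; rewrite translate_pt !subst_pt acts_mul. Qed.

Lemma translate_gdet h : translate h gdet = \det h *: gdet.
Proof. by apply: eq_at_points => k; rewrite translate_pt mevalZ !gdet_pt det_mulmx mulrC. Qed.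

Definition scale (c : C) x : copies R 4 := [ffun k => c *: x k].

Lemma acts_scalar (c : C) x : acts c%:M x = scale (c ^+ 2) x.
Proof.
apply/ffunP => k; rewrite !ffunE; apply: val_inj.
by rewrite /= tr_scalar_mx mul_mx_scalar mul_scalar_mx scalerA.
Qed.

Lemma coords_scale c x v : coords (scale c x) v = c * coords x v.
Proof. by rewrite /coords; case: (enum_val v) => [[k i] j]; rewrite ffunE mxE. Qed.

Definition of_degree d (F : copies R 4 -> C) := forall c x, F (scale c x) = c ^+ d * F x.
Definition sl_inv (F : copies R 4 -> C) := forall h, \det h = 1 -> forall x, F (acts h x) = F x.

(** Up to a scalar, a cube root of its determinant, an invertible matrix has
    determinant 1. *)
Lemma gl_inv n F h x : sl_inv F -> of_degree (3 * n) F -> \det h != 0 ->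
  F (acts h x) = \det h ^+ (2 * n) * F x.
Proof.
move=> hF hd h0; pose c := 3.-root (\det h).
have c3 : c ^+ 3 = \det h by rewrite rootCK.
have c0 : c != 0 by apply: contra h0 => /eqP c0; rewrite -c3 c0 expr0n.
have -> : h = c%:M *m (c^-1 *: h) by rewrite mul_scalar_mx scalerA mulfV // scale1r.
rewrite -acts_mul acts_scalar hd hF.
  by rewrite det_mulmx det_scalar c3 detZ exprVn c3 mulVf // mulr1 -c3 -!exprM; congr (_ ^+ _ * _); lia.
by rewrite detZ exprVn c3 mulVf.
Qed.

(** The scalar matrices of determinant 1 are the cube roots of unity w, and w
    acts by the factor w^2 on the matrices. *)
Lemma homog_neq3 d F : sl_inv F -> of_degree d F -> ~~ (3 %| d)%N -> forall x, F x = 0.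
Proof.
move=> hF hd d3 x.
have [w hw] : exists w : C, w ^+ 2 + w + 1 = 0.
  have [w /rootP hw] : exists w : C, root ('X^2 + 'X + 1 : {poly C}) w.
    apply/closed_rootP; rewrite -addrA size_polyDl ?size_polyXn //.
    by rewrite -[X in 'X + X]polyC1 size_XaddC.
  by exists w; move: hw; rewrite !hornerE.
have w3 : w ^+ 3 = 1 by apply/eqP; rewrite -subr_eq0; apply/eqP; rewrite -[RHS](mulr0 (w - 1)) -hw; ring.
have n3 : (3 : C) != 0 by rewrite pnatr_eq0.
have w1 : w != 1 by apply: contra n3 => /eqP e; rewrite -hw e; apply/eqP; ring.
have w2 : w ^+ 2 != 1.
  apply: contra n3 => /eqP e; move: hw; rewrite e => h; have ew : w = - 2 by lc (1 ⊡ h).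
  by apply/eqP; move: e; rewrite ew => e; lc (1 ⊡ e).
have e := hF w%:M _ x; rewrite det_scalar w3 acts_scalar hd in e.
have {}e := e erefl; apply/eqP; apply: contraT => Fx.
have : w ^+ (2 * d) = 1 by rewrite exprM; apply: (mulIf Fx); rewrite mul1r.
have w3n k : w ^+ (3 * k) = 1 by rewrite exprM w3 expr1n.
rewrite (divn_eq d 3) mulnDr exprD mulnCA [(_ * 3)%N]mulnC mulnCA w3n mul1r.
have : (d %% 3 < 3)%N by rewrite ltn_mod.
move: d3; rewrite /dvdn; case: (d %% 3)%N => [|[|[|]]] // _ _ e1.
  by rewrite e1 eqxx in w2.
by move: e1 w1; rewrite (_ : 2 * 2 = 3 + 1)%N // exprD w3 mul1r expr1 => ->; rewrite eqxx.
Qed.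

Lemma meval_homog d p c x : p \is d.-homog -> p.@[coords (scale c x)] = c ^+ d * p.@[coords x].
Proof.
move/dhomogP => hp; rewrite !mevalE mulr_sumr big_seq [RHS]big_seq; apply: eq_bigr => m /hp hm.
rewrite mulrCA; congr (_ * _); under eq_bigr do rewrite coords_scale exprMn.
have <- : (\sum_i m i)%N = d by rewrite -(mdegE m); exact: hm.
by rewrite big_split /= prodrXr.
Qed.

Lemma eval_scale p k c x : (msize p <= k)%N ->
  p.@[coords (scale c x)] = \sum_(d < k) c ^+ d * (pihomog mdeg d p).@[coords x].
Proof.
move=> hk; have {1}-> : p = \sum_(d < k) pihomog mdeg d p.
  by apply: pihomog_partitionE; rewrite mmeasureE.
rewrite raddf_sum; apply: eq_bigr => d _.
by apply: meval_homog; exact: pihomogP.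
Qed.

Lemma of_degree_part d (F : copies R 4 -> C) p : (forall x, F x = p.@[coords x]) ->
  of_degree d F -> forall x, F x = (pihomog mdeg d p).@[coords x].
Proof.
move=> hF hd x; pose k := maxn (msize p) d.+1; have dk : (d < k)%N by rewrite leq_maxr.
have q0 : \sum_(e < k) (pihomog mdeg e p).@[coords x] *: 'X^e - F x *: 'X^d = 0 :> {poly C}.
  apply: poly_eq0_nz => t _; rewrite hornerD hornerN hornerZ hornerXn horner_sum.
  rewrite [F x * _]mulrC -hd hF (@eval_scale _ k) ?leq_maxl // -sumrB big1 // => e _.
  by rewrite hornerZ hornerXn mulrC subrr.
have := congr1 (fun q : {poly C} => q`_d) q0.
rewrite coef0 coefB coefZ coefXn eqxx mulr1 => /eqP; rewrite subr_eq0 => /eqP <-.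
rewrite coef_sum (bigD1 (Ordinal dk)) //= coefZ coefXn eqxx mulr1 big1 ?addr0 // => e ne.
rewrite coefZ coefXn; case: eqP => [ed|]; last by rewrite mulr0.
by case/eqP: ne; apply: val_inj.
Qed.

(** Both sides are polynomials in the scalar, so that the powers of the scalar
    can be compared. *)
Lemma scale_eq (F : copies R 4 -> C) p a b : (forall x, F x = p.@[coords x]) ->
  (forall c x, c ^+ a * F x = c ^+ b * F (scale c x)) ->
  (forall x, F x = 0) \/ (b <= a)%N /\ of_degree (a - b) F.
Proof.
move=> hF hs; case: (leqP b a) => ba; [right; split=> // | left].
  (* the powers of a nonzero scalar cancel, and then the scalar may be 0 *)
  move=> c x; pose k := msize p.
  have q0 : \sum_(d < k) (pihomog mdeg d p).@[coords x] *: 'X^d - F x *: 'X^(a - b) = 0 :> {poly C}.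
    apply: poly_eq0_nz => t t0; rewrite hornerD hornerN hornerZ hornerXn horner_sum.
    have e : t ^+ (a - b) * F x = F (scale t x).
      have tb : t ^+ b != 0 by rewrite expf_neq0.
      by apply: (mulfI tb); rewrite -hs mulrA -exprD subnKC.
    rewrite [F x * _]mulrC e hF (@eval_scale _ k) // -sumrB big1 // => d _.
    by rewrite hornerZ hornerXn mulrC subrr.
  have := congr1 (fun q : {poly C} => q.[c]) q0.
  rewrite horner0 hornerD hornerN hornerZ hornerXn horner_sum => /eqP.
  rewrite subr_eq0 mulrC => /eqP <-; rewrite hF (@eval_scale _ k) //.
  by apply: eq_bigr => d _; rewrite hornerZ hornerXn mulrC.
move=> x; pose k := msize p.
have q0 : \sum_(d < k) (pihomog mdeg d p).@[coords x] *: 'X^(b + d) - F x *: 'X^a = 0 :> {poly C}.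
  apply: poly_eq0_nz => t _; rewrite hornerD hornerN hornerZ hornerXn horner_sum.
  rewrite [F x * _]mulrC hs (hF (scale _ _)) (@eval_scale _ k) // mulr_sumr -sumrB big1 // => d _.
  by rewrite hornerZ hornerXn exprD; ring.
have := congr1 (fun q : {poly C} => q`_a) q0.
rewrite coef0 coefB coefZ coefXn eqxx mulr1 => /eqP; rewrite subr_eq0 => /eqP <-.
rewrite coef_sum big1 // => d _; rewrite coefZ coefXn; case: eqP => [e|]; last by rewrite mulr0.
by move: ba; rewrite e ltnNge leq_addr.
Qed.
End Points.

(** * Hilbert's argument *)

Section ThetaInvariance.
Variable K : comUnitRingType.
Implicit Types A B D g : 'M[K]_3.

Lemma theta_det A B D : theta A B D = \det (A + B + D) - \det (A + B) - \det (A + D)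
  - \det (B + D) + \det A + \det B + \det D.
Proof.
rewrite !det3E /theta !mx3E.
by gen9 A; gen9 B; gen9 D; ring.
Qed.

Lemma theta_act g A B D : \det g = 1 ->
  theta (g * A * g^T) (g * B * g^T) (g * D * g^T) = theta A B D.
Proof.
move=> hg; have dt X : \det (g * X * g^T) = \det X.
  by rewrite !det_mulmx det_tr hg mul1r mulr1.
by rewrite !theta_det -!mulrDl -!mulrDr !dt.
Qed.

Lemma trace_ext A B : (forall X, \tr (X^T * A) = \tr (X^T * B)) -> A = B.
Proof.
move=> h; apply/matrixP => i j; have := h (delta_mx i j).
have tr_delta Y : \tr ((delta_mx i j)^T * Y) = Y i j.
  rewrite trmx_delta /mxtrace (bigD1 j) //= big1 ?addr0.
    rewrite mxE (bigD1 i) //= mxE !eqxx mul1r big1 ?addr0 // => k nk.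
    by rewrite mxE eqxx (negPf nk) mul0r.
  move=> k nk; rewrite mxE big1 // => l _; by rewrite mxE (negPf nk) mul0r.
by rewrite !tr_delta.
Qed.

(** The trace form is nondegenerate, so the invariance of the trilinear form
    determines the transform of a cross product. *)
Lemma cross_act g : \det g = 1 -> exists k, \det k = 1 /\
  forall A B, cross (g * A * g^T) (g * B * g^T) = k * cross A B * k^T.
Proof.
move=> hg; have ug : g \in unitmx by rewrite unitmxE hg unitr1.
have ugt : g^T \in unitmx by rewrite unitmx_tr.
exists (invmx g)^T; split; first by rewrite det_tr det_inv hg invr1.
move=> A B; have e : g^T * cross (g * A * g^T) (g * B * g^T) * g = cross A B.
  apply: trace_ext => X; rewrite -[RHS]theta_crossE -(theta_act X A B hg) theta_crossE.
  by rewrite !trM3 trmxK -[in RHS]mulrA [RHS]trC3 !mulrA.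
rewrite -e trmxK trmx_inv; move: (cross (g * A * g^T) _) => Y.
change (Y = invmx g^T *m (g^T *m Y *m g) *m invmx g).
by rewrite !mulmxA mulVmx // mul1mx -mulmxA mulmxV // mulmx1.
Qed.
End ThetaInvariance.

Section Hilbert.
Variable R : realType.
Notation C := R[i].
Notation N := #|{: 'I_4 * 'I_3 * 'I_3}|.
Notation P := {mpoly C[N]}.
Notation G := {mpoly C[3 * 3]}.
Notation gv := (gv C).
Notation gdet := (gdet C).
Notation T := ('I_4 * 'I_4 * 'I_4 + 'I_4 * 'I_4 * 'I_4 * ('I_4 * 'I_4 * 'I_4))%type.
Implicit Types (x y : copies R 4) (h : 'M[C]_3) (p q : P).

Definition gfun (t : T) x : C := generator (fun k => x k : 'M[C]_3) t.
Definition gsize (t : T) : nat := if t is inl _ then 1 else 2.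

Lemma gfun_eval t x : gfun t x = (generator (@gen R) t).@[coords x].
Proof.
rewrite -(generator_map (meval (coords x))) /gfun; congr generator.
by apply/funext => k; rewrite gen_eval.
Qed.

Lemma gfun_inv t : sl_inv (gfun t).
Proof.
move=> h hh x; rewrite /gfun.
have ex k : (acts h x k : 'M[C]_3) = h * x k * h^T by rewrite ffunE.
have [k [hk ck]] := cross_act hh.
case: t => [[[i j] l]|[[[i j] l] [[m n] s]]]; rewrite /generator !ex ?ck; exact: theta_act.
Qed.

Lemma gfun_degree t : of_degree (3 * gsize t) (gfun t).
Proof.
move=> c x; rewrite /gfun; have ex k : (scale c x k : 'M[C]_3) = c *: (x k : 'M[C]_3) by rewrite ffunE.
case: t => [[[i j] l]|[[[i j] l] [[m n] s]]]; rewrite /generator !ex /gsize.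
  by rewrite thetaZl thetaZm thetaZr; ring.
rewrite !(crossZl, crossZr) !(thetaZl, thetaZm, thetaZr); ring.
Qed.

(** Both sides agree where the determinant does not vanish, hence after
    multiplication by the determinant. *)
Lemma subst_invariant n (F : copies R 4 -> C) p x : (forall y, F y = p.@[coords y]) ->
  sl_inv F -> of_degree (3 * n) F -> subst x p = F x *: gdet ^+ (2 * n).
Proof.
move=> hp hF hd; apply/eqP; rewrite -subr_eq0; apply/eqP.
have : gdet * (subst x p - F x *: gdet ^+ (2 * n)) == 0.
  apply/eqP; apply: eq_at_points => h; rewrite meval0 mevalM gdet_pt.
  case: (eqVneq (\det h) 0) => [->|h0]; first by rewrite mul0r.
  rewrite mevalB subst_pt -hp (gl_inv x hF hd h0) mevalZ rmorphXn /= gdet_pt.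
  by rewrite [F x * _]mulrC subrr mulr0.
by rewrite mulf_eq0 (negPf (gdet_neq0 R)) => /eqP.
Qed.

Lemma pf_const (c : C) : polynomial_function (fun _ : copies R 4 => c).
Proof. by exists c%:MP => x; rewrite mevalC. Qed.
Lemma pf_add (F H : copies R 4 -> C) : polynomial_function F -> polynomial_function H ->
  polynomial_function (fun x => F x + H x).
Proof. by move=> [p hp] [q hq]; exists (p + q) => x; rewrite hp hq; exact: esym (mevalD _ _ _). Qed.
Lemma pf_mul (F H : copies R 4 -> C) : polynomial_function F -> polynomial_function H ->
  polynomial_function (fun x => F x * H x).
Proof. by move=> [p hp] [q hq]; exists (p * q) => x; rewrite hp hq; exact: esym (mevalM _ _ _). Qed.
Lemma pf_coord k i j : polynomial_function (fun x : copies R 4 => (x k : 'M[C]_3) i j).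
Proof. by exists 'X_(enum_rank (k, i, j)) => x; rewrite mevalXU /coords enum_rankK. Qed.
Lemma pf_sum (J : Type) (l : seq J) (f : J -> copies R 4 -> C) :
  (forall j, polynomial_function (f j)) -> polynomial_function (fun x => \sum_(j <- l) f j x).
Proof.
move=> h; elim: l => [|j l [p hp]].
  by exists 0 => x; rewrite big_nil meval0.
have [q hq] := pf_add (h j) (ex_intro _ p hp : polynomial_function _).
by exists q => x; rewrite big_cons -hq.
Qed.

(** The functional is applied to the coefficients of a polynomial in the
    entries of x, and every monomial of q contributes such a polynomial with
    scalar coefficients. *)
Lemma LOmega_pf M (D : G) q : polynomial_function (fun x => LOmega M (D * subst x q)).
Proof.
have ext (F H : copies R 4 -> C) : (forall x, H x = F x) -> polynomial_function F -> polynomial_function H.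
  by move=> e [p hp]; exists p => x; rewrite e.
have entries_pf (l : seq ('I_4 * 'I_3 * 'I_3)) (D' : G) :
    polynomial_function (fun x : copies R 4 => LOmega M (D' * \prod_(z <- l) gx (x z.1.1) z.1.2 z.2)).
  elim: l D' => [|[[k i] j] l IH] D'.
    by apply: ext (pf_const (LOmega M D')) => x; rewrite big_nil mulr1.
  apply: ext (pf_sum (index_enum _) (fun a => pf_sum (index_enum _) (fun b =>
     pf_mul (pf_coord k a b) (IH (D' * (gv i a * gv j b)))))) => x.
  rewrite big_cons mulrA /gx mulr_sumr mulr_suml LOmega_sum; apply: eq_bigr => a _.
  rewrite mulr_sumr mulr_suml LOmega_sum; apply: eq_bigr => b _.
  by rewrite -scalerAr -scalerAl LOmegaZ.
elim/mpolyind: q => [|c m q _ _ IH].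
  by apply: ext (pf_const (LOmega M 0)) => x; rewrite -mpolyC0 substC mpolyC0 mulr0.
apply: ext (pf_add (pf_mul (pf_const c) (entries_pf (entries m) D)) IH) => x.
by rewrite substD mulrDr LOmegaD substZ -scalerAr LOmegaZ subst_monomial.
Qed.

(** Acting on x translates the generic matrix, and Cayley operators are
    invariant under translations of determinant 1. *)
Lemma LOmega_coef_inv M w q : sl_inv (fun x => LOmega M (gdet ^+ w * subst x q)).
Proof.
move=> h hh x; have e : gdet ^+ w * subst (acts h x) q = translate h (gdet ^+ w * subst x q).
  rewrite translateM subst_acts; congr (_ * _).
  have tX k : translate h (gdet ^+ k) = translate h gdet ^+ k by rewrite /translate rmorphXn.
  by rewrite tX translate_gdet hh scale1r.
apply: etrans (congr1 (LOmega M) e) _; apply: etrans (LOmega_translate _ _ _) _.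
by rewrite hh expr1n mul1r.
Qed.

Lemma LOmega_coef_scale n m q c x :
  c ^+ (3 * n) * LOmega (2 * n) (gdet ^+ (2 * m) * subst x q) =
  c ^+ (3 * m) * LOmega (2 * n) (gdet ^+ (2 * m) * subst (scale c x) q).
Proof.
pose b := sqrtC c; have bc : b ^+ 2 = c by rewrite sqrtCK.
have := LOmega_translate (b%:M) (2 * n) (gdet ^+ (2 * m) * subst x q).
have tX k : translate b%:M (gdet ^+ k) = translate b%:M gdet ^+ k by rewrite /translate rmorphXn.
rewrite translateM -subst_acts acts_scalar bc tX translate_gdet det_scalar exprZn -scalerAl LOmegaZ.
rewrite -!exprM => e.
have e1 k : c ^+ (3 * k) = b ^+ (3 * (2 * k)) by rewrite -bc -exprM; congr (_ ^+ _); lia.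
by rewrite !e1; exact: esym e.
Qed.

Section Generation.
Variable S : set (copies R 4 -> C).
Hypothesis S_alg : subalgebra S.
Hypothesis S_gen : forall t, S (gfun t).

Lemma subalgebra_sum (J : Type) (l : seq J) (f : J -> copies R 4 -> C) :
  (forall j, S (f j)) -> S (fun x => \sum_(j <- l) f j x).
Proof.
case: S_alg => Sc Sa _ h; elim: l => [|j l IH].
  rewrite (_ : (fun=> _) = fun=> 0); first exact: Sc.
  by apply/funext => x; rewrite big_nil.
rewrite (_ : (fun=> _) = f j \+ (fun x => \sum_(j <- l) f j x)); first exact: Sa.
by apply/funext => x; rewrite big_cons.
Qed.

(** Hilbert's argument: Cayley's operator replaces the coefficients of an
    invariant in the ideal of the generators by invariants of lower degree. *)
Lemma graded_generation n (F : copies R 4 -> C) : polynomial_function F -> sl_inv F ->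
  of_degree (3 * n) F -> S F.
Proof.
elim/ltn_ind: n F => n IH F [p hp] hF hd; have [Sc Sa Sm] := S_alg.
case: (posnP n) => [n0|n0].
  rewrite (_ : F = fun=> F (scale 0 0)); first exact: Sc.
  apply/funext => x; have := hd 0 x; rewrite n0 muln0 expr0 mul1r => <-.
  by congr F; apply/ffunP => k; rewrite !ffunE !scale0r.
pose c := LOmega (2 * n) (gdet ^+ (2 * n)).
have c0 : c != 0 := LOmega_det C (2 * n).
pose ph := pihomog mdeg (3 * n) p.
have hph := of_degree_part hp hd.
have [q [[d hq] eq]] : exists q : P, inI q /\ forall y, LOmega (2 * n) (subst y ph) = q.@[coords y].
  by apply: subst_in_ideal => // m; exact: (dhomogP _ _ _ (pihomogP _ _ _)).
pose p' := \sum_t (c^-1 *: d t) * generator (@gen R) t.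
have hp' x : F x = p'.@[coords x].
  have := eq x; rewrite (subst_invariant x hph hF hd) LOmegaZ -/c => e.
  rewrite -[LHS](mulfK c0) e hq /p' mulrC -mevalZ scaler_sumr; congr (_.@[_]).
  by apply: eq_bigr => t _; rewrite scalerAl.
have main : F = fun x => \sum_t gfun t x *
    (c^-1 * LOmega (2 * n) (gdet ^+ (2 * gsize t) * subst x (c^-1 *: d t))).
  apply/funext => x; apply: (mulIf c0); rewrite /c -LOmegaZ -(subst_invariant x hp' hF hd).
  rewrite /p' subst_sum LOmega_sum mulr_suml; apply: eq_bigr => t _.
  rewrite substM (subst_invariant x (gfun_eval t) (gfun_inv t) (gfun_degree t)).
  rewrite -scalerAr LOmegaZ [subst _ _ * _]mulrC -/c -!mulrA; congr (_ * _).
  by rewrite mulrCA mulVf // mulr1.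
rewrite main; apply: subalgebra_sum => t.
apply: (Sm (gfun t)) => //; apply: (Sm (fun=> c^-1)); first exact: Sc.
set H := fun x => LOmega _ _.
have [r hr] : polynomial_function H by exact: LOmega_pf.
have [H0|[le3 hH]] := scale_eq hr (LOmega_coef_scale n (gsize t) (c^-1 *: d t)).
  by rewrite (_ : H = fun=> 0) //; apply/funext.
apply: (IH (n - gsize t)%N).
- by case: (t); rewrite /gsize; lia.
- by exists r.
- exact: LOmega_coef_inv.
- by rewrite mulnBr.
Qed.

(** The homogeneous components of an invariant are invariants, and they vanish
    in the degrees that are not divisible by 3. *)
Theorem generation (F : copies R 4 -> C) : polynomial_function F -> sl_inv F -> S F.
Proof.
move=> [p hp] hF; pose Fd d x := (pihomog mdeg d p).@[coords x].
have FdE d : S (Fd d).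
  have pf : polynomial_function (Fd d) by exists (pihomog mdeg d p).
  have deg : of_degree d (Fd d) by move=> c x; apply: meval_homog; exact: pihomogP.
  have inv : sl_inv (Fd d).
    move=> h hh x; pose k := maxn (msize p) d.+1; have dk : (d < k)%N by rewrite leq_maxr.
    have q0 : \sum_(e < k) (Fd e (acts h x) - Fd e x) *: 'X^e = 0 :> {poly C}.
      apply: poly_eq0_nz => t _; rewrite horner_sum.
      transitivity (F (scale t (acts h x)) - F (scale t x)).
        rewrite !hp !(@eval_scale _ _ k) ?leq_maxl // -sumrB; apply: eq_bigr => e _.
        by rewrite hornerZ hornerXn /Fd; ring.
      have -> : scale t (acts h x) = acts h (scale t x).
        apply/ffunP => m; rewrite !ffunE; apply: val_inj => /=.
        by rewrite -scalemxAr -scalemxAl.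
      by rewrite hF // subrr.
    have := congr1 (fun q : {poly C} => q`_d) q0.
    rewrite coef0 coef_sum (bigD1 (Ordinal dk)) //= coefZ coefXn eqxx mulr1 big1 ?addr0.
      by move/eqP; rewrite subr_eq0 => /eqP.
    move=> e ne; rewrite coefZ coefXn; case: eqP => [ed|]; last by rewrite mulr0.
    by case/eqP: ne; apply: val_inj.
  case: (boolP (3 %| d)%N) => [d3|d3].
    apply: (@graded_generation (d %/ 3)) => //.
    by rewrite mulnC divnK.
  have [Sc _ _] := S_alg; rewrite (_ : Fd d = fun=> 0); first exact: Sc.
  by apply/funext => x; exact: (homog_neq3 inv deg d3).
rewrite (_ : F = fun x => \sum_(d < msize p) Fd d x); first exact: subalgebra_sum.
apply/funext => x; rewrite hp {1}(_ : p = \sum_(d < msize p) pihomog mdeg d p) ?raddf_sum //.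
by apply: pihomog_partitionE; rewrite mmeasureE.
Qed.
End Generation.
End Hilbert.

(** * Adjugates, the polarized determinant and interpolation *)

Section Adjugate.
Variable K : comNzRingType.
Implicit Types A B : 'M[K]_3.

Lemma adj3E A i j : (\adj A) i j =
  A (j + 1) (i + 1) * A (j + 2) (i + 2) - A (j + 1) (i + 2) * A (j + 2) (i + 1).
Proof.
pose f k l := A (inord k) (inord l).
have AE k l : A k l = f k l by rewrite /f !inord_val.
rewrite !mxE /cofactor (expand_det_row _ 0) !big_ord_recl big_ord0 /cofactor !det_mx11 !mxE !AE.
by move: i j; do 2!apply: ord3P; rewrite /= /bump /= ?expr0 ?expr1; ring.
Qed.

Lemma cross_adjE A B : cross A B = (\adj (A + B) - \adj A - \adj B)^T.
Proof.
apply/matrixP => i j; rewrite crossE tr3mxE !(add3mxE, opp3mxE) !adj3E !add3mxE; ring.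
Qed.
End Adjugate.

Lemma lin3E (K : comNzRingType) (a b c : K) (A B D : 'M[K]_3) i j :
  (a *: A + b *: B + c *: D) i j = a * A i j + b * B i j + c * D i j.
Proof. by rewrite !mxE. Qed.

Section PolarDet.
Variable R : realType.
Notation C := R[i].

Lemma coef_monomial (c : C) (i j k : 'I_3) :
  (c%:MP * ('X_i * 'X_j * 'X_k) : {mpoly C[3]})@_[multinom 1%N | _ < 3] =
  c * (uniq [:: i; j; k])%:R.
Proof.
rewrite -!mpolyXD mcoeffCM mcoeffX; congr (_ * (nat_of_bool _)%:R).
have eqE (m m' : 'X_{1..3}) : (m == m') = [&& m 0 == m' 0, m 1 == m' 1 & m 2 == m' 2].
  apply/eqP/and3P => [-> //|[/eqP e0 /eqP e1 /eqP e2]].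
  by apply/mnmP; apply: ord3P.
rewrite eqE !mnmDE !mnm1E !mnmE.
by move: i j k; do 3!apply: ord3P.
Qed.

Lemma coef_product (u v w : 'I_3 -> C) :
  ((\sum_i 'X_i * (u i)%:MP) * (\sum_i 'X_i * (v i)%:MP) * (\sum_i 'X_i * (w i)%:MP)
    : {mpoly C[3]})@_[multinom 1%N | _ < 3] =
  u 0 * v 1 * w 2 + u 0 * v 2 * w 1 + u 1 * v 0 * w 2 + u 1 * v 2 * w 0
  + u 2 * v 0 * w 1 + u 2 * v 1 * w 0.
Proof.
transitivity (\sum_i \sum_k \sum_j (u i * v j * w k) * (uniq [:: i; j; k])%:R).
  rewrite !mulr_suml raddf_sum; apply: eq_bigr => i _; rewrite /= mulr_sumr raddf_sum.
  apply: eq_bigr => k _; rewrite /= mulr_sumr mulr_suml raddf_sum; apply: eq_bigr => j _ /=.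
  rewrite -coef_monomial !mpolyCM; congr (_@_ _); ring.
rewrite !sum3E /=; ring.
Qed.

Lemma mcoeff6 (p1 p2 p3 p4 p5 p6 : {mpoly C[3]}) m :
  (p1 - p2 - p3 + p4 + p5 - p6)@_m = p1@_m - p2@_m - p3@_m + p4@_m + p5@_m - p6@_m.
Proof. by rewrite !(mcoeffB, mcoeffD). Qed.

Lemma polar_detE (x y z : sym3 R) : polar_det x y z = theta (x : 'M[C]_3) y z.
Proof.
rewrite /polar_det; set A := (X in \det X).
pose e (i j : 'I_3) (m : 'I_3) : C := [:: (x : 'M[C]_3) i j; (y : 'M[C]_3) i j; (z : 'M[C]_3) i j]`_m.
have AE i j : A i j = \sum_m 'X_m * (e i j m)%:MP.
  by rewrite sum3E lin3E; congr (_ * _ + _ * _ + _ * _); rewrite mxE.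
have eA i j k l m n : (A i j * A k l * A m n)@_[multinom 1%N | _ < 3] =
  e i j 0 * e k l 1 * e m n 2 + e i j 0 * e k l 2 * e m n 1 + e i j 1 * e k l 0 * e m n 2
  + e i j 1 * e k l 2 * e m n 0 + e i j 2 * e k l 0 * e m n 1 + e i j 2 * e k l 1 * e m n 0.
  by rewrite !AE coef_product.
rewrite det3E mcoeff6 6!eA /theta !mx3E /e /=.
ring.
Qed.
End PolarDet.

Section Interpolation.
Variable F : numFieldType.

(** The weights are the values at 0 of the Lagrange polynomials of
    sufficiently many points outside the roots of p. *)
Lemma interpolation D (p : {poly F}) : p != 0 -> exists (s : seq F) (c : F -> F),
  (forall t, t \in s -> p.[t] != 0) /\
  forall q : {poly F}, (size q <= D)%N -> q.[0] = \sum_(t <- s) c t * q.[t].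
Proof.
move=> p0; pose l := [seq (n%:R : F) | n <- iota 0 (D + size p)].
have ul : uniq l by rewrite map_inj_uniq ?iota_uniq // => n m /eqP; rewrite eqr_nat => /eqP.
pose s := [seq t <- l | ~~ root p t]; exists s.
have us : uniq s by rewrite filter_uniq.
have Ds : (D <= size s)%N.
  have e : (count (root p) l + size s = D + size p)%N.
    by rewrite /s size_filter -(size_iota 0 (D + size p)) -(size_map (fun n => n%:R : F)); exact: count_predC.
  have : (count (root p) l < size p)%N.
    rewrite -size_filter; apply: max_poly_roots => //; last by rewrite filter_uniq.
    by apply/allP => t; rewrite mem_filter => /andP[].
  by move: e; lia.
pose L t : {poly F} := (\prod_(a <- s | a != t) (t - a)^-1) *: \prod_(a <- s | a != t) ('X - a%:P).
exists (fun t => (L t).[0]); split=> [t|q sq].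
  by rewrite mem_filter => /andP[].
have Lt t u : t \in s -> u \in s -> (L t).[u] = (t == u)%:R.
  move=> ts uss; rewrite /L hornerZ horner_prod.
  case: (eqVneq t u) => [<-|tu].
    rewrite -big_split /= big1 // => a nat'; rewrite hornerXsubC mulVf // subr_eq0 eq_sym //.
  by rewrite [X in _ * X](big_rem u uss) /= eq_sym tu hornerXsubC subrr mul0r mulr0.
have size_prod_XsubC_seq t : t \in s -> size (\prod_(a <- s | a != t) ('X - a%:P)) = size s.
  move=> ts; rewrite -big_filter size_prod_XsubC -rem_filter // size_rem //.
  by case: (s) ts.
have q0 : q - \sum_(t <- s) q.[t] *: L t = 0.
  apply/eqP; apply: contraT => n0.
  have := @max_poly_roots _ _ s n0 _ us; rewrite ltnNge.
  have -> : (size (q - \sum_(t <- s) q.[t] *: L t)%R <= size s)%N.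
    rewrite (leq_trans (size_polyD _ _)) // geq_max (leq_trans sq Ds) size_polyN /=.
    apply: (leq_trans (size_sum _ _ _)); apply/bigmax_leqP_seq => t ts _.
    apply: (leq_trans (size_scale_leq _ _)); apply: (leq_trans (size_scale_leq _ _)).
    by rewrite size_prod_XsubC_seq.
  apply; apply/allP => u uss; apply/rootP; rewrite hornerD hornerN horner_sum (bigD1_seq u) //=.
  rewrite hornerZ Lt // eqxx mulr1 big_seq_cond big1 ?addr0 ?subrr // => t /andP[ts tu].
  by rewrite hornerZ Lt // (negPf tu) mulr0.
have := congr1 (fun r : {poly F} => r.[0]) q0.
rewrite horner0 hornerD hornerN horner_sum => /eqP; rewrite subr_eq0 => /eqP ->.
by apply: eq_bigr => t _; rewrite hornerZ mulrC.
Qed.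
End Interpolation.

(** * Polarizations *)

Section Polarizations.
Variable R : realType.
Notation C := R[i].
Notation N := #|{: 'I_4 * 'I_3 * 'I_3}|.
Notation P := {mpoly C[N]}.
Implicit Types (x y : copies R 4) (F : copies R 4 -> C).

Lemma meval_line (p : P) : exists D, forall u v : 'I_N -> C, exists q : {poly C},
  (size q <= D)%N /\ forall t, q.[t] = p.@[fun i => u i + t * v i].
Proof.
elim/mpoly_ring_ind: p => [c|i|p q [D hD] [D' hD']|p q [D hD] [D' hD']].
- by exists 1 => u v; exists c%:P; rewrite size_polyC leq_b1; split=> // t; rewrite hornerC mevalC.
- exists 2 => u v; exists ((u i)%:P + v i *: 'X); split=> [|t]; last first.
    by rewrite hornerD hornerC hornerZ hornerX mevalXU mulrC.
  rewrite (leq_trans (size_polyD _ _)) // geq_max (leq_trans (size_polyC_leq1 _)) //=.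
  by rewrite (leq_trans (size_scale_leq _ _)) // size_polyX.
- exists (maxn D D') => u v; have [a [sa ea]] := hD u v; have [b [sb eb]] := hD' u v.
  exists (a + b); split=> [|t]; last by rewrite hornerD ea eb; exact: esym (mevalD _ _ _).
  by rewrite (leq_trans (size_polyD _ _)) // geq_max !leq_max sa sb orbT.
- exists (D + D')%N => u v; have [a [sa ea]] := hD u v; have [b [sb eb]] := hD' u v.
  exists (a * b); split=> [|t]; last by rewrite hornerM ea eb; exact: esym (mevalM _ _ _).
  by rewrite (leq_trans (size_polyMleq _ _)) // (leq_trans (leq_pred _)) // leq_add.
Qed.

Lemma sym3_sum (J : Type) (l : seq J) (f : J -> sym3 R) :
  ((\sum_(m <- l) f m)%R : 'M[C]_3) = \sum_(m <- l) (f m : 'M[C]_3).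
Proof. by elim: l => [|m l IH]; rewrite ?big_nil // !big_cons -IH. Qed.

Lemma gl_actE (a : 'M[C]_4) x k :
  (gl_act a x k : 'M[C]_3) = \sum_m a k m *: (x m : 'M[C]_3).
Proof. by rewrite ffunE sym3_sum. Qed.

Lemma coords_gl_act (b : 'M[C]_4) t x v :
  coords (gl_act (b + t%:M) x) v = coords (gl_act b x) v + t * coords x v.
Proof.
rewrite /coords; case: (enum_val v) => [[k i] j].
rewrite !gl_actE !summxE (bigD1 k) //= [in RHS](bigD1 k) //= !mxE eqxx mulrDl.
rewrite -!addrA; congr (_ + _); rewrite addrC; congr (_ + _).
by apply: eq_bigr => m nm; rewrite !mxE eq_sym (negPf nm) addr0.
Qed.

Lemma unit_shift (b : 'M[C]_4) t : ~~ root (char_poly (- b)) t -> b + t%:M \in unitmx.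
Proof.
rewrite -eigenvalue_root_char /eigenvalue /eigenspace negbK kermx_eq0 row_free_unit.
by rewrite -opprD -scaleN1r unitmxZ // unitrN1.
Qed.

Section Submodule.
Variable M : set (copies R 4 -> C).
Hypothesis glM : gl_submodule M.

Lemma submodule_scale c F : M F -> M (fun x => c * F x). Proof. by case: glM => _ _ h _; exact: h. Qed.
Lemma submodule_add F H : M F -> M H -> M (fun x => F x + H x).
Proof. by case: glM => _ h _ _; exact: h. Qed.
Lemma submodule_sub F H : M F -> M H -> M (fun x => F x - H x).
Proof.
move=> hF hH; have := submodule_add hF (submodule_scale (-1) hH).
by congr M; apply/funext => x; rewrite mulN1r.
Qed.
Lemma submodule_sum (J : eqType) (s : seq J) (f : J -> copies R 4 -> C) :
  (forall j, j \in s -> M (f j)) -> M (fun x => \sum_(j <- s) f j x).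
Proof.
elim: s => [|j s IH] h.
  by case: glM => M0 _ _ _; congr M: M0; apply/funext => x; rewrite big_nil.
have hs : M (fun x => \sum_(j <- s) f j x).
  by apply: IH => k ks; apply: h; rewrite inE ks orbT.
by have := submodule_add (h j (mem_head _ _)) hs; congr M; apply/funext => x; rewrite big_cons.
Qed.

(** The matrix b + t is invertible for all but finitely many scalars t, and
    the value at t = 0 is a linear combination of the values at some of those,
    by interpolation. *)
Lemma submodule_subst F (b : 'M[C]_4) : polynomial_function F -> M F ->
  M (fun x => F (gl_act b x)).
Proof.
move=> [p hp] MF; have [D hD] := meval_line p.
have [s [c [hs hint]]] := interpolation D (monic_neq0 (char_poly_monic (- b))).
have Mt t : t \in s -> M (fun x => F (gl_act (b + t%:M) x)).
  move=> ts; case: glM => _ _ _ h; rewrite -[b + _]invmxK; apply: h => //.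
  by rewrite unitmx_inv unit_shift // rootE hs.
have : M (fun x => \sum_(t <- s) c t * F (gl_act (b + t%:M) x)).
  by apply: submodule_sum => t ts; apply: submodule_scale; exact: Mt.
congr M; apply/funext => x.
have [q [sq eq]] := hD (coords (gl_act b x)) (coords x).
have e t : F (gl_act (b + t%:M) x) = q.[t].
  by rewrite hp eq; apply: meval_eq => v; exact: coords_gl_act.
have -> : F (gl_act b x) = q.[0] by rewrite -e -[in LHS](addr0 b) -scalemx1 scale0r.
by rewrite hint //; apply: eq_bigr => t _; rewrite e.
Qed.

Notation row_sums l := (\matrix_(r < 4, c < 4) (count_mem c (l r))%:R : 'M[C]_4).

Lemma gl_act_row_sums (l : 'I_4 -> seq 'I_4) x k :
  (gl_act (row_sums l) x k : 'M[C]_3) = \sum_(i <- l k) (x i : 'M[C]_3).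
Proof.
rewrite gl_actE; under eq_bigr do rewrite mxE.
elim: (l k) => [|i s IH]; first by rewrite big_nil big1 // => m _; rewrite scale0r.
rewrite big_cons -IH; under eq_bigr do rewrite /= natrD scalerDl.
rewrite big_split /=; congr (_ + _); rewrite (bigD1 i) //= eqxx scale1r big1 ?addr0 //.
by move=> m nm; rewrite eq_sym (negPf nm) scale0r.
Qed.

Lemma pf_ext F H : polynomial_function F -> H = F -> polynomial_function H.
Proof. by move=> h ->. Qed.

Lemma gfun_pf t : polynomial_function (@gfun R t).
Proof. by exists (generator (@gen R) t) => x; rewrite gfun_eval. Qed.

Notation ext1 := (extend_vars (isT : (1 <= 4)%N)).
Notation ext3 := (extend_vars (isT : (3 <= 4)%N)).
Notation w1 := (widen_ord (isT : (1 <= 4)%N)).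
Notation w3 := (widen_ord (isT : (3 <= 4)%N)).

Lemma det_funE : ext1 (@det_fun R) =
  fun x => 6^-1 * gfun (inl (w1 ord0, w1 ord0, w1 ord0)) x.
Proof.
apply/funext => x; rewrite /extend_vars /det_fun ffunE /gfun /generator.
have -> (A : 'M[C]_3) : theta A A A = 6 * \det A.
  by rewrite det3E /theta !mx3E; gen9 A; ring.
by rewrite mulKf // pnatr_eq0.
Qed.

Lemma polar_det_adj_funE : ext3 (@polar_det_adj_fun R) =
  fun x => theta (\adj (x (w3 0) : 'M[C]_3)) (\adj (x (w3 1) : 'M[C]_3)) (\adj (x (w3 2%R) : 'M[C]_3)).
Proof. by apply/funext => x; rewrite /extend_vars /polar_det_adj_fun !ffunE polar_detE. Qed.

Lemma polar_det_adj_gfun : ext3 (@polar_det_adj_fun R) =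
  fun x => 8^-1 * gfun (inr (w3 0, w3 0, w3 1, (w3 1, w3 2%R, w3 2%R))) x.
Proof.
rewrite polar_det_adj_funE; apply/funext => x; rewrite /gfun /generator.
have e k : cross (x k : 'M[C]_3) (x k) = 2 *: \adj (x k : 'M[C]_3).
  rewrite -[in RHS](tr_sym3 (x k)) -trmx_adj; apply/matrixP => i j.
  by rewrite crossE scale3mxE tr3mxE adj3E; ring.
rewrite !e thetaZl thetaZm thetaZr; apply: (mulfI (_ : 8 != 0 :> C)); first by rewrite pnatr_eq0.
rewrite mulVKf ?pnatr_eq0 //; ring.
Qed.

Section Cubic.
Hypothesis M_det : M (ext1 (@det_fun R)).

Lemma submodule_det_sum (l : seq 'I_4) : M (fun x => \det (\sum_(i <- l) (x i : 'M[C]_3))).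
Proof.
have pf : polynomial_function (ext1 (@det_fun R)).
  by apply: (pf_ext _ det_funE); apply: pf_mul; [exact: pf_const|exact: gfun_pf].
have := submodule_subst (row_sums (fun=> l)) pf M_det; congr M; apply/funext => x.
by rewrite /extend_vars /det_fun ffunE gl_act_row_sums.
Qed.

(** theta is an alternating sum of determinants of sums, theta_det. *)
Lemma submodule_cubic i j k : M (gfun (inl (i, j, k))).
Proof.
have d := submodule_det_sum; have := submodule_add (submodule_add (submodule_add (submodule_sub (submodule_sub (submodule_sub
  (d [:: i; j; k]) (d [:: i; j])) (d [:: i; k])) (d [:: j; k])) (d [:: i])) (d [:: j])) (d [:: k]).
congr M; apply/funext => x; rewrite /gfun /generator theta_det.
by rewrite !big_cons !big_nil !addr0 !addrA.
Qed.
End Cubic.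

Section Sextic.
Hypothesis M_polar : M (ext3 (@polar_det_adj_fun R)).

Lemma submodule_theta_adj (l0 l1 l2 : seq 'I_4) :
  M (fun x => theta (\adj (\sum_(i <- l0) (x i : 'M[C]_3)))
    (\adj (\sum_(i <- l1) (x i : 'M[C]_3))) (\adj (\sum_(i <- l2) (x i : 'M[C]_3)))).
Proof.
have pf : polynomial_function (ext3 (@polar_det_adj_fun R)).
  by apply: (pf_ext _ polar_det_adj_gfun); apply: pf_mul; [exact: pf_const|exact: gfun_pf].
have := submodule_subst (row_sums (fun r : 'I_4 => nth [::] [:: l0; l1; l2] r)) pf M_polar.
by congr M; rewrite polar_det_adj_funE; apply/funext => x; rewrite !gl_act_row_sums.
Qed.

(** cross is an alternating sum of adjugates of sums, cross_adjE, and this is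
    used in one argument of theta after the other. *)
Lemma submodule_sextic t : M (gfun (inr t)).
Proof.
move: t => [[[i j] k] [[l m] n]].
pose s (a : seq 'I_4) x : 'M[C]_3 := \adj (\sum_(i <- a) (x i : 'M[C]_3)).
have crE a b x : cross (x a : 'M[C]_3) (x b) = s [:: a; b] x - s [:: a] x - s [:: b] x.
  rewrite -(tr_sym3 (x a)) -(tr_sym3 (x b)) -trmx_cross cross_adjE trmxK /s.
  by rewrite !big_cons !big_nil !addr0.
have thB A B Y Z : theta (A - B : 'M[C]_3) Y Z = theta A Y Z - theta B Y Z.
  by rewrite thetaDl -scaleN1r thetaZl mulN1r.
have thBm A B Y Z : theta Y (A - B : 'M[C]_3) Z = theta Y A Z - theta Y B Z.
  by rewrite thetaDm -scaleN1r thetaZm mulN1r.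
have thBr A B Y Z : theta Y Z (A - B : 'M[C]_3) = theta Y Z A - theta Y Z B.
  by rewrite thetaDr -scaleN1r thetaZr mulN1r.
have h1 a b u v : M (fun x => theta (cross (x a : 'M[C]_3) (x b)) (s u x) (s v x)).
  have h := submodule_theta_adj; have := submodule_sub (submodule_sub (h [:: a; b] u v) (h [:: a] u v)) (h [:: b] u v).
  by congr M; apply/funext => x; rewrite crE !thB.
have h2 a b a' b' v : M (fun x => theta (cross (x a : 'M[C]_3) (x b)) (cross (x a' : 'M[C]_3) (x b')) (s v x)).
  have h := h1 a b; have := submodule_sub (submodule_sub (h [:: a'; b'] v) (h [:: a'] v)) (h [:: b'] v).
  by congr M; apply/funext => x; rewrite (crE a' b') !thBm.
have h := h2 i j k l; have := submodule_sub (submodule_sub (h [:: m; n]) (h [:: m])) (h [:: n]).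
by congr M; apply/funext => x; rewrite /gfun /generator (crE m n) !thBr.
Qed.
End Sextic.
End Submodule.

Lemma invariants_subalgebra : subalgebra (invariants R 4).
Proof.
split=> [c|F H [pF hF] [pH hH]|F H [pF hF] [pH hH]]; split.
- exact: pf_const.
- by [].
- exact: pf_add.
- by move=> g hg x; congr (_ + _); [exact: hF|exact: hH].
- exact: pf_mul.
- by move=> g hg x; congr (_ * _); [exact: hF|exact: hH].
Qed.

Lemma pf_gl_act (a : 'M[C]_4) F : polynomial_function F ->
  polynomial_function (fun x => F (gl_act a x)).
Proof.
move=> [p hp]; apply: (@pf_ext (fun x => p.@[coords (gl_act a x)])); last first.
  by apply/funext => x; rewrite hp.
elim/mpoly_ring_ind: p {hp F} => [c|v|p q hp hq|p q hp hq].
- by apply: (pf_ext (pf_const c)); apply/funext => x; rewrite mevalC.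
- case E: (enum_val v) => [[k i] j].
  have h : polynomial_function (fun x => \sum_m a k m * (x m : 'M[C]_3) i j).
    by apply: pf_sum => m; apply: pf_mul; [exact: pf_const|exact: pf_coord].
  apply: (pf_ext h); apply/funext => x; rewrite mevalXU /coords E gl_actE summxE.
  by apply: eq_bigr => m _; rewrite mxE.
- by apply: (pf_ext (pf_add hp hq)); apply/funext => x; exact: mevalD.
- by apply: (pf_ext (pf_mul hp hq)); apply/funext => x; exact: mevalM.
Qed.

Lemma acts_gl_act (a : 'M[C]_4) h x : gl_act a (acts h x) = acts h (gl_act a x).
Proof.
apply/ffunP => k; apply: val_inj; rewrite [acts h (gl_act a x) k]ffunE /=.
rewrite !gl_actE mulmx_sumr mulmx_suml; apply: eq_bigr => m _.
by rewrite ffunE /= -scalemxAr -scalemxAl.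
Qed.

Lemma invariants_gl_submodule : gl_submodule (invariants R 4).
Proof.
have [hc ha hm] := invariants_subalgebra; split=> // [c F hF|a F _ [pF hF]].
- exact: (hm (fun=> c)).
- split=> [|g hg x]; first exact: pf_gl_act.
  by rewrite -(hF g hg (gl_act _ x)); congr F; exact: acts_gl_act.
Qed.

Lemma gfun_invariants t : invariants R 4 (@gfun R t).
Proof. split; [exact: gfun_pf|exact: gfun_inv]. Qed.
End Polarizations.

Theorem proposition6p1 (R : realType) :
  invariants R 4 =
  generated_algebra
    (polarizations (isT : (1 <= 4)%N) (@det_fun R) `|`
     polarizations (isT : (3 <= 4)%N) (@polar_det_adj_fun R)).
Proof.
have [hc ha hm] := invariants_subalgebra R.
apply/seteqP; split=> F.
  case=> pF hF; apply: (generation _ _ pF hF).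
    split=> [c|A B hA hB|A B hA hB] S hS; have [[Sc Sa Sm] SG] := hS.
    - exact: Sc.
    - by apply: Sa; [exact: (hA S hS)|exact: (hB S hS)].
    - by apply: Sm; [exact: (hA S hS)|exact: (hB S hS)].
  move=> t S [_ SG]; apply: SG; case: t => [[[i j] k]|t]; [left|right] => M [glM MG].
    by apply: submodule_cubic => //; exact: MG.
  by apply: submodule_sextic => //; exact: MG.
apply; split; first exact: invariants_subalgebra.
move=> H [] hH; apply: hH; (split; first exact: invariants_gl_submodule).
  by move=> _ ->; rewrite det_funE; apply: (hm (fun=> _)); [exact: hc|exact: gfun_invariants].
by move=> _ ->; rewrite polar_det_adj_gfun; apply: (hm (fun=> _)); [exact: hc|exact: gfun_invariants].
Qed.
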